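(* Let $K,L\in\mathbb N$, let $(I_l)_{l=1}^L$ be a partition of $[0,1]$ into intervals of positive length, and let $(a,S)$ be piecewise $1/2$-Hölder continuous Kronecker data on $\mathcal A=\mathbb C^{K\times K}\otimes L^\infty[0,1]$ with respect to this partition (as defined in the context). Let $\rho$ be the self-consistent density of states for the Dyson equation with data pair $(a,S)$ and let $\tau\in\mathbb R\setminus\operatorname{supp}\rho$. Then $$\rho((-\infty,\tau))\in\Big\{\frac1K\sum_{l=1}^Lk_l|I_l|:\ k_l\in\{0,1,\dots,K\}\text{ for }l=1,\dots,L\Big\}.$$ In particular, in the case $L=1$, when $s^\mu,t^\nu$ and $a$ are $1/2$-Hölder continuous on all of $[0,1]^2$ and $[0,1]$, respectively, $\rho(J)$ is an integer multiple of $1/K$ for every connected component $J$ of $\operatorname{supp}\rho$, and there are at most $K$ such components.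
   Context: Kronecker data. $\mathcal A=\mathbb C^{K\times K}\otimes L^\infty[0,1]$ with tracial state $\langle\kappa\otimes f\rangle=\frac{\operatorname{Tr}\kappa}{K}\int_0^1f(x)\,\mathrm dx$. Let $\alpha_1,\dots,\alpha_{\ell_1}\in\mathbb C^{K\times K}$ be self-adjoint and $\beta_1,\dots,\beta_{\ell_2}\in\mathbb C^{K\times K}$ arbitrary. Let $s^\mu,t^\nu:[0,1]^2\to[0,\infty)$ ($\mu\le\ell_1,\nu\le\ell_2$) be functions that are Hölder continuous with exponent $1/2$ on each rectangle $I_l\times I_k$, with $s^\mu(x,y)=s^\mu(y,x)$. Define the self-energy operator $S:\mathcal A\to\mathcal A$ by $$S(\kappa\otimes f):=\sum_{\mu=1}^{\ell_1}\alpha_\mu\kappa\alpha_\mu\otimes S_\mu f+\sum_{\nu=1}^{\ell_2}\big(\beta_\nu\kappa\beta_\nu^*\otimes T_\nu f+\beta_\nu^*\kappa\beta_\nu\otimes T_\nu^*f\big),$$ where $(S_\mu f)(x)=\int_0^1s^\mu(x,y)f(y)\,\mathrm dy$, $(T_\nu f)(x)=\int_0^1t^\nu(x,y)f(y)\,\mathrm dy$, $(T_\nu^*f)(x)=\int_0^1t^\nu(y,x)f(y)\,\mathrm dy$. Let $a=a^*\in\mathcal A$ be given by a function $a:[0,1]\to\mathbb C^{K\times K}$ that is $1/2$-Hölder continuous on each $I_l$. The Dyson equation with data pair $(a,S)$ is $-m(z)^{-1}=z\mathbf 1-a+S[m(z)]$ for $z$ in the upper half-plane; it has a unique solution $m$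 with values in $\mathcal A$ and $\operatorname{Im}m(z)$ positive definite. $\langle m(z)\rangle$ is the Stieltjes transform $\int_{\mathbb R}\frac{\rho(\mathrm d\tau)}{\tau-z}$ of a probability measure $\rho$ on $\mathbb R$, the self-consistent density of states. $|I_l|$ is the length of $I_l$. *)

(* Defs.v *)
From HB Require Import structures.
From mathcomp Require Import all_boot all_order all_algebra.
From mathcomp Require Import sesquilinear spectral.
From mathcomp Require Import all_classical all_reals all_analysis.
From mathcomp Require Import complex.

Set Implicit Arguments.
Unset Strict Implicit.
Unset Printing Implicit Defensive.

Import Order.TTheory GRing.Theory Num.Theory.
Import numFieldNormedType.Exports.


Local Open Scope classical_set_scope.
Local Open Scope ring_scope.
Local Open Scope complex_scope.
Local Open Scope sesquilinear_scope.

Definition cintegral (R : realType) (d : measure_display) (T : measurableType d)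
    (mu : {measure set T -> \bar R}) (D : set T) (f : T -> R[i]) : R[i] :=
  (\int[mu]_(x in D) complex.Re (f x)) +i* (\int[mu]_(x in D) complex.Im (f x)).

Definition leb (R : realType) : {measure set (measurableTypeR R) -> \bar R} :=
  @lebesgue_measure R.

Definition hoelder_on (R : realType) (V : normedModType R) (W : normedZmodType R)
    (gamma : R) (A : set V) (f : V -> W) : Prop :=
  exists C : R, forall x y, A x -> A y -> `|f x - f y| <= C * `|x - y| `^ gamma.

(* Elements of the algebra of K x K matrices over L^oo[0,1] are represented by
   functions R -> 'M[R[i]]_K: only the values on [0,1] matter, and equality in
   the algebra is almost everywhere equality on [0,1]. *)

Definition linfty_mx (R : realType) (K : nat) (r : R -> 'M[R[i]]_K) : Prop :=
  forall i j,
    [/\ measurable_fun `[0 : R, 1] (fun x => complex.Re (r x i j)),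
        measurable_fun `[0 : R, 1] (fun x => complex.Im (r x i j))
      & exists M : R,
          \forall x \ae leb R, 0 <= x <= 1 -> Normc.normc (r x i j) <= M].

(* A bilinear map on pairs (matrix, function), extended linearly from the simple
   tensors: r is the sum over (i, j) of delta_mx i j (x) (x |-> r x i j). *)
Definition tensor_lift (R : realType) (K : nat) (V : zmodType)
    (Phi : 'M[R[i]]_K -> (R -> R[i]) -> V) (r : R -> 'M[R[i]]_K) : V :=
  \sum_(i < K) \sum_(j < K) Phi (delta_mx i j) (fun x => r x i j).

Definition tracial_state (R : realType) (K : nat) (r : R -> 'M[R[i]]_K) : R[i] :=
  tensor_lift (fun kappa f => \tr kappa / K%:R * cintegral (leb R) `[0, 1] f) r.

Definition mx_im (R : realType) (K : nat) (A : 'M[R[i]]_K) : 'M[R[i]]_K :=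
  (2%:R * 'i)^-1 *: (A - A ^t*).

(* In R[i], 0 <= z means that z is real and nonnegative. *)
Definition mx_psd (R : realType) (K : nat) (A : 'M[R[i]]_K) : Prop :=
  forall v : 'cV[R[i]]_K, 0 <= (v ^t* *m A *m v) 0 0.

(* Positive definite as an element of the algebra, i.e. positive with spectrum
   bounded away from 0, hence the uniform lower bound. *)
Definition alg_posdef (R : realType) (K : nat) (r : R -> 'M[R[i]]_K) : Prop :=
  exists2 eps : R, 0 < eps &
    \forall x \ae leb R, 0 <= x <= 1 -> mx_psd (r x - (eps%:C)%:M).

Record kronecker_data (R : realType) (K l1 l2 : nat) := KroneckerData {
  kd_alpha : 'I_l1 -> 'M[R[i]]_K;
  kd_beta : 'I_l2 -> 'M[R[i]]_K;
  kd_s : 'I_l1 -> R * R -> R;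
  kd_t : 'I_l2 -> R * R -> R;
  kd_a : R -> 'M[R[i]]_K
}.

Definition kernel_op (R : realType) (k : R * R -> R) (f : R -> R[i]) (x : R) :
    R[i] :=
  cintegral (leb R) `[0, 1] (fun y => (k (x, y))%:C * f y).

Definition self_energy (R : realType) (K l1 l2 : nat)
    (d : kronecker_data R K l1 l2) (r : R -> 'M[R[i]]_K) (x : R) : 'M[R[i]]_K :=
  tensor_lift (fun kappa f =>
    \sum_(mu < l1) kernel_op (kd_s d mu) f x *:
        (kd_alpha d mu *m kappa *m kd_alpha d mu)
    + \sum_(nu < l2)
        (kernel_op (kd_t d nu) f x *:
           (kd_beta d nu *m kappa *m (kd_beta d nu) ^t*)
         + kernel_op (fun p => kd_t d nu (p.2, p.1)) f x *:
           ((kd_beta d nu) ^t* *m kappa *m kd_beta d nu))) r.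

Definition interval_partition (R : realType) (L : nat) (I : 'I_L -> set R) : Prop :=
  [/\ partition [set: 'I_L] I `[0, 1],
      (forall l, is_interval (I l))
    & (forall l, (0 < leb R (I l))%E)].

(* [Rcomplex R] is [R[i]] seen as a normed space over [R]; Hoelder continuity of
   the matrix-valued function is entrywise, as all norms on 'M_K are equivalent. *)
Definition piecewise_hoelder (R : realType) (K l1 l2 L : nat) (I : 'I_L -> set R)
    (d : kronecker_data R K l1 l2) : Prop :=
  [/\ (forall mu, kd_alpha d mu \is hermsymmx),
      (forall mu, [/\ forall x y : R, 0 <= x <= 1 -> 0 <= y <= 1 ->
                        0 <= kd_s d mu (x, y),
                      forall x y : R, 0 <= x <= 1 -> 0 <= y <= 1 ->
                        kd_s d mu (x, y) = kd_s d mu (y, x)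
                    & forall l k,
                        hoelder_on 2^-1 (I l `*` I k) (kd_s d mu)]),
      (forall nu, (forall x y : R, 0 <= x <= 1 -> 0 <= y <= 1 ->
                     0 <= kd_t d nu (x, y)) /\
                  (forall l k, hoelder_on 2^-1 (I l `*` I k) (kd_t d nu))),
      (\forall x \ae leb R, 0 <= x <= 1 -> kd_a d x \is hermsymmx)
    & (forall l i j,
         hoelder_on 2^-1 (I l) (fun x : R => kd_a d x i j : Rcomplex R))].

Definition dyson_solution (R : realType) (K l1 l2 : nat)
    (d : kronecker_data R K l1 l2) (m : R[i] -> R -> 'M[R[i]]_K) : Prop :=
  forall z : R[i], 0 < complex.Im z ->
    [/\ linfty_mx (m z),
        alg_posdef (fun x => mx_im (m z x))
      & \forall x \ae leb R, 0 <= x <= 1 ->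
          m z x \in unitmx /\
          - invmx (m z x) = z%:M - kd_a d x + self_energy d (m z) x].

Definition stieltjes (R : realType) (rho : probability (measurableTypeR R) R)
    (z : R[i]) : R[i] :=
  cintegral rho setT (fun t : measurableTypeR R => (t%:C - z)^-1).

Definition self_consistent_dos (R : realType) (K l1 l2 : nat)
    (d : kronecker_data R K l1 l2) (rho : probability (measurableTypeR R) R) : Prop :=
  exists2 m, dyson_solution d m &
    forall z : R[i], 0 < complex.Im z -> tracial_state (m z) = stieltjes rho z.

Definition msupport (R : realType) (mu : {measure set (measurableTypeR R) -> \bar R}) :
    set R :=
  [set x : R | forall U : set R, open U -> U x -> (0 < mu U)%E].

Definition components (R : realType) (A : set R) : set (set R) :=
  [set connected_component A x | x in A].

(* Main.v *)
Require Import Defs.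
From HB Require Import structures.
From mathcomp Require Import all_boot all_order all_algebra.
From mathcomp Require Import fingroup perm sesquilinear spectral.
From mathcomp Require Import all_classical all_reals all_analysis.
From mathcomp Require Import complex measurable_realfun ring lra.

Set Implicit Arguments.
Unset Strict Implicit.
Unset Printing Implicit Defensive.

Import Order.TTheory GRing.Theory Num.Theory.
Import numFieldNormedType.Exports.

Local Open Scope classical_set_scope.
Local Open Scope card_scope.
Local Open Scope ring_scope.
Local Open Scope complex_scope.
Local Open Scope sesquilinear_scope.

(** The masses are quantized because the argument of a determinant is.

Write E for the integral over [0,1] and, at z = tau + i eta with eta > 0, put
G = z - a + S[m] = - m^-1. The matrix G(x) has positive definite imaginary part, so
det G(x) has a continuous logarithm whose imaginary part [argdet] lies in [0, K pi]. As a
function of eta, the potential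
   Theta + Quad = E (argdet G) + 1/2 Im E tr (m S[m])
has derivative - Re E tr m: the variation of m contributes - Im E tr (m S[dm]) to the
first term and, S being symmetric for the trace, the opposite amount to the second. Since
E tr m = K int (t - z)^-1 rho(dt), this is also the derivative of K times
   int (pi/2 - atan ((tau - t) / eta)) rho(dt),
and both functions tend to K pi/2 at infinity, so they agree ([potential_identity]).
When eta tends to 0 the last integral tends to pi rho(]tau, +oo[) if tau is not an atom
([logpot_zero]).

No derivative with respect to eta is taken. Two solutions at z1 and z2 are compared
directly ([sol_lip], a matrix form of the Schwarz-Pick lemma obtained by iterating the
identity m1 - m2 = m1 (z1 - z2 + S[m1 - m2]) m2), the potential is expanded to first order
with a quadratic error ([potential_step]), and a function with |f s - f t| <= c (s - t)^2
is constant ([sq_const]).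

Let tau lie outside the support. Then E (Im tr m) = O(eta), hence E |m|^2 = O(1), so that
S[m], and with it G, is bounded and piecewise 1/2-Hoelder uniformly in eta. If |m| were
very large near some x0 of I_l, the Hoelder bound on G would give
|m(x)|^2 >= c / |x - x0| on a large range of scales, contradicting E |m|^2 = O(1); here the
exponent 1/2 is exactly what makes the integral diverge ([log_divergence], [gap_bound]).
With m and G bounded, the imaginary part of det G is O(eta) while |det G| stays away from 0
([gap_sin]), and Quad = O(eta) ([gap_quad]). So argdet G(x) is close to a multiple of pi,
and by continuity to the same multiple k_l pi throughout I_l ([near_multiple_itv]).
Integrating over x and letting eta tend to 0 gives
pi K rho(]tau, +oo[) = pi sum_l k_l |I_l| ([gap_mass]).

The given solution is only an element of L^oo. It agrees almost everywhere with
M = - G^-1, which solves the equation at every point and is piecewise Hoelder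
([sol_of_ae]); all the analysis is done on M.

For L = 1 the function rho(]-oo, tau[) takes finitely many values j/K on the complement of
the support. The mass to the left of a component, and the mass up to its right end, are
therefore attained at points of the complement unless they are 0, respectively 1
([left_mass], [upto_mass]), so every component has mass n/K. Components are separated by
gaps, and the mass to the left increases strictly from one to the next while staying below
1; this injects them into {0, .., K-1} ([components_card]). *)

(** * Complex numbers and matrices with positive imaginary part *)

Section Cplx.
Import Normc.
Context {R : realType}.
Implicit Types z w : R[i].

(** The canonical norm of R[i] takes its values in R[i]; this one is real-valued. *)
Definition cabs z : R := Normc.normc z.
Lemma cabs0 : cabs 0 = 0. Proof. exact: normc0. Qed.
Lemma cabs1 : cabs 1 = 1. Proof. exact: normc1. Qed.
Lemma cabsM z w : cabs (z * w) = cabs z * cabs w. Proof. exact: normcM. Qed.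
Lemma cabsN z : cabs (- z) = cabs z. Proof. exact: normcN. Qed.
Lemma cabsV z : cabs z^-1 = (cabs z)^-1. Proof. exact: normcV. Qed.
Lemma le_cabsD z w : cabs (z + w) <= cabs z + cabs w. Proof. exact: le_normcD. Qed.
Lemma eq0_cabs z : cabs z = 0 -> z = 0. Proof. exact: eq0_normc. Qed.

Lemma Re_conj z : complex.Re (Num.conj z) = complex.Re z.
Proof. by case: z. Qed.
Lemma Im_conj z : complex.Im (Num.conj z) = - complex.Im z.
Proof. by case: z. Qed.
Lemma ReD z w : complex.Re (z + w) = complex.Re z + complex.Re w.
Proof. by case: z => a b; case: w. Qed.
Lemma ImD z w : complex.Im (z + w) = complex.Im z + complex.Im w.
Proof. by case: z => a b; case: w. Qed.
Lemma ReN z : complex.Re (- z) = - complex.Re z.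
Proof. by case: z. Qed.
Lemma ImN z : complex.Im (- z) = - complex.Im z.
Proof. by case: z. Qed.
Lemma ReB z w : complex.Re (z - w) = complex.Re z - complex.Re w.
Proof. by rewrite ReD ReN. Qed.
Lemma ImB z w : complex.Im (z - w) = complex.Im z - complex.Im w.
Proof. by rewrite ImD ImN. Qed.
Lemma ReM z w : complex.Re (z * w) = complex.Re z * complex.Re w - complex.Im z * complex.Im w.
Proof. by case: z => a b; case: w. Qed.
Lemma ImM z w : complex.Im (z * w) = complex.Re z * complex.Im w + complex.Im z * complex.Re w.
Proof. by case: z => a b; case: w. Qed.
Lemma Re_sum (I : Type) (r : seq I) (P : pred I) (F : I -> R[i]) :
  complex.Re (\sum_(i <- r | P i) F i) = \sum_(i <- r | P i) complex.Re (F i).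
Proof. by apply: (big_morph _ ReD). Qed.
Lemma Im_sum (I : Type) (r : seq I) (P : pred I) (F : I -> R[i]) :
  complex.Im (\sum_(i <- r | P i) F i) = \sum_(i <- r | P i) complex.Im (F i).
Proof. by apply: (big_morph _ ImD). Qed.
Lemma ReMc (a : R) z : complex.Re (a%:C * z) = a * complex.Re z.
Proof. by rewrite ReM /= mul0r subr0. Qed.
Lemma ImMc (a : R) z : complex.Im (a%:C * z) = a * complex.Im z.
Proof. by rewrite ImM /= mul0r addr0. Qed.
Lemma cabs_ge0 z : 0 <= cabs z.
Proof. by case: z => a b; rewrite /cabs /= sqrtr_ge0. Qed.
Lemma cabs_sqr z : cabs z ^+ 2 = complex.Re z ^+ 2 + complex.Im z ^+ 2.
Proof. by case: z => a b; rewrite /cabs /= sqr_sqrtr // addr_ge0 // sqr_ge0. Qed.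
Lemma le_Re_cabs z : `|complex.Re z| <= cabs z.
Proof.
by case: z => a b; rewrite /cabs /= -sqrtr_sqr ler_wsqrtr // lerDl sqr_ge0.
Qed.

Lemma le_Im_cabs z : `|complex.Im z| <= cabs z.
Proof.
by case: z => a b; rewrite /cabs /= -sqrtr_sqr ler_wsqrtr // lerDr sqr_ge0.
Qed.

Lemma cabs_le_ReIm z : cabs z <= `|complex.Re z| + `|complex.Im z|.
Proof.
rewrite -ler_sqr ?nnegrE ?cabs_ge0 ?addr_ge0 // cabs_sqr sqrrD !real_normK ?num_real //.
by rewrite addrAC lerDl mulrn_wge0 // mulr_ge0.
Qed.

Lemma cabsJ z : cabs (Num.conj z) = cabs z.
Proof. by case: z => a b; rewrite /cabs /= sqrrN. Qed.
Lemma cabs_le_sum (I : Type) (r : seq I) (P : pred I) (F : I -> R[i]) :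
  cabs (\sum_(i <- r | P i) F i) <= \sum_(i <- r | P i) cabs (F i).
Proof.
elim/big_ind2: _ => [|x a y b xa yb|//]; first by rewrite cabs0.
by rewrite (le_trans (le_cabsD _ _)) // lerD.
Qed.

Lemma cabs_real (a : R) : cabs a%:C = `|a|.
Proof. by rewrite /cabs /= expr0n addr0 sqrtr_sqr. Qed.
Lemma ler_cabsB z w : cabs (z - w) <= cabs z + cabs w.
Proof. by rewrite (le_trans (le_cabsD _ _)) ?cabsN. Qed.
Lemma cabs_gt0 z : z != 0 -> 0 < cabs z.
Proof.
move=> z0; rewrite lt_def cabs_ge0 andbT; apply/eqP => /eq0_cabs e.
by rewrite e eqxx in z0.
Qed.

Lemma mulJ_cabs z : Num.conj z * z = (cabs z ^+ 2)%:C.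
Proof.
rewrite cabs_sqr; case: z => a b; apply/eqP; rewrite eq_complex /=.
by apply/andP; split; apply/eqP; ring.
Qed.
End Cplx.

Section Forms.
Context {R : realType}.
Notation C := R[i].

Definition dot n (u v : 'cV[C]_n) : C := (u^t* *m v) 0 0.
Definition nsq n (u : 'cV[C]_n) : R := \sum_i cabs (u i 0) ^+ 2.
Definition mxle m n (A : 'M[C]_(m, n)) (c : R) := forall i j, cabs (A i j) <= c.
Definition imge n (c : R) (A : 'M[C]_n) :=
  forall u : 'cV[C]_n, c * nsq u <= complex.Im (dot u (A *m u)).

Lemma dotE n (u v : 'cV[C]_n) : dot u v = \sum_i Num.conj (u i 0) * v i 0.
Proof. by rewrite /dot mxE; apply: eq_bigr => i _; rewrite !mxE. Qed.
Lemma dotDr n (u v w : 'cV[C]_n) : dot u (v + w) = dot u v + dot u w.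
Proof. by rewrite /dot mulmxDr mxE. Qed.
Lemma dotNr n (u v : 'cV[C]_n) : dot u (- v) = - dot u v.
Proof. by rewrite /dot mulmxN mxE. Qed.
Lemma dotZr n a (u v : 'cV[C]_n) : dot u (a *: v) = a * dot u v.
Proof. by rewrite /dot -scalemxAr mxE. Qed.
Lemma dot_conj n (u v : 'cV[C]_n) : Num.conj (dot u v) = dot v u.
Proof.
by rewrite !dotE rmorph_sum; apply: eq_bigr => i _; rewrite rmorphM /= conjCK mulrC.
Qed.

Lemma dotDl n (u v w : 'cV[C]_n) : dot (u + v) w = dot u w + dot v w.
Proof. by rewrite -dot_conj dotDr rmorphD /= !dot_conj. Qed.

Lemma dotZl n a (u v : 'cV[C]_n) : dot (a *: u) v = Num.conj a * dot u v.
Proof. by rewrite -dot_conj dotZr rmorphM /= dot_conj. Qed.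
Lemma adjmxM m n p (A : 'M[C]_(m, n)) (B : 'M[C]_(n, p)) :
  (A *m B)^t* = B^t* *m A^t*.
Proof. by rewrite trmx_mul map_mxM. Qed.
Lemma adjmxK m n (A : 'M[C]_(m, n)) : (A^t*)^t* = A.
Proof. by apply/matrixP => i j; rewrite !mxE conjCK. Qed.
Lemma dot_adj m n (A : 'M[C]_(m, n)) u v : dot u (A *m v) = dot (A^t* *m u) v.
Proof. by rewrite /dot adjmxM adjmxK mulmxA. Qed.
Lemma dot_adjl m n (A : 'M[C]_(m, n)) u v : dot (A *m u) v = dot u (A^t* *m v).
Proof. by rewrite dot_adj adjmxK. Qed.
Lemma dot_self n (u : 'cV[C]_n) : dot u u = (nsq u)%:C.
Proof. by rewrite dotE rmorph_sum; apply: eq_bigr => i _; rewrite mulJ_cabs. Qed.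
Lemma nsq_ge0 n (u : 'cV[C]_n) : 0 <= nsq u.
Proof. by apply: sumr_ge0 => i _; rewrite sqr_ge0. Qed.
Lemma nsq_eq0 n (u : 'cV[C]_n) : nsq u = 0 -> u = 0.
Proof.
move=> /eqP; rewrite psumr_eq0 => [|i _]; last by rewrite sqr_ge0.
move=> /allP h; apply/matrixP => i j; rewrite ord1 mxE.
have /= := h i (mem_index_enum i); rewrite sqrf_eq0 => /eqP; exact: eq0_cabs.
Qed.

Lemma nsqN n (u : 'cV[C]_n) : nsq (- u) = nsq u.
Proof. by apply: eq_bigr => i _; rewrite mxE cabsN. Qed.

(** Weighted arithmetic-geometric mean inequality: the defect is a square. *)
Lemma amgm (a b c : R) : 0 < c -> 2 * (a * b) <= c * a ^+ 2 + c^-1 * b ^+ 2.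
Proof.
move=> c0; rewrite -subr_ge0.
have -> : c * a ^+ 2 + c^-1 * b ^+ 2 - 2 * (a * b) = c * (a - c^-1 * b) ^+ 2.
  by field; rewrite gt_eqF.
by rewrite mulr_ge0 ?sqr_ge0 // ltW.
Qed.

Lemma form_le n (A : 'M[C]_n) (M t : R) u v : 0 <= M -> 0 < t -> mxle A M ->
  2 * cabs (dot u (A *m v)) <= n%:R * M * (t * nsq u + t^-1 * nsq v).
Proof.
move=> M0 t0 AM; rewrite dotE.
have h : cabs (\sum_i Num.conj (u i 0) * (A *m v) i 0) <=
    \sum_i \sum_j M * (cabs (u i 0) * cabs (v j 0)).
  rewrite (le_trans (cabs_le_sum _ _ _)) //; apply: ler_sum => i _.
  rewrite mxE mulr_sumr (le_trans (cabs_le_sum _ _ _)) //; apply: ler_sum => j _.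
  rewrite !cabsM cabsJ mulrCA; apply: ler_wpM2r; last exact: AM.
  by rewrite mulr_ge0 ?cabs_ge0.
apply: (@le_trans _ _ (\sum_i \sum_j M * (t * cabs (u i 0) ^+ 2 + t^-1 * cabs (v j 0) ^+ 2))).
  rewrite (le_trans (ler_wpM2l _ h)) // mulr_sumr; apply: ler_sum => i _.
  rewrite mulr_sumr; apply: ler_sum => j _; rewrite mulrCA ler_wpM2l //.
  exact: amgm.
rewrite le_eqVlt; apply/orP; left; apply/eqP.
under eq_bigr do rewrite -mulr_sumr big_split /= sumr_const card_ord -mulr_sumr.
rewrite -mulr_sumr big_split /= sumr_const card_ord sumrMnl -mulr_sumr -/(nsq u) -/(nsq v).
by rewrite -mulrnDl mulrnAr -mulr_natl mulrA.
Qed.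

Lemma dot_le n (t : R) (u v : 'cV[C]_n) : 0 < t ->
  2 * cabs (dot u v) <= t * nsq u + t^-1 * nsq v.
Proof.
move=> t0; rewrite dotE.
apply: (@le_trans _ _ (\sum_i (t * cabs (u i 0) ^+ 2 + t^-1 * cabs (v i 0) ^+ 2))).
  rewrite (le_trans (ler_wpM2l _ (cabs_le_sum _ _ _))) // mulr_sumr.
  by apply: ler_sum => i _; rewrite cabsM cabsJ amgm.
by rewrite big_split /= -!mulr_sumr.
Qed.

Lemma nsq_mul_le n (A : 'M[C]_n) (M : R) v : 0 < M -> mxle A M ->
  nsq (A *m v) <= (n%:R * M) ^+ 2 * nsq v.
Proof.
case: n A v => [|n] A v M0 AM.
  by rewrite /nsq !big_ord0 mulr0.
set b := n.+1%:R * M; have b0 : 0 < b by rewrite mulr_gt0 ?ltr0Sn.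
have := @form_le n.+1 A M b^-1 (A *m v) v (ltW M0) _ AM.
rewrite invr_gt0 dot_self => /(_ b0); rewrite cabs_real ger0_norm ?nsq_ge0 //.
rewrite -/b mulrDr mulrA divff ?gt_eqF // mul1r invrK mulrA -expr2.
lra.
Qed.

Lemma entry_le_nsq p q (B : 'M[C]_(p, q)) i j :
  cabs (B i j) ^+ 2 <= nsq (B *m delta_mx j 0).
Proof.
rewrite /nsq (bigD1 i) //= -colE mxE lerDl; apply: sumr_ge0 => k _; exact: sqr_ge0.
Qed.

Lemma nsq_delta n (j : 'I_n) : nsq (delta_mx j 0 : 'cV[C]_n) = 1.
Proof.
rewrite /nsq (bigD1 j) //= !mxE !eqxx cabs1 expr1n big1 ?addr0 // => k kj.
by rewrite mxE (negbTE kj) cabs0 expr0n.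
Qed.

Lemma dot_delta n (A : 'M[C]_n) k l : dot (delta_mx k 0) (A *m delta_mx l 0) = A k l.
Proof.
rewrite -colE dotE (bigD1 k) //= big1 ?addr0 => [|k' kk'].
  by rewrite !mxE !eqxx conjC1 mul1r.
by rewrite mxE (negbTE kk') conjC0 mul0r.
Qed.

Section ImPos.
Variables (n : nat) (c : R) (A : 'M[C]_n).
Hypotheses (c0 : 0 < c) (Ac : imge c A).

(** A vector in the kernel makes the quadratic form vanish, while the lower bound on the
imaginary part forces the form to be positive. *)
Lemma imge_unit : A \in unitmx.
Proof.
rewrite -row_free_unit -kermx_eq0; apply/eqP/row_matrixP => i.
pose v : 'rV[C]_n := row i (kermx A); rewrite -/v.
have vA : v *m A = 0 by apply/sub_kermxP; exact: row_sub.
have /= := Ac (v^t*); rewrite /dot adjmxK mulmxA vA mul0mx mxE /= => h.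
have /nsq_eq0 e : nsq (v^t*) = 0.
  apply/eqP; rewrite eq_le nsq_ge0 andbT -(pmulr_rle0 _ c0); exact: h.
by rewrite row0 -(adjmxK v) e trmx0 map_mx0.
Qed.

Lemma ninv_mulA : A *m (- invmx A) = - 1%:M.
Proof. by rewrite mulmxN mulmxV ?imge_unit. Qed.
Lemma ninv_Amul : - invmx A *m A = - 1%:M.
Proof. by rewrite mulNmx mulVmx ?imge_unit. Qed.

Variable m : 'M[C]_n.
Hypotheses (mA : m *m A = - 1%:M).

Lemma ninv_comm : A *m m = - 1%:M.
Proof.
have : m = - invmx A by rewrite -[m](mulmxK imge_unit) mA mulNmx mul1mx.
by move=> ->; exact: ninv_mulA.
Qed.

(** If v = - A w, that is w = m v, the forms of m at v and of A at w have the same imaginary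
part. This is how m = - A^-1 inherits positivity from A, and it is an exact identity, so
the lower bound c on Im A becomes an upper bound 1/c on m. *)
Lemma im_ninv v : complex.Im (dot v (m *m v)) = complex.Im (dot (m *m v) (A *m (m *m v))).
Proof.
by rewrite [A *m _]mulmxA ninv_comm mulNmx mul1mx dotNr ImN -(dot_conj v) Im_conj opprK.
Qed.

Lemma im_ninv_adj v :
  complex.Im (dot v (m *m v)) = complex.Im (dot (m^t* *m v) (A *m (m^t* *m v))).
Proof.
rewrite -(dot_adj m) [m *m (A *m _)]mulmxA mA mulNmx mul1mx dotNr ImN.
by rewrite -dot_adjl -[in RHS]dot_conj Im_conj opprK.
Qed.

Lemma im_ninv_ge v : c * nsq (m *m v) <= complex.Im (dot v (m *m v)).
Proof. by rewrite im_ninv. Qed.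
Lemma nsq_ninv v : nsq (m *m v) <= c^-1 ^+ 2 * nsq v.
Proof.
have h1 := im_ninv_ge v.
have h2 := @dot_le _ c^-1 v (m *m v); rewrite invr_gt0 invrK in h2.
have h3 : complex.Im (dot v (m *m v)) <= cabs (dot v (m *m v)).
  by rewrite (le_trans (ler_norm _)) ?le_Im_cabs.
have h4 : c * nsq (m *m v) <= c^-1 * nsq v by move: (h2 c0); lra.
rewrite -(ler_pM2l c0) (le_trans h4) // expr2 !mulrA divff ?gt_eqF //.
by rewrite mul1r.
Qed.

Lemma mxle_ninv : mxle m c^-1.
Proof.
move=> i j; rewrite -ler_sqr ?nnegrE ?cabs_ge0 ?invr_ge0 //; last exact: ltW.
by rewrite (le_trans (entry_le_nsq _ _ _)) // (le_trans (nsq_ninv _)) // nsq_delta mulr1.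
Qed.
End ImPos.
End Forms.

(** * The argument of the determinant *)

Section Arg.
Context {R : realType}.
Notation C := R[i].
Implicit Types q : C.

(** The argument of 1/q for q in the lower half plane. It lies in ]0, pi[, and the formula is
smooth in q, so no branch has to be chosen. *)
Definition argp q : R := pi / 2 + atan (complex.Re q / complex.Im q).

Lemma argp_bounds q : 0 < argp q < pi.
Proof.
have h1 := atan_gtNpi2 (complex.Re q / complex.Im q).
have h2 := atan_ltpi2 (complex.Re q / complex.Im q).
by rewrite /argp; apply/andP; split; lra.
Qed.

Lemma sin_atan (x : R) : sin (atan x) = x / Num.sqrt (1 + x ^+ 2).
Proof.
have h : cos (atan x) != 0.
  by rewrite cos_atan invr_neq0 // sqrtr_eq0 -ltNge ltr_pwDl ?sqr_ge0.
by rewrite -(cos_atan x) -{2}(atanK x) /tan mulfVK.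
Qed.

Lemma argp_polar q : complex.Im q < 0 ->
  exists2 r : R, 0 < r & q^-1 = (r * cos (argp q)) +i* (r * sin (argp q)).
Proof.
case: q => x y /= y0; rewrite /argp /=.
set t := x / y; pose s := Num.sqrt (1 + t ^+ 2).
have s0 : 0 < s by rewrite sqrtr_gt0 ltr_pwDl ?sqr_ge0.
have n0 : 0 < x ^+ 2 + y ^+ 2 by rewrite ltr_wpDl ?sqr_ge0 // exprn_even_gt0 //= lt_eqF.
exists (- y * s / (x ^+ 2 + y ^+ 2)).
  by rewrite divr_gt0 // mulr_gt0 ?oppr_gt0.
rewrite [pi / 2 + _]addrC cosDpihalf sinDpihalf sin_atan cos_atan -/s.
apply/eqP; rewrite eq_complex /=; apply/andP; split; apply/eqP; rewrite /t.
  by field; rewrite ?(gt_eqF n0) ?(gt_eqF s0) ?(lt_eqF y0).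
by field; rewrite ?(gt_eqF n0) ?(gt_eqF s0) ?(lt_eqF y0).
Qed.

Lemma atan_mvt (a b : R) : exists c, (`|c - b| <= `|a - b|) /\
  atan a - atan b = (1 + c ^+ 2)^-1 * (a - b).
Proof.
have cont x y : {within `[x, y], continuous (@atan R)}.
  by apply: continuous_subspaceT => z; exact: continuous_atan.
have [ab|ba] := leP a b.
  have [c + e] := @MVT_segment R atan _ a b ab (fun x _ => is_derive1_atan x) (cont a b).
  rewrite in_itv /= => /andP[ac cb]; exists c; split.
    by rewrite !ler0_norm ?subr_le0 // lerN2 lerB.
  by rewrite -opprB e -mulrN opprB.
have [c + e] := @MVT_segment R atan _ b a (ltW ba) (fun x _ => is_derive1_atan x) (cont b a).
rewrite in_itv /= => /andP[bc ca]; exists c; split=> //.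
by rewrite !ger0_norm ?subr_ge0 ?(ltW ba) // lerB.
Qed.

Lemma atan_abs_le (a : R) : `|atan a| <= `|a|.
Proof.
have [c [_]] := atan_mvt a 0; rewrite atan0 !subr0 => ->.
rewrite normrM ler_piMl // ger0_norm ?invr_ge0 ?addr_ge0 ?sqr_ge0 //.
by rewrite invf_le1 ?lerDl ?sqr_ge0 // ltr_pwDl ?sqr_ge0.
Qed.

(** The mean value theorem gives a point c between a and b; the second order term is then
controlled by the variation of 1 / (1 + x^2) between c and b. *)
Lemma atan_taylor (a b : R) :
  `|atan a - atan b - (a - b) / (1 + b ^+ 2)| <= (a - b) ^+ 2.
Proof.
have [c [cb ->]] := atan_mvt a b.
have c1 : 1 <= 1 + c ^+ 2 by rewrite lerDl sqr_ge0.
have b1 : 1 <= 1 + b ^+ 2 by rewrite lerDl sqr_ge0.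
have c0 : 0 < 1 + c ^+ 2 by rewrite (lt_le_trans _ c1).
have b0 : 0 < 1 + b ^+ 2 by rewrite (lt_le_trans _ b1).
have -> : (1 + c ^+ 2)^-1 * (a - b) - (a - b) / (1 + b ^+ 2) =
   (a - b) * ((c - b) * (- (c + b) / ((1 + c ^+ 2) * (1 + b ^+ 2)))).
  by field; rewrite !gt_eqF.
have P0 := mulr_gt0 c0 b0.
rewrite -[leRHS]real_normK ?num_real // [leRHS]expr2 normrM ler_wpM2l // normrM.
apply: le_trans cb; rewrite ler_piMr // normrM normrN normfV.
rewrite (gtr0_norm P0) ler_pdivrMr // mul1r.
rewrite (le_trans (ler_normD _ _)) //.
have hc : `|c| <= (1 + c ^+ 2) / 2.
  by rewrite -(real_normK (num_real c)); have := sqr_ge0 (`|c| - 1); nra.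
have hb : `|b| <= (1 + b ^+ 2) / 2.
  by rewrite -(real_normK (num_real b)); have := sqr_ge0 (`|b| - 1); nra.
by nra.
Qed.

(** The differential of arg (1/q) is - Im (dq / q), with a remainder that is uniform as long
as q stays below the line Im q = - c. *)
Lemma argp_taylor (c B h : R) q1 q2 : 0 < c -> 0 <= B -> 0 <= h ->
  complex.Im q1 <= - c -> complex.Im q2 <= - c -> cabs q2 <= B ->
  cabs (q1 - q2) <= h ->
  `|argp q1 - argp q2 + complex.Im ((q1 - q2) / q2)| <=
    ((2 * B / c ^+ 2) ^+ 2 + 2 * B / c ^+ 3) * h ^+ 2.
Proof.
move=> c0 B0 h0 I1 I2 qB q12.
have R2B := le_trans (le_Re_cabs q2) qB; have I2B := le_trans (le_Im_cabs q2) qB.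
have Rh := le_trans (le_Re_cabs (q1 - q2)) q12.
have Ih := le_trans (le_Im_cabs (q1 - q2)) q12.
rewrite ReB in Rh; rewrite ImB in Ih.
case: q1 q2 I1 I2 R2B I2B Rh Ih {qB q12} => x1 y1 [x2 y2] /= I1 I2 R2B I2B Rh Ih.
rewrite /argp /=.
have y1n : y1 != 0 by rewrite lt_eqF // (le_lt_trans I1) // oppr_lt0.
have y2n : y2 != 0 by rewrite lt_eqF // (le_lt_trans I2) // oppr_lt0.
set a := x1 / y1; set b := x2 / y2.
have n0 : 0 < x2 ^+ 2 + y2 ^+ 2 by rewrite ltr_wpDl ?sqr_ge0 // exprn_even_gt0 //= .
have abE : a - b = ((x1 - x2) * y2 - x2 * (y1 - y2)) / (y1 * y2).
  by rewrite /a /b; field; rewrite y1n y2n.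
set N := (x1 - x2) * y2 - x2 * (y1 - y2) in abE.
have NB : `|N| <= 2 * B * h.
  rewrite (le_trans (ler_normB _ _)) // !normrM.
  have : `|x1 - x2| * `|y2| <= h * B by rewrite ler_pM.
  have : `|x2| * `|y1 - y2| <= B * h by rewrite ler_pM.
  lra.
have y1c : c <= `|y1| by rewrite ltr0_norm; lra.
have y2c : c <= `|y2| by rewrite ltr0_norm; lra.
have nc : c ^+ 2 <= x2 ^+ 2 + y2 ^+ 2.
  by rewrite ler_wpDl ?sqr_ge0 // -(real_normK (num_real y2)) ler_sqr ?nnegrE // ltW.
have T := atan_taylor a b.
have E : (a - b) / (1 + b ^+ 2) +
   ((x1 - x2) * (- y2 / (x2 ^+ 2 + y2 ^+ 2)) + (y1 - y2) * (x2 / (x2 ^+ 2 + y2 ^+ 2))) =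
   - (N * (y1 - y2) / ((x2 ^+ 2 + y2 ^+ 2) * y1)).
  rewrite abE /b /N; field.
  rewrite y1n y2n gt_eqF //= gt_eqF // addrC //.
rewrite -mulNr; set Z := _ + (y1 - y2) * _ in E *.
have -> : pi / 2 + atan a - (pi / 2 + atan b) + Z =
    (atan a - atan b - (a - b) / (1 + b ^+ 2)) + ((a - b) / (1 + b ^+ 2) + Z) by ring.
rewrite E (le_trans (ler_normD _ _)) // [leRHS]mulrDl; apply: lerD.
  apply: (le_trans T); rewrite -exprMn -(real_normK (num_real (a - b))) ler_sqr ?nnegrE //.
    rewrite abE normrM normfV [X in _ / X <= _]normrM [X in _ <= X]mulrAC.
    rewrite ler_pM ?invr_ge0 // ?mulr_ge0 //.
    by rewrite lef_pV2 ?posrE ?mulr_gt0 ?exprn_gt0 ?normr_gt0 // expr2 ler_pM // ltW.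
  by rewrite mulr_ge0 // (divr_ge0 (mulr_ge0 _ B0) (exprn_ge0 _ (ltW c0))).
rewrite normrN normrM normfV [X in _ / X <= _]normrM (ger0_norm (ltW n0)) normrM.
have -> : 2 * B / c ^+ 3 * h ^+ 2 = (2 * B * h) * h / (c ^+ 2 * c).
  by field; rewrite gt_eqF.
rewrite ler_pM ?mulr_ge0 ?invr_ge0 ?mulr_ge0 // ?(ltW n0) //.
  by rewrite ler_pM.
by rewrite lef_pV2 ?posrE ?mulr_gt0 ?exprn_gt0 ?normr_gt0 // ler_pM // ?exprn_ge0 // ltW.
Qed.

Definition minor0 n (A : 'M[C]_n.+1) : 'M[C]_n := row' ord0 (col' ord0 A).

(** A continuous determination of the argument of det G. By Schur complements, 1 / det G is the
product of the corner entries of the inverses of the nested minors of G; when Im G > 0 each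
of these entries lies in the lower half plane and has an argument given by [argp]. The value lies in
[0, n pi] for every matrix. *)
Fixpoint argdet n : 'M[C]_n -> R :=
  match n with
  | 0 => fun=> 0
  | n'.+1 => fun G => argp (invmx G ord0 ord0) + argdet (minor0 G)
  end.

Lemma minor0E n (A : 'M[C]_n.+1) i j : minor0 A i j = A (lift ord0 i) (lift ord0 j).
Proof. by rewrite !mxE. Qed.
Lemma minor0B n (A B : 'M[C]_n.+1) : minor0 (A - B) = minor0 A - minor0 B.
Proof. by apply/matrixP => i j; rewrite !mxE. Qed.
Lemma mxle_minor0 n (A : 'M[C]_n.+1) M : mxle A M -> mxle (minor0 A) M.
Proof. by move=> AM i j; rewrite minor0E. Qed.

Lemma imge_minor0 n (A : 'M[C]_n.+1) c : imge c A -> imge c (minor0 A).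
Proof.
move=> Ac u.
pose u' : 'cV[C]_n.+1 := \col_i (if unlift ord0 i is Some j then u j 0 else 0).
have u0 : u' ord0 0 = 0 by rewrite mxE unlift_none.
have ul j : u' (lift ord0 j) 0 = u j 0 by rewrite mxE liftK.
have -> : nsq u = nsq u'.
  rewrite /nsq big_ord_recl u0 cabs0 expr0n add0r.
  by apply: eq_bigr => j _; rewrite ul.
have -> : dot u (minor0 A *m u) = dot u' (A *m u'); last exact: Ac.
rewrite !dotE big_ord_recl u0 conjC0 mul0r add0r; apply: eq_bigr => j _.
rewrite ul !mxE; congr (_ * _); rewrite big_ord_recl u0 mulr0 add0r.
by apply: eq_bigr => k _; rewrite ul minor0E.
Qed.

(** Block inversion, read from the entries of the inverse of the whole matrix. *)
Lemma inv_minor0 n (G : 'M[C]_n.+1) : G \in unitmx -> minor0 G \in unitmx ->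
  invmx G ord0 ord0 != 0 ->
  invmx (minor0 G) = minor0 (invmx G -
    (invmx G ord0 ord0)^-1 *: (col ord0 (invmx G) *m row ord0 (invmx G))).
Proof.
move=> uG uM q0; set N := minor0 (_ - _).
suff NM : N *m minor0 G = 1%:M by rewrite -[N](mulmxK uM) NM mul1mx.
set Gi := invmx G in q0 N *.
have E a k : \sum_j Gi a (lift ord0 j) * G (lift ord0 j) k =
    (a == k)%:R - Gi a ord0 * G ord0 k.
  have /matrixP/(_ a k) : Gi *m G = 1%:M by rewrite mulVmx.
  by rewrite !mxE big_ord_recl => <-; rewrite addrAC subrr add0r.
apply/matrixP => i k; rewrite !mxE.
under eq_bigr do rewrite !mxE big_ord1 !mxE mulrBl.
rewrite sumrB E.
under eq_bigr do rewrite -!mulrA.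
rewrite -!mulr_sumr E eq_sym (negbTE (neq_lift _ _)) sub0r.
rewrite (inj_eq (@lift_inj _ _)) [k == i]eq_sym 2!mulrN opprK.
by rewrite [_^-1 * _]mulrCA mulKf // subrK.
Qed.

(** The logarithmic derivative tr (G^-1 H) of the determinant splits in the same way as [argdet]:
one term for the minor and one for the corner entry of the inverse. *)
Lemma tr_minor0 n (G H : 'M[C]_n.+1) : G \in unitmx -> minor0 G \in unitmx ->
  invmx G ord0 ord0 != 0 ->
  \tr (invmx G *m H) = \tr (invmx (minor0 G) *m minor0 H) +
    (invmx G *m H *m invmx G) ord0 ord0 / invmx G ord0 ord0.
Proof.
move=> uG uM q0; rewrite inv_minor0 //; set Gi := invmx G in q0 *.
set P := _ *: _; pose N := Gi - P.
have N0 j : N ord0 j = 0.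
  by rewrite !mxE big_ord1 !mxE mulrA mulVf // mul1r subrr.
have N0' i : N i ord0 = 0.
  by rewrite !mxE big_ord1 !mxE mulrCA mulVf // mulr1 subrr.
have E : Gi *m H = N *m H + P *m H by rewrite mulmxBl subrK.
rewrite [X in \tr X]E mxtraceD; congr (_ + _).
  rewrite /mxtrace big_ord_recl mxE big1 ?add0r => [|j _]; last by rewrite N0 mul0r.
  apply: eq_bigr => i _; rewrite !mxE big_ord_recl N0' mul0r add0r.
  by apply: eq_bigr => j _; rewrite !minor0E.
rewrite /P -scalemxAl mxtraceZ mulrC -mulmxA mxtrace_mulC /mxtrace big_ord1.
rewrite -row_mul; congr (_ / _); rewrite [in LHS]mxE [in RHS]mxE.
by apply: eq_bigr => j _; rewrite [row _ _ _ _]mxE [col _ _ _ _]mxE.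
Qed.

Lemma det_minor0 n (G : 'M[C]_n.+1) : G \in unitmx -> invmx G ord0 ord0 != 0 ->
  \det G = (invmx G ord0 ord0)^-1 * \det (minor0 G).
Proof.
move=> uG; have d0 : \det G != 0 by rewrite -unitfE -unitmxE.
rewrite /invmx uG !mxE /cofactor addn0 expr0 mul1r mulf_eq0 invr_eq0 (negbTE d0) /= => m0.
by rewrite invfM invrK -mulrA mulVf ?mulr1.
Qed.

Lemma mxle_mul m n p (A : 'M[C]_(m, n)) (B : 'M[C]_(n, p)) a b : 0 <= a ->
  mxle A a -> mxle B b -> mxle (A *m B) (n%:R * (a * b)).
Proof.
move=> a0 Aa Bb i j; rewrite mxE (le_trans (cabs_le_sum _ _ _)) //.
rewrite -[X in _ <= X%:R * _]card_ord -sum1_card natr_sum mulr_suml.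
apply: ler_sum => k _; rewrite mul1r cabsM ler_pM ?cabs_ge0 //.
Qed.

Lemma invmxB n (A B : 'M[C]_n) : A \in unitmx -> B \in unitmx ->
  invmx A - invmx B = - (invmx A *m (A - B) *m invmx B).
Proof.
move=> uA uB; rewrite mulmxBr mulVmx // mulmxBl mul1mx -mulmxA mulmxV // mulmx1.
by rewrite opprB.
Qed.

Lemma mxle_invmx n c (A : 'M[C]_n) : 0 < c -> imge c A -> mxle (invmx A) c^-1.
Proof.
move=> c0 Ac i j; have := mxle_ninv c0 Ac (ninv_Amul c0 Ac) i j.
by rewrite mxE cabsN.
Qed.

(** The corner entry of the inverse stays away from the real axis: for v = - G^-1 e its form is
at least c |v|^2, and |v| cannot be small because G maps it to - e. *)
Lemma im_inv00 n c M (A : 'M[C]_n.+1) : 0 < c -> 0 < M -> imge c A -> mxle A M ->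
  complex.Im (invmx A ord0 ord0) <= - (c / (n.+1%:R * M) ^+ 2).
Proof.
move=> c0 M0 Ac AM; set e : 'cV[C]_n.+1 := delta_mx ord0 0.
have h := im_ninv_ge c0 Ac (ninv_Amul c0 Ac) e.
have b0 : 0 < (n.+1%:R * M) ^+ 2 by rewrite exprn_gt0 // mulr_gt0 // ltr0Sn.
have := nsq_mul_le (- invmx A *m e) M0 AM.
rewrite mulmxA (ninv_mulA c0 Ac) mulNmx mul1mx nsqN nsq_delta => h2.
have de : dot e (- invmx A *m e) = - invmx A ord0 ord0.
  rewrite dotE (bigD1 ord0) //= big1 => [|i i0].
    by rewrite addr0 [e _ _]mxE !eqxx conjC1 mul1r -colE !mxE.
  by rewrite mxE (negbTE i0) conjC0 mul0r.
rewrite de ImN in h; rewrite lerNr; apply: le_trans h.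
by rewrite ler_pM2l // -[X in X <= _]mul1r ler_pdivrMr // mulrC.
Qed.

Lemma inv00_neq0 n c M (A : 'M[C]_n.+1) : 0 < c -> 0 < M -> imge c A -> mxle A M ->
  invmx A ord0 ord0 != 0.
Proof.
move=> c0 M0 Ac AM; have := im_inv00 c0 M0 Ac AM; apply: contraTneq => ->.
by rewrite -ltNge oppr_lt0 divr_gt0 // exprn_gt0 // mulr_gt0 ?ltr0Sn.
Qed.

Lemma mxle_exists n (A : 'M[C]_n) : exists2 M, 0 < M & mxle A M.
Proof.
exists (1 + \sum_i \sum_j cabs (A i j)).
  by rewrite ltr_pwDl //; apply: sumr_ge0 => i _; apply: sumr_ge0 => j _; exact: cabs_ge0.
move=> i j; rewrite (bigD1 i) //= (bigD1 j) //=.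
rewrite addrCA -addrA lerDl !addr_ge0 //.
- by apply: sumr_ge0 => k _; exact: cabs_ge0.
- by apply: sumr_ge0 => k _; apply: sumr_ge0 => l _; exact: cabs_ge0.
Qed.

(** Under [det_minor0] moduli multiply and arguments add up. *)
Lemma argdet_polar n c (G : 'M[C]_n) : 0 < c -> imge c G ->
  exists2 r : R, 0 < r & \det G = (r * cos (argdet G)) +i* (r * sin (argdet G)).
Proof.
move=> c0; elim: n G => [|n IH] G Gc.
  by exists 1 => //; rewrite det_mx00 /= cos0 sin0 mulr1 mulr0.
have [M M0 GM] := mxle_exists G.
have [r r0 e] := IH _ (imge_minor0 Gc).
have i00 := im_inv00 c0 M0 Gc GM.
have [s s0 f] : exists2 r : R, 0 < r & (invmx G ord0 ord0)^-1 =
    (r * cos (argp (invmx G ord0 ord0))) +i* (r * sin (argp (invmx G ord0 ord0))).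
  apply: argp_polar; rewrite (le_lt_trans i00) // oppr_lt0 divr_gt0 // exprn_gt0 //.
  by rewrite mulr_gt0 ?ltr0Sn.
exists (s * r); first exact: mulr_gt0.
rewrite (det_minor0 (imge_unit c0 Gc) (inv00_neq0 c0 M0 Gc GM)) e f /=.
apply/eqP; rewrite eq_complex /= cosD sinD; apply/andP; split; apply/eqP; ring.
Qed.

Lemma argdet_bounds n (G : 'M[C]_n) : 0 <= argdet G <= n%:R * pi.
Proof.
elim: n G => [|n IH] G /=; first by rewrite mul0r lexx.
have /andP[a b] := argp_bounds (invmx G ord0 ord0); have /andP[a' b'] := IH (minor0 G).
rewrite -natr1 mulrDl mul1r addrC addr_ge0 ?(ltW a) //= lerD //; exact: ltW.
Qed.

(** Jacobi's formula d (log det G) = tr (G^-1 dG) with a second order remainder uniform on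
bounded sets, by induction on the size through [tr_minor0]. *)
Lemma argdet_taylor n c M : 0 < c -> 0 < M ->
  exists2 K : R, 0 <= K & forall (G1 G2 : 'M[C]_n) h, imge c G1 -> imge c G2 ->
    mxle G1 M -> mxle G2 M -> 0 <= h -> mxle (G1 - G2) h ->
    `|argdet G1 - argdet G2 - complex.Im (\tr (invmx G2 *m (G1 - G2)))| <= K * h ^+ 2.
Proof.
move=> c0 M0; elim: n => [|n [K K0 IH]].
  by exists 0 => // G1 G2 h *; rewrite /mxtrace big_ord0 !subr0 normr0 mul0r.
pose N : R := n.+1%:R; pose c' := c / (N * M) ^+ 2; pose B := c^-1.
have N0 : 0 < N by rewrite ltr0Sn.
have c'0 : 0 < c' by rewrite divr_gt0 // exprn_gt0 // mulr_gt0.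
have B0 : 0 < B by rewrite invr_gt0.
pose b := N * (N * (B * 1) * B).
pose Ka := ((2 * B / c' ^+ 2) ^+ 2 + 2 * B / c' ^+ 3) * b ^+ 2.
pose Kb := N * (N * (b * 1) * B) / c'.
have Ka0 : 0 <= Ka.
  rewrite mulr_ge0 ?sqr_ge0 // addr_ge0 ?sqr_ge0 //.
  by rewrite (divr_ge0 (mulr_ge0 _ (ltW B0)) (exprn_ge0 _ (ltW c'0))).
have b0 : 0 <= b by rewrite !mulr_ge0 ?ltW.
have Kb0 : 0 <= Kb by rewrite (divr_ge0 _ (ltW c'0)) // !mulr_ge0 // ltW.
exists (Ka + K + Kb); first by rewrite !addr_ge0.
move=> G1 G2 h G1c G2c G1M G2M h0 Hh.
have u1 := imge_unit c0 G1c; have u2 := imge_unit c0 G2c.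
have i1 := mxle_invmx c0 G1c; have i2 := mxle_invmx c0 G2c.
have q1 := im_inv00 c0 M0 G1c G1M; have q2 := im_inv00 c0 M0 G2c G2M.
have q20 := inv00_neq0 c0 M0 G2c G2M.
have hB : mxle (invmx G1 *m (G1 - G2) *m invmx G2) (b * h).
  have -> : b * h = N * (N * (B * h) * B) by rewrite /b; ring.
  by apply: mxle_mul => //; [rewrite !mulr_ge0 // ltW|apply: mxle_mul => //; rewrite ltW].
have IHm := IH _ _ h (imge_minor0 G1c) (imge_minor0 G2c) (mxle_minor0 G1M) (mxle_minor0 G2M) h0.
rewrite -minor0B in IHm; have {}IHm := IHm (mxle_minor0 Hh).
rewrite /= (tr_minor0 _ u2 (imge_unit c0 (imge_minor0 G2c)) q20) ImD.
set p1 := invmx G1 ord0 ord0 in q1 *; set p2 := invmx G2 ord0 ord0 in q2 q20 *.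
have dp : p1 - p2 = - (invmx G1 *m (G1 - G2) *m invmx G2) ord0 ord0.
  by have /matrixP/(_ ord0 ord0) := invmxB u1 u2; rewrite !mxE.
have T : `|argp p1 - argp p2 + complex.Im ((p1 - p2) / p2)| <= Ka * h ^+ 2.
  rewrite /Ka -mulrA -exprMn; apply: (argp_taylor c'0 (ltW B0) (mulr_ge0 b0 h0) q1 q2).
    exact: i2.
  by rewrite dp cabsN; exact: hB.
have U : `|complex.Im ((p1 - p2) / p2) + complex.Im ((invmx G2 *m (G1 - G2) *m invmx G2) ord0 ord0 / p2)|
    <= Kb * h ^+ 2.
  rewrite -ImD -mulrDl (le_trans (le_Im_cabs _)) // cabsM cabsV.
  have -> : Kb * h ^+ 2 = (N * (N * ((b * h) * h) * B)) / c' by rewrite /Kb; ring.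
  apply: ler_pM; rewrite ?cabs_ge0 ?invr_ge0 ?cabs_ge0 //.
    have -> : p1 - p2 + (invmx G2 *m (G1 - G2) *m invmx G2) ord0 ord0 =
        (invmx G1 *m (G1 - G2) *m invmx G2 *m (G1 - G2) *m invmx G2) ord0 ord0.
      rewrite dp; have -> : invmx G1 *m (G1 - G2) *m invmx G2 = invmx G2 - invmx G1.
        by rewrite -[RHS]opprB invmxB // opprK.
      rewrite (mulmxBl _ _ (G1 - G2)) (mulmxBl _ _ (invmx G2)).
      have -> : invmx G1 *m (G1 - G2) *m invmx G2 = invmx G2 - invmx G1.
        by rewrite -[RHS]opprB invmxB // opprK.
      by rewrite !mxE opprB; ring.
    by apply: mxle_mul => //; [rewrite !mulr_ge0 // ltW|apply: mxle_mul => //; rewrite mulr_ge0].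
  rewrite lef_pV2 ?posrE ?cabs_gt0 //.
  have q2' : complex.Im p2 <= - c' by [].
  by rewrite (le_trans _ (le_Im_cabs _)) // ler0_norm; lra.
set X := argdet _ - argdet _ - _ in IHm.
have -> : argp p1 + argdet (minor0 G1) - (argp p2 + argdet (minor0 G2)) -
   (complex.Im (\tr (invmx (minor0 G2) *m minor0 (G1 - G2))) +
    complex.Im ((invmx G2 *m (G1 - G2) *m invmx G2) ord0 ord0 / p2)) =
   (argp p1 - argp p2 + complex.Im ((p1 - p2) / p2)) + X -
   (complex.Im ((p1 - p2) / p2) + complex.Im ((invmx G2 *m (G1 - G2) *m invmx G2) ord0 ord0 / p2)).
  by rewrite /X; ring.
have -> : (Ka + K + Kb) * h ^+ 2 = Ka * h ^+ 2 + K * h ^+ 2 + Kb * h ^+ 2 by ring.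
rewrite (le_trans (ler_normB _ _)) // lerD // (le_trans (ler_normD _ _)) // lerD //.
Qed.

(** When G is i eta up to a bounded error, each of the n corner entries of the inverses is
- i / eta up to O(eta^-2), and contributes pi/2 up to O(1/eta). *)
Lemma argdet_large n (E eta b : R) (G : 'M[C]_n) : 0 < eta -> 0 <= E ->
  n%:R * E <= b -> 2 * b <= eta -> imge eta G -> mxle (G - (0 +i* eta)%:M) E ->
  `|argdet G - n%:R * (pi / 2)| <= n%:R * (2 * b / eta).
Proof.
move=> eta0 E0; elim: n G => [|p IH] G hE hb Gc GE.
  by rewrite /= !mul0r subr0 normr0.
have hE' : p%:R * E <= b by apply: le_trans hE; rewrite ler_wpM2r // ler_nat.
rewrite /=; have := IH (minor0 G) hE' hb (imge_minor0 Gc).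
have -> : minor0 G - (0 +i* eta)%:M = minor0 (G - (0 +i* eta)%:M).
  by apply/matrixP => i j; rewrite !mxE (inj_eq (@lift_inj _ _)).
move=> /(_ (mxle_minor0 GE)) h.
set q := invmx G ord0 ord0.
have k0 : (0 +i* eta : C) != 0 by rewrite eq_complex /= eqxx gt_eqF.
have uG := imge_unit eta0 Gc.
have hq : cabs (q - (0 +i* eta)^-1) <= b / eta ^+ 2.
  have -> : q - (0 +i* eta)^-1 = - (0 +i* eta)^-1 * ((G - (0 +i* eta)%:M) *m invmx G) ord0 ord0.
    rewrite mulmxBl mulmxV // mul_scalar_mx !mxE -/q eqxx mulNr mulrBr mulr1.
    by rewrite mulKf // opprB.
  rewrite cabsM cabsN cabsV.
  have -> : cabs (0 +i* eta) = eta by rewrite /cabs /= expr0n add0r sqrtr_sqr gtr0_norm.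
  have -> : b / eta ^+ 2 = eta^-1 * (b / eta) by field; rewrite gt_eqF.
  rewrite ler_wpM2l ?invr_ge0 ?(ltW eta0) //.
  apply: le_trans (mxle_mul E0 GE (mxle_invmx eta0 Gc) ord0 ord0) _.
  by rewrite mulrA ler_wpM2r // invr_ge0 ltW.
have invE : (0 +i* eta)^-1 = 0 +i* (- eta^-1) :> C.
  apply/eqP; rewrite eq_complex /= expr0n add0r mul0r eqxx /=; apply/eqP.
  by field; rewrite gt_eqF.
have hR := le_trans (le_Re_cabs _) hq; have hI := le_trans (le_Im_cabs _) hq.
rewrite invE ReB ImB /= subr0 opprK in hR hI.
have x0 : 0 < eta^-1 by rewrite invr_gt0.
have small : b / eta ^+ 2 <= eta^-1 / 2.
  have -> : b / eta ^+ 2 = (b / eta) * eta^-1 by field; rewrite gt_eqF.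
  by rewrite mulrC ler_pM2l // ler_pdivrMr //; lra.
have hI2 : eta^-1 / 2 <= `|complex.Im q|.
  by move: hI; rewrite ler_norml => /andP[_ ?]; rewrite ler0_norm; lra.
have b0 : 0 <= b by rewrite (le_trans _ hE) // mulr_ge0.
have ha : `|argp q - pi / 2| <= 2 * b / eta.
  rewrite /argp addrAC subrr add0r (le_trans (atan_abs_le _)) // normrM normfV.
  rewrite ler_pdivrMr; last by rewrite (lt_le_trans _ hI2) // divr_gt0.
  apply: (le_trans hR); apply: (@le_trans _ _ (2 * b / eta * (eta^-1 / 2))).
    by rewrite le_eqVlt; apply/orP; left; apply/eqP; field; rewrite gt_eqF.
  by rewrite ler_wpM2l // divr_ge0 ?mulr_ge0 // ltW.
have -> : argp q + argdet (minor0 G) - p.+1%:R * (pi / 2) =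
  (argp q - pi / 2) + (argdet (minor0 G) - p%:R * (pi / 2)) by rewrite -natr1; ring.
have -> : p.+1%:R * (2 * b / eta) = 2 * b / eta + p%:R * (2 * b / eta).
  by rewrite -natr1; ring.
by rewrite (le_trans (ler_normD _ _)) // lerD.
Qed.

End Arg.

(** * Bounded and piecewise Hoelder functions on the unit interval *)

Section Bmf.
Context d (T : measurableType d) (R : realType) (mu : {measure set T -> \bar R}) (D : set T).
Hypotheses (mD : measurable D) (fD : (mu D < +oo)%E).

Definition bmf (f : T -> R) := measurable_fun D f /\ exists M, forall x, D x -> `|f x| <= M.

Lemma bmf_int f : bmf f -> mu.-integrable D (EFin \o f).
Proof.
move=> [mf [M fM]]; apply: measurable_bounded_integrable => //.
exists M; split; first exact: num_real.
by move=> M' MM' x Dx /=; rewrite (le_trans (fM x Dx)) // ltW.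
Qed.

Lemma bmf_eq f g : {in D, f =1 g} -> bmf f -> bmf g.
Proof.
move=> fg [mf [M fM]]; split; first exact: eq_measurable_fun mf.
by exists M => x Dx; rewrite -fg ?inE //; exact: fM.
Qed.

Lemma bmf_cst a : bmf (cst a).
Proof. by split; [exact: measurable_cst|exists `|a| => x _]. Qed.
Lemma bmfD f g : bmf f -> bmf g -> bmf (fun x => f x + g x).
Proof.
move=> [mf [M fM]] [mg [N gN]]; split; first exact: measurable_funD.
by exists (M + N) => x Dx; rewrite (le_trans (ler_normD _ _)) // lerD ?fM ?gN.
Qed.

Lemma bmfM f g : bmf f -> bmf g -> bmf (fun x => f x * g x).
Proof.
move=> [mf [M fM]] [mg [N gN]]; split; first exact: measurable_funM.
by exists (M * N) => x Dx; rewrite normrM ler_pM ?fM ?gN.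
Qed.

Lemma bmfZ a f : bmf f -> bmf (fun x => a * f x).
Proof. exact/bmfM/bmf_cst. Qed.
Lemma bmfN f : bmf f -> bmf (fun x => - f x).
Proof.
move=> [mf [M fM]]; split; first exact: measurable_funN.
by exists M => x Dx; rewrite normrN fM.
Qed.

Lemma bmfB f g : bmf f -> bmf g -> bmf (fun x => f x - g x).
Proof. by move=> bf bg; apply: bmfD => //; exact: bmfN. Qed.
Lemma bmf_sum (I : Type) (r : seq I) (F : I -> T -> R) :
  (forall i, bmf (F i)) -> bmf (fun x => \sum_(i <- r) F i x).
Proof.
move=> bF; elim: r => [|i r IH].
  by apply: bmf_eq (bmf_cst 0) => x _; rewrite big_nil.
by apply: bmf_eq (bmfD (bF i) IH) => x _; rewrite big_cons.
Qed.

Lemma le_bmf f g : bmf f -> bmf g -> (forall x, D x -> f x <= g x) ->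
  \int[mu]_(x in D) f x <= \int[mu]_(x in D) g x.
Proof. by move=> bf bg; apply: le_Rintegral => //; exact: bmf_int. Qed.
Lemma int_bmfD f g : bmf f -> bmf g ->
  \int[mu]_(x in D) (f x + g x) = \int[mu]_(x in D) f x + \int[mu]_(x in D) g x.
Proof. by move=> bf bg; apply: RintegralD => //; exact: bmf_int. Qed.
Lemma int_bmfB f g : bmf f -> bmf g ->
  \int[mu]_(x in D) (f x - g x) = \int[mu]_(x in D) f x - \int[mu]_(x in D) g x.
Proof. by move=> bf bg; apply: RintegralB => //; exact: bmf_int. Qed.
Lemma int_bmfZ a f : bmf f ->
  \int[mu]_(x in D) (a * f x) = a * \int[mu]_(x in D) f x.
Proof. by move=> bf; apply: RintegralZl => //; exact: bmf_int. Qed.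
Lemma int_bmfN f : bmf f ->
  \int[mu]_(x in D) (- f x) = - \int[mu]_(x in D) f x.
Proof.
move=> bf; rewrite -mulN1r -int_bmfZ //; apply: eq_Rintegral => x _; by rewrite mulN1r.
Qed.

Lemma int_bmf_sum (I : Type) (r : seq I) (F : I -> T -> R) : (forall i, bmf (F i)) ->
  \int[mu]_(x in D) (\sum_(i <- r) F i x) = \sum_(i <- r) \int[mu]_(x in D) F i x.
Proof.
move=> bF; elim: r => [|i r IH].
  rewrite big_nil -[RHS](mul0r (fine (mu D))) -Rintegral_cst //.
  by apply: eq_Rintegral => x _; rewrite big_nil.
rewrite big_cons -IH -int_bmfD //; last exact: bmf_sum.
by apply: eq_Rintegral => x _; rewrite big_cons.
Qed.

Lemma le_int_bmf f M : bmf f -> (forall x, D x -> `|f x| <= M) ->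
  `|\int[mu]_(x in D) f x| <= M * fine (mu D).
Proof.
move=> bf fM; rewrite -Rintegral_cst // ler_norml -int_bmfN; last exact: bmf_cst.
apply/andP; split; apply: le_bmf => //; try exact: bmf_cst.
- by move=> x Dx; move: (fM x Dx); rewrite ler_norml => /andP[].
- by move=> x Dx; move: (fM x Dx); rewrite ler_norml => /andP[].
Qed.
End Bmf.

Section Unit.
Context {R : realType}.
Notation C := R[i].
Local Notation U := (`[0 : R, 1]%classic).

Lemma mU : measurable (U : set (measurableTypeR R)).
Proof. exact: measurable_itv. Qed.
Lemma lebU : leb R U = 1%E.
Proof. by have := @lebesgue_measure_itv R `[0, 1]; rewrite /= lte_fin ltr01 oppr0 adde0. Qed.
Lemma fU : (leb R U < +oo)%E.
Proof. by rewrite lebU ltry. Qed.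

Definition E01 (f : R -> R) : R := \int[leb R]_(x in `[0, 1]) f x.
Notation bmU := (@bmf _ (measurableTypeR R) R U).
Definition cbm (f : R -> C) := bmU (fun x => complex.Re (f x)) /\ bmU (fun x => complex.Im (f x)).
Definition cI (f : R -> C) : C := cintegral (leb R) `[0, 1] f.

Lemma E01_le f g : bmU f -> bmU g -> (forall x, 0 <= x <= 1 -> f x <= g x) -> E01 f <= E01 g.
Proof.
move=> bf bg fg; apply: (@le_bmf _ (measurableTypeR R) R (leb R) U mU fU f g bf bg) => x.
by rewrite /= in_itv; exact: fg.
Qed.

Lemma E01_eq f g : (forall x, 0 <= x <= 1 -> f x = g x) -> E01 f = E01 g.
Proof. by move=> fg; apply: eq_Rintegral => x; rewrite inE /= in_itv; exact: fg. Qed.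
Lemma E01D f g : bmU f -> bmU g -> E01 (fun x => f x + g x) = E01 f + E01 g.
Proof. exact: (@int_bmfD _ (measurableTypeR R) R (leb R) U mU fU f g). Qed.
Lemma E01B f g : bmU f -> bmU g -> E01 (fun x => f x - g x) = E01 f - E01 g.
Proof. exact: (@int_bmfB _ (measurableTypeR R) R (leb R) U mU fU f g). Qed.
Lemma E01Z a f : bmU f -> E01 (fun x => a * f x) = a * E01 f.
Proof. exact: (@int_bmfZ _ (measurableTypeR R) R (leb R) U mU fU a f). Qed.
Lemma E01_cst a : E01 (fun=> a) = a.
Proof. by rewrite /E01 Rintegral_cst ?lebU ?mulr1 //; exact: mU. Qed.
Lemma E01_sum (I : Type) (r : seq I) (F : I -> R -> R) : (forall i, bmU (F i)) ->
  E01 (fun x => \sum_(i <- r) F i x) = \sum_(i <- r) E01 (F i).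
Proof. exact: (@int_bmf_sum _ (measurableTypeR R) R (leb R) U mU fU I r F). Qed.
Lemma E01_norm f (M : R) : bmU f -> (forall x, 0 <= x <= 1 -> `|f x| <= M) -> `|E01 f| <= M.
Proof.
move=> bf fM; rewrite -[leRHS]mulr1 -[1]/(fine 1%E) -lebU.
apply: (@le_int_bmf _ (measurableTypeR R) R (leb R) U mU fU f M bf) => x.
by rewrite /= in_itv; exact: fM.
Qed.

Lemma E01_ge0 f : (forall x, 0 <= x <= 1 -> 0 <= f x) -> 0 <= E01 f.
Proof. by move=> f0; apply: Rintegral_ge0 => x; rewrite /= in_itv; exact: f0. Qed.
Lemma E01_norm_le f g : bmU f -> bmU g -> (forall x, 0 <= x <= 1 -> `|f x| <= g x) ->
  `|E01 f| <= E01 g :> R.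
Proof.
move=> bf bg h; rewrite ler_norml -mulN1r -E01Z //; apply/andP; split; apply: E01_le => //.
- exact: bmfZ.
- by move=> x /h; rewrite ler_norml mulN1r => /andP[].
- by move=> x /h; rewrite ler_norml => /andP[].
Qed.

Lemma E01_ae (f g : R -> R) : measurable_fun U f -> measurable_fun U g ->
  (\forall x \ae leb R, 0 <= x <= 1 -> f x = g x) -> E01 f = E01 g.
Proof.
move=> mf mg fg; rewrite /E01 /Rintegral; congr fine; apply: ae_eq_integral.
- exact: mU.
- exact/measurable_EFinP.
- exact/measurable_EFinP.
by apply: (@filterS _ _ (ae_filter_ringOfSetsType (leb R)) _ _ _ fg) => x /= h; rewrite in_itv => /h ->.
Qed.

Lemma cbm_cst a : cbm (fun=> a).
Proof. by split; exact: bmf_cst. Qed.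
Lemma cbm_eq f g : (forall x, 0 <= x <= 1 -> f x = g x) -> cbm f -> cbm g.
Proof.
move=> fg [a b]; split; [apply: bmf_eq a|apply: bmf_eq b];
  by move=> x; rewrite inE /= in_itv => /fg ->.
Qed.

Lemma cbmD f g : cbm f -> cbm g -> cbm (fun x => f x + g x).
Proof.
move=> [fr fi] [gr gi]; split.
  by apply: bmf_eq (bmfD fr gr) => x _; rewrite ReD.
by apply: bmf_eq (bmfD fi gi) => x _; rewrite ImD.
Qed.

Lemma cbmM f g : cbm f -> cbm g -> cbm (fun x => f x * g x).
Proof.
move=> [fr fi] [gr gi]; split.
  by apply: bmf_eq (bmfB (bmfM fr gr) (bmfM fi gi)) => x _; rewrite ReM.
by apply: bmf_eq (bmfD (bmfM fr gi) (bmfM fi gr)) => x _; rewrite ImM.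
Qed.

Lemma cbmZ a f : cbm f -> cbm (fun x => a * f x).
Proof. exact/cbmM/cbm_cst. Qed.
Lemma cbmN f : cbm f -> cbm (fun x => - f x).
Proof. by move=> bf; under eq_fun do rewrite -mulN1r; exact: cbmZ. Qed.
Lemma cbmB f g : cbm f -> cbm g -> cbm (fun x => f x - g x).
Proof. by move=> bf bg; apply: cbmD => //; exact: cbmN. Qed.
Lemma cbm_real f : bmU f -> cbm (fun x => (f x)%:C).
Proof. by move=> bf; split=> //=; exact: bmf_cst. Qed.
Lemma cbm_sum (I : Type) (r : seq I) (F : I -> R -> C) : (forall i, cbm (F i)) ->
  cbm (fun x => \sum_(i <- r) F i x).
Proof.
move=> bF; split.
  apply: (@bmf_eq _ _ _ _ (fun x => \sum_(i <- r) complex.Re (F i x))) => [x _|].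
    by rewrite Re_sum.
  by apply: bmf_sum => i; case: (bF i).
apply: (@bmf_eq _ _ _ _ (fun x => \sum_(i <- r) complex.Im (F i x))) => [x _|].
  by rewrite Im_sum.
by apply: bmf_sum => i; case: (bF i).
Qed.

Lemma Re_cI f : complex.Re (cI f) = E01 (fun x => complex.Re (f x)).
Proof. by []. Qed.
Lemma Im_cI f : complex.Im (cI f) = E01 (fun x => complex.Im (f x)).
Proof. by []. Qed.
Lemma eqC (z w : C) : complex.Re z = complex.Re w -> complex.Im z = complex.Im w -> z = w.
Proof. by case: z w => a b [c e] /= -> ->. Qed.
Lemma cI_eq f g : (forall x, 0 <= x <= 1 -> f x = g x) -> cI f = cI g.
Proof. by move=> fg; apply: eqC; rewrite !(Re_cI, Im_cI); apply: E01_eq => x /fg ->. Qed.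
Lemma cID f g : cbm f -> cbm g -> cI (fun x => f x + g x) = cI f + cI g.
Proof.
move=> [fr fi] [gr gi]; apply: eqC.
  by rewrite ReD !Re_cI -E01D //; apply: E01_eq => x _; rewrite ReD.
by rewrite ImD !Im_cI -E01D //; apply: E01_eq => x _; rewrite ImD.
Qed.

Lemma cIZ a f : cbm f -> cI (fun x => a * f x) = a * cI f.
Proof.
move=> [fr fi]; apply: eqC.
  rewrite ReM !Re_cI Im_cI -!E01Z // -E01B ?E01Z //; try exact: bmfZ.
  by apply: E01_eq => x _; rewrite ReM.
rewrite ImM !Im_cI Re_cI -!E01Z // -E01D ?E01Z //; try exact: bmfZ.
by apply: E01_eq => x _; rewrite ImM.
Qed.

Lemma cIN f : cbm f -> cI (fun x => - f x) = - cI f.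
Proof. by move=> bf; rewrite -mulN1r -cIZ //; apply: cI_eq => x _; rewrite mulN1r. Qed.
Lemma cIB f g : cbm f -> cbm g -> cI (fun x => f x - g x) = cI f - cI g.
Proof. by move=> bf bg; rewrite cID ?cIN //; exact: cbmN. Qed.
Lemma cI_cst a : cI (fun=> a) = a.
Proof. by apply: eqC; rewrite !(Re_cI, Im_cI) E01_cst. Qed.
Lemma cI_sum (I : Type) (r : seq I) (F : I -> R -> C) : (forall i, cbm (F i)) ->
  cI (fun x => \sum_(i <- r) F i x) = \sum_(i <- r) cI (F i).
Proof.
move=> bF; elim: r => [|i r IH].
  by rewrite big_nil -[RHS]cI_cst; apply: cI_eq => x _; rewrite big_nil.
rewrite big_cons -IH -cID //; last exact: cbm_sum.
by apply: cI_eq => x _; rewrite big_cons.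
Qed.

Lemma cabs_cI f M : cbm f -> (forall x, 0 <= x <= 1 -> cabs (f x) <= M) -> cabs (cI f) <= 2 * M.
Proof.
move=> [fr fi] fM; rewrite (le_trans (cabs_le_ReIm _)) // mulr_natl mulr2n Re_cI Im_cI.
rewrite lerD //; apply: E01_norm => // x /fM; apply: le_trans.
  exact: le_Re_cabs.
exact: le_Im_cabs.
Qed.

Lemma cabs_cI_E f phi : cbm f -> bmU phi ->
  (forall x, 0 <= x <= 1 -> cabs (f x) <= phi x) -> cabs (cI f) <= 2 * E01 phi.
Proof.
move=> [fr fi] bp fM; rewrite (le_trans (cabs_le_ReIm _)) // mulr_natl mulr2n Re_cI Im_cI.
rewrite lerD //; apply: E01_norm_le => // x /fM; apply: le_trans.
  exact: le_Re_cabs.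
exact: le_Im_cabs.
Qed.

Lemma cbm_bounded f : cbm f -> exists2 M, 0 <= M & forall x, 0 <= x <= 1 -> cabs (f x) <= M.
Proof.
move=> [[_ [M hM]] [_ [N hN]]]; exists (`|M| + `|N|); first exact: addr_ge0.
move=> x x01; rewrite (le_trans (cabs_le_ReIm _)) // lerD //.
  by rewrite (le_trans _ (ler_norm _)) // hM //= in_itv.
by rewrite (le_trans _ (ler_norm _)) // hN //= in_itv.
Qed.
End Unit.
Notation bmU := (@bmf _ (measurableTypeR _) _ `[0, 1]%classic).

Lemma E01_indic (R : realType) (A : set (measurableTypeR R)) : measurable A ->
  E01 (\1_A : R -> R) = fine (leb R (A `&` `[0, 1]%classic)).
Proof.
move=> mA; rewrite /E01 /Rintegral integral_indic //.
Qed.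

Section Pwh.
Context {R : realType} (L : nat) (I : 'I_L -> set R) (HI : interval_partition I).
Notation C := R[i].

Lemma part_sub l x : I l x -> 0 <= x <= 1.
Proof.
move=> Ix; have [[e _ _] _ _] := HI.
have : cover [set: 'I_L] I x by exists l.
by rewrite e /= in_itv.
Qed.

Lemma part_cover x : 0 <= x <= 1 -> exists l, I l x.
Proof.
move=> x01; have [[e _ _] _ _] := HI.
have : `[0 : R, 1]%classic x by rewrite /= in_itv.
by rewrite -e => -[l _ lx]; exists l.
Qed.

Lemma part_inj l k x : I l x -> I k x -> l = k.
Proof.
move=> lx kx; have [[_ t _] _ _] := HI.
by apply: t => //; exists x.
Qed.

Lemma part_meas l : measurable (I l : set (measurableTypeR R)).
Proof. by have [_ h _] := HI; exact: is_interval_measurable. Qed.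
Lemma part_ne l : exists x, I l x.
Proof. by have [[_ _ h] _ _] := HI; exact: h. Qed.

Definition pwr (f : R -> R) := exists2 c, 0 <= c &
  forall l x y, I l x -> I l y -> `|f x - f y| <= c * Num.sqrt `|x - y|.
Definition pwh (f : R -> C) := exists2 c, 0 <= c &
  forall l x y, I l x -> I l y -> cabs (f x - f y) <= c * Num.sqrt `|x - y|.

Lemma pwr_bounded f : pwr f -> exists2 M, 0 <= M & forall x, 0 <= x <= 1 -> `|f x| <= M.
Proof.
move=> [c c0 fc]; have /choice[p Ip] := part_ne.
exists (\sum_l `|f (p l)| + c); first by rewrite addr_ge0 // sumr_ge0.
move=> x x01; have [l lx] := part_cover x01.
rewrite -[f x](subrK (f (p l))) addrC (le_trans (ler_normD _ _)) // lerD //.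
  by rewrite (bigD1 l) //= lerDl sumr_ge0.
rewrite (le_trans (fc _ _ _ lx (Ip l))) // ler_piMr //.
have /andP[? ?] := part_sub (Ip l); have /andP[? ?] := x01.
by rewrite -sqrtr1 ler_wsqrtr // ler_norml; apply/andP; split; lra.
Qed.

(** Only used to obtain measurability and the intermediate value property. *)
Lemma holder_within (A : set R) (f : R -> R) (c : R) : 0 <= c ->
  (forall x y, A x -> A y -> `|f x - f y| <= c * Num.sqrt `|x - y|) ->
  {within A, continuous f}.
Proof.
move=> c0 fc; apply/subspace_continuousP => x lx; apply/cvgrPdist_lt => e e0.
have d0 : 0 < (e / (c + 1)) ^+ 2 by rewrite exprn_gt0 // divr_gt0 // ltr_wpDl.
rewrite /prop_near1 nbhs_simpl /within /=.
exists ((e / (c + 1)) ^+ 2) => //= y /= xy ly.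
apply: (le_lt_trans (fc _ _ lx ly)).
apply: (@le_lt_trans _ _ (c * (e / (c + 1)))).
  have q0 : 0 <= e / (c + 1) by rewrite divr_ge0 ?addr_ge0 ?(ltW e0).
  by rewrite ler_wpM2l // -(ger0_norm q0) -[leRHS]sqrtr_sqr ler_wsqrtr // ltW.
by rewrite mulrA ltr_pdivrMr ?ltr_wpDl // mulrC ltr_pM2l // ltrDl.
Qed.

Lemma pwr_meas f : pwr f -> measurable_fun `[0 : R, 1] f.
Proof.
move=> [c c0 fc].
have mI l : measurable_fun (I l) f.
  apply: subspace_continuous_measurable_fun; first exact: part_meas.
  by apply: (holder_within c0) => x y lx ly; exact: fc lx ly.
have [[e _ _] _ _] := HI.
rewrite -e; pose F n := if insub n is Some l then I l else set0.
have -> : cover [set: 'I_L] I = \bigcup_n F n.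
  apply/seteqP; split=> x [n _].
    by move=> nx; exists (n : nat) => //; rewrite /F valK.
  by rewrite /F; case: insubP => // l _ _ lx; exists l.
apply/measurable_fun_bigcup => n; rewrite /F.
  by case: insubP => // l _ _; exact: part_meas.
by case: insub => [l|]; [exact: mI|exact: measurable_fun_set0].
Qed.

Lemma pwr_bmf f : pwr f -> bmU f.
Proof.
move=> pf; split; first exact: pwr_meas.
by have [M _ h] := pwr_bounded pf; exists M => x; rewrite /= in_itv; exact: h.
Qed.

Lemma pwhE f : pwh f <-> pwr (fun x => complex.Re (f x)) /\ pwr (fun x => complex.Im (f x)).
Proof.
split=> [[c c0 fc]|[[c c0 fc] [e e0 fe]]].
  split; exists c => // l x y lx ly; rewrite -?ReB -?ImB; apply: le_trans (fc _ _ _ lx ly).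
    exact: le_Re_cabs.
  exact: le_Im_cabs.
exists (c + e); first exact: addr_ge0.
move=> l x y lx ly; rewrite (le_trans (cabs_le_ReIm _)) // mulrDl ReB ImB lerD //.
  exact: fc lx ly.
exact: fe lx ly.
Qed.

Lemma pwh_cbm f : pwh f -> cbm f.
Proof. by move=> /pwhE[fr fi]; split; exact: pwr_bmf. Qed.
Lemma pwh_bounded f : pwh f -> exists2 M, 0 <= M & forall x, 0 <= x <= 1 -> cabs (f x) <= M.
Proof. by move=> /pwh_cbm/cbm_bounded. Qed.
Lemma pwh_cst a : pwh (fun=> a).
Proof. by exists 0 => // l x y _ _; rewrite subrr cabs0 mul0r. Qed.
Lemma pwhD f g : pwh f -> pwh g -> pwh (fun x => f x + g x).
Proof.
move=> [c c0 fc] [e e0 ge]; exists (c + e); first exact: addr_ge0.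
move=> l x y lx ly; rewrite opprD addrACA (le_trans (le_cabsD _ _)) // mulrDl lerD //.
  exact: fc lx ly.
exact: ge lx ly.
Qed.

Lemma pwhM f g : pwh f -> pwh g -> pwh (fun x => f x * g x).
Proof.
move=> pf pg; have [M M0 fM] := pwh_bounded pf; have [N N0 gN] := pwh_bounded pg.
case: pf pg => [c c0 fc] [e e0 ge]; exists (c * N + M * e).
  by rewrite addr_ge0 // mulr_ge0.
move=> l x y lx ly.
have -> : f x * g x - f y * g y = (f x - f y) * g x + f y * (g x - g y).
  by rewrite mulrBl mulrBr addrA subrK.
rewrite (le_trans (le_cabsD _ _)) // [leRHS]mulrDl !cabsM lerD //.
  by rewrite mulrAC ler_pM ?cabs_ge0 //; [exact: fc lx ly|exact: gN (part_sub lx)].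
by rewrite -mulrA ler_pM ?cabs_ge0 //; [exact: fM (part_sub ly)|exact: ge lx ly].
Qed.

Lemma pwhN f : pwh f -> pwh (fun x => - f x).
Proof.
move=> [c c0 fc]; exists c => // l x y lx ly; rewrite -opprD cabsN; exact: fc lx ly.
Qed.

Lemma pwhZ a f : pwh f -> pwh (fun x => a * f x).
Proof. exact/pwhM/pwh_cst. Qed.
Lemma pwh_sum (J : Type) (r : seq J) (F : J -> R -> C) : (forall i, pwh (F i)) ->
  pwh (fun x => \sum_(i <- r) F i x).
Proof.
move=> pF; elim: r => [|i r IH].
  by under eq_fun do rewrite big_nil; exact: pwh_cst.
by under eq_fun do rewrite big_cons; exact: pwhD.
Qed.

Definition kern (k : R -> R -> R) (H : R) := [/\ 0 <= H,
  forall x y, 0 <= x <= 1 -> 0 <= y <= 1 -> `|k x y| <= H,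
  forall l x x' y, 0 <= y <= 1 -> I l x -> I l x' -> `|k x y - k x' y| <= H * Num.sqrt `|x - x'| &
  forall l x y y', 0 <= x <= 1 -> I l y -> I l y' -> `|k x y - k x y'| <= H * Num.sqrt `|y - y'|].

(** Transposed kernels give the adjoint operators. *)
Lemma kern_swap k H : kern k H -> kern (fun x y => k y x) H.
Proof. move=> [a b c e]; split=> //.
- by move=> x y x01 y01; exact: b.
- by move=> l x x' y y01 lx lx'; exact: (e l y).
- by move=> l x y y' x01 ly ly'; exact: (c l y y'). Qed.

Lemma kern_pwr k H x : kern k H -> 0 <= x <= 1 -> pwr (k x).
Proof. by move=> [a b c e] x01; exists H; [exact: a|move=> l y y' ly ly'; exact: (e l)]. Qed.

Definition kop (k : R -> R -> R) (g : R -> C) (x : R) : C := cI (fun y => (k x y)%:C * g y).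

Lemma kern_cbm k H g x : kern k H -> cbm g -> 0 <= x <= 1 -> cbm (fun y => (k x y)%:C * g y).
Proof. by move=> kH bg x01; apply: cbmM => //; apply/cbm_real/pwr_bmf/(kern_pwr kH). Qed.

Lemma kop_holderE k H g phi l x x' : kern k H -> cbm g -> bmU phi ->
  (forall y, 0 <= y <= 1 -> cabs (g y) <= phi y) -> I l x -> I l x' ->
  cabs (kop k g x - kop k g x') <= 2 * (H * E01 phi) * Num.sqrt `|x - x'|.
Proof.
move=> kH bg bp gG lx lx'; have [H0 _ kx _] := kH.
rewrite /kop -cIB; [|exact: (kern_cbm kH bg (part_sub lx))|exact: (kern_cbm kH bg (part_sub lx'))].
rewrite -mulrA [H * _ * _]mulrAC -E01Z //; apply: cabs_cI_E => [||y y01].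
- by apply: cbmB; [exact: (kern_cbm kH bg (part_sub lx))|exact: (kern_cbm kH bg (part_sub lx'))].
- exact: bmfZ.
rewrite -mulrBl -rmorphB cabsM cabs_real ler_pM ?cabs_ge0 //.
  exact: kx lx lx'.
exact: gG.
Qed.

Lemma kop_boundE k H g phi x : kern k H -> cbm g -> bmU phi ->
  (forall y, 0 <= y <= 1 -> cabs (g y) <= phi y) -> 0 <= x <= 1 ->
  cabs (kop k g x) <= 2 * (H * E01 phi).
Proof.
move=> kH bg bp gG x01; have [H0 kb _ _] := kH.
rewrite -E01Z //; apply: cabs_cI_E => [||y y01]; first exact: (kern_cbm kH bg).
  exact: bmfZ.
by rewrite cabsM cabs_real ler_pM ?cabs_ge0 // ?kb // gG.
Qed.

Lemma kop_holder k H g G l x x' : kern k H -> cbm g ->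
  (forall y, 0 <= y <= 1 -> cabs (g y) <= G) -> I l x -> I l x' ->
  cabs (kop k g x - kop k g x') <= 2 * (H * G) * Num.sqrt `|x - x'|.
Proof.
move=> kH bg gG lx lx'; rewrite -[G in leRHS]E01_cst.
by apply: (kop_holderE kH bg _ gG lx lx'); exact: bmf_cst.
Qed.

Lemma pwh_kop k H g : kern k H -> cbm g -> pwh (kop k g).
Proof.
move=> kH bg; have [G G0 gG] := cbm_bounded bg; have [H0 _ _ _] := kH.
exists (2 * (H * G)); first by rewrite !mulr_ge0.
by move=> l x y lx ly; apply: (kop_holder kH bg gG lx ly).
Qed.

(** A grid of mesh 1/(n+1) refined by the partition. The index goes up to n+1 so that the point
1 is covered. *)
Definition cell n (p : 'I_L * 'I_n.+2) : set R :=
  I p.1 `&` `[p.2%:R / n.+1%:R, p.2.+1%:R / n.+1%:R[%classic.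

Lemma cell_meas n p : measurable (@cell n p : set (measurableTypeR R)).
Proof. apply: measurableI; [exact: part_meas|exact: measurable_itv]. Qed.

Lemma cellP n p x : @cell n p x <-> I p.1 x /\ p.2%:R <= n.+1%:R * x < p.2.+1%:R.
Proof.
rewrite /cell /setI /= in_itv /= ler_pdivrMr ?ltr0Sn // ltr_pdivlMr ?ltr0Sn //.
by rewrite mulrC.
Qed.

Lemma cell_cover n x : 0 <= x <= 1 -> exists p, @cell n p x.
Proof.
move=> /[dup] x01 /andP[x0 x1]; have [l lx] := part_cover x01.
have nx0 : 0 <= n.+1%:R * x by rewrite mulr_ge0.
have /andP[t1 t2] := truncn_itv nx0.
have pn : (Num.truncn (n.+1%:R * x) < n.+2)%N.
  rewrite ltnS -(ler_nat R) (le_trans t1) // -[leRHS]mulr1.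
  by rewrite ler_wpM2l.
by exists (l, Ordinal pn); apply/cellP; split=> //=; rewrite t1 t2.
Qed.

Lemma cell_inj n p q x : @cell n p x -> @cell n q x -> p = q.
Proof.
case: p q => p1 p2 [q1 q2] /cellP[/= i1 /andP[a1 b1]] /cellP[/= i2 /andP[a2 b2]].
rewrite (part_inj i1 i2); congr (_, _); apply: val_inj => /=.
have := le_lt_trans a1 b2; have := le_lt_trans a2 b1; rewrite !ltr_nat !ltnS => ? ?.
by apply/eqP; rewrite eqn_leq; apply/andP.
Qed.

Lemma cell_diam n p x y : @cell n p x -> @cell n p y -> `|x - y| <= n.+1%:R^-1.
Proof.
move=> /cellP[_ /andP[a1 b1]] /cellP[_ /andP[a2 b2]].
rewrite -(ler_pM2l (ltr0Sn R n)) divff ?gt_eqF ?ltr0Sn //.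
rewrite -[n.+1%:R in leLHS]ger0_norm // -normrM mulrBr.
rewrite -[p.2.+1]addn1 natrD in b1 b2.
by rewrite ler_norml; apply/andP; split; lra.
Qed.

Lemma cell_sum (n : nat) (V : 'I_L * 'I_n.+2 -> C) p x : @cell n p x ->
  \sum_q (\1_(@cell n q) x : R)%:C * V q = V p.
Proof.
move=> px; rewrite (bigD1 p) //= indicE mem_set // mul1r big1 ?addr0 // => q qp.
rewrite indicE memNset ?mul0r // => qx.
by rewrite (cell_inj qx px) eqxx in qp.
Qed.

Lemma bmU_cell n p : bmU (\1_(@cell n p) : R -> R).
Proof.
split; first by apply: measurable_indic; exact: cell_meas.
by exists 1 => x _; rewrite indicE; case: (_ \in _); rewrite ?normr1 ?normr0.
Qed.

Lemma le_inv_nat0 (a b : R) : (forall n, a <= b / n.+1%:R) -> a <= 0.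
Proof.
move=> h; rewrite leNgt; apply/negP => a0.
have := h (Num.truncn (b / a)); rewrite leNgt => /negP; apply.
rewrite ltr_pdivrMr ?ltr0Sn // mulrC -ltr_pdivrMr //.
exact: truncnS_gt.
Qed.

(** Fubini for a kernel which is Hoelder in each variable. Replacing the first variable of the
kernel by a sample point of its cell turns the kernel into a finite sum of functions of one
variable each, for which the exchange is linearity; the error is O(n^-1/2). *)
Lemma kop_sym k H f g : kern k H -> pwh f -> pwh g ->
  cI (fun x => f x * kop k g x) = cI (fun y => g y * kop (fun x y => k y x) f y).
Proof.
move=> kH pf pg; have kH' := kern_swap kH; have [H0 _ kx _] := kH.
have bf := pwh_cbm pf; have bg := pwh_cbm pg.
have [F F0 fF] := cbm_bounded bf; have [G G0 gG] := cbm_bounded bg.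
have pk := pwh_cbm (pwh_kop kH bg); have pk' := pwh_cbm (pwh_kop kH' bf).
set lhs := LHS; set rhs := RHS.
pose s (n : nat) : R := Num.sqrt (n.+1%:R^-1).
have s0 n : 0 <= s n by exact: sqrtr_ge0.
suff main n : cabs (lhs - rhs) <= 8 * (F * G * H) * s n.
  apply/eqP; rewrite -subr_eq0; apply/eqP/eq0_cabs/eqP.
  rewrite eq_le cabs_ge0 andbT -[leLHS]ger0_norm ?cabs_ge0 // -sqrtr_sqr.
  suff : cabs (lhs - rhs) ^+ 2 <= 0 by move=> h; rewrite (ler0_sqrtr h).
  apply: (@le_inv_nat0 _ ((8 * (F * G * H)) ^+ 2)) => n.
  have -> : n.+1%:R^-1 = s n ^+ 2 by rewrite sqr_sqrtr ?invr_ge0.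
  by rewrite -exprMn ler_sqr ?nnegrE ?cabs_ge0 // !mulr_ge0.
(* The default value 0 is for empty cells, on which V and W are set to 0. *)
pose r p : R := xget 0 (@cell n p).
have rP p x : cell p x -> cell p (r p) by move=> px; apply: (xgetPex _ (ex_intro _ x px)).
have close p x : cell p x -> Num.sqrt `|x - r p| <= s n.
  by move=> px; rewrite ler_wsqrtr // (cell_diam px (rP _ _ px)).
pose ind (p : 'I_L * 'I_n.+2) x : C := (\1_(@cell n p) x : R)%:C.
have bind p : cbm (ind p) by apply/cbm_real/bmU_cell.
pose V p := if `[< exists x, cell p x >] then kop k g (r p) else 0.
pose W y p : R := if `[< exists x, cell p x >] then k (r p) y else 0.
pose S := \sum_p cI (fun x => f x * ind p x) * V p.
have r01 p x : cell p x -> 0 <= r p <= 1 by move=> /rP[/part_sub].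
have bW p : cbm (fun y => (W y p)%:C).
  rewrite /W; case: asboolP => [[x px]|_]; last exact: cbm_cst.
  by apply/cbm_real/pwr_bmf/(kern_pwr kH (r01 _ _ px)).
have WV p : cI (fun y => (W y p)%:C * g y) = V p.
  rewrite /W /V; case: asboolP => // _.
  rewrite -[RHS](cI_cst 0); apply: cI_eq => y _; by rewrite mul0r.
have E1 : cabs (lhs - S) <= 2 * (F * (2 * (H * G) * s n)).
  have -> : S = cI (fun x => f x * \sum_p ind p x * V p).
    have eS p : cI (fun x => f x * ind p x) * V p = cI (fun x => V p * (f x * ind p x)).
      by rewrite cIZ 1?mulrC //; exact: cbmM.
    rewrite /S (eq_bigr _ (fun p _ => eS p)) -cI_sum => [|p]; last exact/cbmZ/cbmM.
    by apply: cI_eq => x _; rewrite mulr_sumr; apply: eq_bigr => p _; rewrite mulrC mulrA.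
  have bs : cbm (fun x => \sum_p ind p x * V p).
    by apply: cbm_sum => p; apply: cbmM => //; exact: cbm_cst.
  rewrite /lhs -cIB; [|exact: cbmM|exact: cbmM].
  apply: cabs_cI => [|x x01]; first by apply: cbmB; exact: cbmM.
  have [p px] := @cell_cover n x x01.
  rewrite (cell_sum _ px) -mulrBr cabsM ler_pM ?cabs_ge0 ?fF //.
  rewrite /V; case: asboolP => [_|[]]; last by exists x.
  apply: le_trans (kop_holder kH bg gG (proj1 px) (proj1 (rP _ _ px))) _.
  by rewrite ler_wpM2l ?mulr_ge0 // close.
have E2 : cabs (rhs - S) <= 2 * (G * (2 * (H * s n * F))).
  have -> : S = cI (fun y => g y * cI (fun x => \sum_p ind p x * (W y p)%:C * f x)).
    have e y : 0 <= y <= 1 -> cI (fun x => \sum_p ind p x * (W y p)%:C * f x) =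
        \sum_p (W y p)%:C * cI (fun x => f x * ind p x).
      move=> _; rewrite cI_sum => [|p]; last first.
        by apply: cbmM => //; apply: cbmM => //; exact: cbm_cst.
      apply: eq_bigr => p _; rewrite -cIZ; last exact: cbmM.
      by apply: cI_eq => x _; ring.
    rewrite (cI_eq (g := fun y => \sum_p cI (fun x => f x * ind p x) * ((W y p)%:C * g y))).
      rewrite cI_sum => [|p]; last exact/cbmZ/cbmM.
      by apply: eq_bigr => p _; rewrite cIZ ?WV //; exact: cbmM.
    by move=> y /e ->; rewrite mulr_sumr; apply: eq_bigr => p _; ring.
  have bs y : cbm (fun x => \sum_p ind p x * (W y p)%:C * f x).
    by apply: cbm_sum => p; apply: cbmM => //; apply: cbmM => //; exact: cbm_cst.
  have bS : cbm (fun y => cI (fun x => \sum_p ind p x * (W y p)%:C * f x)).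
    apply: (@cbm_eq _ (fun y => \sum_p (W y p)%:C * cI (fun x => f x * ind p x))).
      move=> y _; rewrite cI_sum => [|p]; last first.
        by apply: cbmM => //; apply: cbmM => //; exact: cbm_cst.
      apply: eq_bigr => p _; rewrite -cIZ; last exact: cbmM.
      by apply: cI_eq => x _; ring.
    by apply: cbm_sum => p; apply: cbmM => //; exact: cbm_cst.
  rewrite /rhs -cIB; [|exact: cbmM|exact: cbmM].
  apply: cabs_cI => [|y y01]; first by apply: cbmB; exact: cbmM.
  rewrite -mulrBr cabsM ler_pM ?cabs_ge0 ?gG //.
  have bk : cbm (fun x => (k x y)%:C * f x) by exact: (kern_cbm kH' bf y01).
  rewrite /kop -cIB //; apply: cabs_cI => [|x x01]; first exact: cbmB.
  have [p px] := @cell_cover n x x01.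
  rewrite -mulr_suml (cell_sum (fun p => (W y p)%:C) px) -mulrBl cabsM ler_pM ?cabs_ge0 ?fF //.
  rewrite /W; case: asboolP => [_|[]]; last by exists x.
  rewrite -rmorphB cabs_real.
  apply: le_trans (kx _ _ _ _ y01 (proj1 px) (proj1 (rP _ _ px))) _.
  by rewrite ler_wpM2l // close.
have -> : lhs - rhs = (lhs - S) - (rhs - S) by rewrite opprB addrA subrK.
rewrite (le_trans (ler_cabsB _ _)) //.
by move: (lerD E1 E2) => /le_trans; apply; rewrite le_eqVlt; apply/orP; left; apply/eqP; ring.
Qed.
End Pwh.

(** * Self-energies in Kraus form and the Dyson equation *)

(* The integrals are used through their linearity and monotonicity only. *)
Opaque E01 cI.

(** A self-energy written as r |-> sum_j c_j K_j[r] c_j^*. The involution [md_s] pairs each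
summand with its adjoint, which is what makes the sum symmetric for the trace. Equations
assumed almost everywhere in the data are required everywhere here. *)
Record model (R : realType) (L : nat) (I : 'I_L -> set R) (K : nat) := Model {
  md_part : interval_partition I;
  md_J : finType;
  md_c : md_J -> 'M[R[i]]_K;
  md_k : md_J -> R -> R -> R;
  md_s : md_J -> md_J;
  md_H : R;
  md_a : R -> 'M[R[i]]_K;
  md_kern : forall j, kern I (md_k j) md_H;
  md_k_ge0 : forall j x y, 0 <= x <= 1 -> 0 <= y <= 1 -> 0 <= md_k j x y;
  md_sK : involutive md_s;
  md_k_s : forall j x y, 0 <= x <= 1 -> 0 <= y <= 1 -> md_k (md_s j) x y = md_k j y x;
  md_c_s : forall j, md_c (md_s j) = (md_c j)^t*;
  md_pwh : forall i j, pwh I (fun x => md_a x i j);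
  md_herm : forall x, 0 <= x <= 1 -> (md_a x)^t* = md_a x
}.

Section Kraus.
Context {R : realType} (L : nat) (I : 'I_L -> set R) (K : nat) (md : model I K).
Notation C := R[i].
Local Notation HI := (md_part md).
Local Notation J := (md_J md).
Local Notation cc := (md_c (m := md)).
Local Notation kk := (md_k (m := md)).
Local Notation sg := (md_s (m := md)).
Local Notation H := (md_H md).
Local Notation a := (md_a md).
Local Notation kH := (md_kern (m := md)).
Local Notation kk_ge0 := (md_k_ge0 (m := md)).
Local Notation sgK := (md_sK (m := md)).
Local Notation kk_sg := (md_k_s (m := md)).
Local Notation cc_sg := (md_c_s (m := md)).
Local Notation pa := (md_pwh md).
Local Notation ha := (md_herm md).

Definition mcbm m n (r : R -> 'M[C]_(m, n)) := forall a b, cbm (fun x => r x a b).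
Definition mpwh m n (r : R -> 'M[C]_(m, n)) := forall a b, pwh I (fun x => r x a b).
Definition mkop m n (k : R -> R -> R) (r : R -> 'M[C]_(m, n)) x : 'M[C]_(m, n) :=
  \matrix_(a, b) kop k (fun y => r y a b) x.
Definition SE (r : R -> 'M[C]_K) (x : R) : 'M[C]_K :=
  \sum_j cc j *m mkop (kk j) r x *m (cc j)^t*.

Lemma mpwh_mcbm m n (r : R -> 'M[C]_(m, n)) : mpwh r -> mcbm r.
Proof. by move=> pr a b; apply: (pwh_cbm HI). Qed.
Lemma mpwhD m n (r s : R -> 'M[C]_(m, n)) : mpwh r -> mpwh s -> mpwh (fun x => r x + s x).
Proof. by move=> pr ps a b; under eq_fun do rewrite mxE; exact: pwhD. Qed.
Lemma mpwhN m n (r : R -> 'M[C]_(m, n)) : mpwh r -> mpwh (fun x => - r x).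
Proof. by move=> pr a b; under eq_fun do rewrite mxE; exact: pwhN. Qed.
Lemma mpwh_cst m n (A : 'M[C]_(m, n)) : mpwh (fun=> A).
Proof. by move=> a b; exact: pwh_cst. Qed.
Lemma mpwhM m n p (r : R -> 'M[C]_(m, n)) (s : R -> 'M[C]_(n, p)) :
  mpwh r -> mpwh s -> mpwh (fun x => r x *m s x).
Proof.
move=> pr ps a b; under eq_fun do rewrite mxE.
by apply: pwh_sum => k; exact: (pwhM HI).
Qed.

Lemma mpwh_sum m n (A : Type) (s : seq A) (r : A -> R -> 'M[C]_(m, n)) :
  (forall i, mpwh (r i)) -> mpwh (fun x => \sum_(i <- s) r i x).
Proof.
move=> pr a b; under eq_fun do rewrite summxE.
by apply: pwh_sum => k; exact: pr.
Qed.

Lemma mcbmB m n (r s : R -> 'M[C]_(m, n)) : mcbm r -> mcbm s -> mcbm (fun x => r x - s x).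
Proof. by move=> pr ps a b; under eq_fun do rewrite 2!mxE; exact: cbmB. Qed.
Lemma mpwh_tr (r : R -> 'M[C]_K) : mpwh r -> pwh I (fun x => \tr (r x)).
Proof. by move=> pr; apply: pwh_sum => i; exact: pr. Qed.

Lemma mxle_bound m n (r : R -> 'M[C]_(m, n)) : mpwh r ->
  exists2 M, 0 < M & forall x, 0 <= x <= 1 -> mxle (r x) M.
Proof.
move=> pr; have h (p : 'I_m * 'I_n) : exists M, 0 <= M /\ forall x, 0 <= x <= 1 -> cabs (r x p.1 p.2) <= M.
  by have [M M0 hM] := pwh_bounded HI (pr p.1 p.2); exists M.
have /choice[f hf] := h; exists (1 + \sum_p f p).
  by rewrite ltr_pwDl // sumr_ge0 // => p _; case: (hf p).
move=> x x01 i j; rewrite (bigD1 (i, j)) //= (le_trans (proj2 (hf (i, j)) x x01)) //.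
rewrite addrCA lerDl addr_ge0 // sumr_ge0 // => p _; by case: (hf p).
Qed.

Lemma mpwh_holder (r : R -> 'M[C]_K) : mpwh r -> exists2 c, 0 <= c &
  forall l x y, I l x -> I l y -> mxle (r x - r y) (c * Num.sqrt `|x - y|).
Proof.
move=> pr; have h (p : 'I_K * 'I_K) : exists c, 0 <= c /\ forall l x y, I l x -> I l y ->
    cabs (r x p.1 p.2 - r y p.1 p.2) <= c * Num.sqrt `|x - y|.
  by have [c c0 hc] := pr p.1 p.2; exists c.
have /choice[f hf] := h; exists (\sum_p f p).
  by apply: sumr_ge0 => p _; case: (hf p).
move=> l x y lx ly i j; rewrite !mxE.
have [_ /(_ l x y lx ly) /= hc] := hf (i, j); rewrite (le_trans hc) // ler_wpM2r ?sqrtr_ge0 //.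
by rewrite (bigD1 (i, j)) //= lerDl sumr_ge0 // => p _; case: (hf p).
Qed.

Lemma E01_lin_le (fa fb fc : R -> R) lam : bmU fa -> bmU fb -> bmU fc ->
  (forall y, 0 <= y <= 1 -> 2 * fa y <= lam * (fb y + fc y)) ->
  2 * E01 fa <= lam * (E01 fb + E01 fc).
Proof.
move=> ba bb bc h; rewrite -(E01D bb bc) -(E01Z 2 ba) -(E01Z lam (bmfD bb bc)).
exact: (E01_le (bmfZ 2 ba) (bmfZ lam (bmfD bb bc)) h).
Qed.

Lemma dot_mxE n (p q : 'cV[C]_n) (M : 'M[C]_n) :
  dot p (M *m q) = \sum_a \sum_b (Num.conj (p a 0) * q b 0) * M a b.
Proof.
rewrite dotE; apply: eq_bigr => a _; rewrite mxE mulr_sumr; apply: eq_bigr => b _.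
by rewrite mulrA mulrAC.
Qed.

Lemma cbm_dot n (p q : 'cV[C]_n) (r : R -> 'M[C]_n) : mcbm r -> cbm (fun y => dot p (r y *m q)).
Proof.
move=> br; under eq_fun do rewrite dot_mxE.
by apply: cbm_sum => a; apply: cbm_sum => b; exact: cbmZ.
Qed.

Lemma dot_mkop j n (p q : 'cV[C]_n) (r : R -> 'M[C]_n) x : mcbm r -> 0 <= x <= 1 ->
  dot p (mkop (kk j) r x *m q) = cI (fun y => (kk j x y)%:C * dot p (r y *m q)).
Proof.
move=> br x01.
have bk a b : cbm (fun y => (kk j x y)%:C * r y a b) by apply: (kern_cbm HI (kH j)).
rewrite dot_mxE (cI_eq (g := fun y => \sum_a \sum_b
    (Num.conj (p a 0) * q b 0) * ((kk j x y)%:C * r y a b))); last first.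
  move=> y _; rewrite dot_mxE mulr_sumr; apply: eq_bigr => a _.
  by rewrite mulr_sumr; apply: eq_bigr => b _; rewrite mulrCA.
rewrite cI_sum => [|a]; last by apply: cbm_sum => b; exact: cbmZ.
apply: eq_bigr => a _; rewrite cI_sum => [|b]; last exact: cbmZ.
by apply: eq_bigr => b _; rewrite cIZ // mxE.
Qed.

(** Kraus form: the quadratic form of S[r] is an average, with nonnegative weights, of quadratic
forms of r. *)
Lemma SE_form (r : R -> 'M[C]_K) u v x : mcbm r -> 0 <= x <= 1 ->
  dot u (SE r x *m v) = \sum_j cI (fun y => (kk j x y)%:C *
    dot ((cc j)^t* *m u) (r y *m ((cc j)^t* *m v))).
Proof.
move=> br x01; rewrite /SE mulmx_suml.
have -> : dot u (\sum_j cc j *m mkop (kk j) r x *m (cc j)^t* *m v) =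
    \sum_j dot u (cc j *m mkop (kk j) r x *m (cc j)^t* *m v).
  by rewrite /dot mulmx_sumr summxE.
by apply: eq_bigr => j _; rewrite -!mulmxA dot_adj dot_mkop.
Qed.

Lemma cbm_kdot j u v (r : R -> 'M[C]_K) x : mcbm r -> 0 <= x <= 1 ->
  cbm (fun y => (kk j x y)%:C * dot u (r y *m v)).
Proof. by move=> br x01; apply: (kern_cbm HI (kH j)) => //; exact: cbm_dot. Qed.

Lemma Re_SE_form (r : R -> 'M[C]_K) u v x : mcbm r -> 0 <= x <= 1 ->
  complex.Re (dot u (SE r x *m v)) = \sum_j E01 (fun y => kk j x y *
    complex.Re (dot ((cc j)^t* *m u) (r y *m ((cc j)^t* *m v)))).
Proof.
move=> br x01; rewrite SE_form // Re_sum; apply: eq_bigr => j _.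
by rewrite Re_cI; apply: E01_eq => y _; rewrite ReMc.
Qed.

Lemma Im_SE_form (r : R -> 'M[C]_K) u v x : mcbm r -> 0 <= x <= 1 ->
  complex.Im (dot u (SE r x *m v)) = \sum_j E01 (fun y => kk j x y *
    complex.Im (dot ((cc j)^t* *m u) (r y *m ((cc j)^t* *m v)))).
Proof.
move=> br x01; rewrite SE_form // Im_sum; apply: eq_bigr => j _.
by rewrite Im_cI; apply: E01_eq => y _; rewrite ImMc.
Qed.

Lemma bm_kReIm j u v (r : R -> 'M[C]_K) x : mcbm r -> 0 <= x <= 1 ->
  bmU (fun y => kk j x y * complex.Re (dot u (r y *m v))) /\
  bmU (fun y => kk j x y * complex.Im (dot u (r y *m v))).
Proof.
move=> br x01; have [a b] := cbm_kdot j u v br x01.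
by split; [apply: bmf_eq a|apply: bmf_eq b] => y _; rewrite ?ReMc ?ImMc.
Qed.

Lemma SE_im_ge0 (r : R -> 'M[C]_K) : mcbm r ->
  (forall y, 0 <= y <= 1 -> forall u, 0 <= complex.Im (dot u (r y *m u))) ->
  forall x, 0 <= x <= 1 -> forall u, 0 <= complex.Im (dot u (SE r x *m u)).
Proof.
move=> br r0 x x01 u; rewrite Im_SE_form //; apply: sumr_ge0 => j _.
by apply: E01_ge0 => y y01; rewrite mulr_ge0 ?kk_ge0 // r0.
Qed.

(** Inequalities between quadratic forms pass through S because of [SE_form]. *)
Lemma SE_mono (r r1 r2 : R -> 'M[C]_K) (lam : R) : mcbm r -> mcbm r1 -> mcbm r2 ->
  (forall y, 0 <= y <= 1 -> forall u v, 2 * complex.Re (dot u (r y *m v)) <=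
     lam * (complex.Im (dot u (r1 y *m u)) + complex.Im (dot v (r2 y *m v)))) ->
  forall x, 0 <= x <= 1 -> forall u v, 2 * complex.Re (dot u (SE r x *m v)) <=
     lam * (complex.Im (dot u (SE r1 x *m u)) + complex.Im (dot v (SE r2 x *m v))).
Proof.
move=> br br1 br2 h x x01 u v; rewrite Re_SE_form // !Im_SE_form //.
rewrite -big_split /= !mulr_sumr; apply: ler_sum => j _.
have [a _] := bm_kReIm j ((cc j)^t* *m u) ((cc j)^t* *m v) br x01.
have [_ b] := bm_kReIm j ((cc j)^t* *m u) ((cc j)^t* *m u) br1 x01.
have [_ c] := bm_kReIm j ((cc j)^t* *m v) ((cc j)^t* *m v) br2 x01.
apply: E01_lin_le => // y y01.
rewrite [2 * _]mulrCA -mulrDr [lam * _]mulrCA ler_wpM2l ?kk_ge0 //.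
exact: h.
Qed.

Lemma mkopB m n k (r s : R -> 'M[C]_(m, n)) x : kern I k H -> mcbm r -> mcbm s -> 0 <= x <= 1 ->
  mkop k (fun y => r y - s y) x = mkop k r x - mkop k s x.
Proof.
move=> kh br bs x01; apply/matrixP => a b; rewrite !mxE /kop -cIB; first last.
- exact: (kern_cbm HI kh).
- exact: (kern_cbm HI kh).
by apply: cI_eq => y _; rewrite !mxE mulrBr.
Qed.

Lemma SEB (r s : R -> 'M[C]_K) x : mcbm r -> mcbm s -> 0 <= x <= 1 ->
  SE (fun y => r y - s y) x = SE r x - SE s x.
Proof.
move=> br bs x01; rewrite /SE -sumrB; apply: eq_bigr => j _.
by rewrite (mkopB (kH j)) // mulmxBr mulmxBl.
Qed.

Lemma mpwh_mkop m n k (r : R -> 'M[C]_(m, n)) : kern I k H -> mcbm r -> mpwh (mkop k r).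
Proof.
move=> kh br a b; under eq_fun do rewrite mxE.
exact: (pwh_kop HI kh).
Qed.

Lemma mpwh_SE r : mcbm r -> mpwh (SE r).
Proof.
move=> br; apply: mpwh_sum => j; apply: mpwhM; last exact: mpwh_cst.
by apply: mpwhM; [exact: mpwh_cst|exact: (mpwh_mkop (kH j))].
Qed.

Lemma mxle_sum m n (T : Type) (s : seq T) (A : T -> 'M[C]_(m, n)) (c : T -> R) :
  (forall i, mxle (A i) (c i)) -> mxle (\sum_(i <- s) A i) (\sum_(i <- s) c i).
Proof.
by move=> h a b; rewrite summxE (le_trans (cabs_le_sum _ _ _)) //; apply: ler_sum => i _; exact: h.
Qed.

(** The kernels are bounded and Hoelder, so integrating r against them only involves its L^1 norm. *)
Lemma SE_bound : exists2 cS, 0 <= cS & forall (r : R -> 'M[C]_K) phi, mcbm r -> bmU phi ->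
  (forall y, 0 <= y <= 1 -> mxle (r y) (phi y)) -> 0 <= E01 phi ->
  (forall x, 0 <= x <= 1 -> mxle (SE r x) (cS * E01 phi)) /\
  (forall l x x', I l x -> I l x' -> mxle (SE r x - SE r x') (cS * E01 phi * Num.sqrt `|x - x'|)).
Proof.
have hj j : exists M, 0 <= M /\ mxle (cc j) M /\ mxle ((cc j)^t*) M.
  have [M M0 hM] := mxle_exists (cc j); have [N N0 hN] := mxle_exists ((cc j)^t*).
  exists (M + N); split; first by rewrite addr_ge0 ?ltW.
  split=> a b; first by rewrite (le_trans (hM a b)) // lerDl ltW.
  by rewrite (le_trans (hN a b)) // lerDr ltW.
have /choice[f hf] := hj.
have f0 j : 0 <= f j by case: (hf j).
have H0 : J -> 0 <= H by move=> j; case: (kH j).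
exists (\sum_j K%:R * (K%:R * (f j * (2 * H)) * f j)).
  by apply: sumr_ge0 => j _; rewrite !mulr_ge0 // (H0 j).
have sand j (A : 'M[C]_K) t : 0 <= t -> mxle A (2 * H * t) ->
    mxle (cc j *m A *m (cc j)^t*) (K%:R * (K%:R * (f j * (2 * H)) * f j) * t).
  move=> t0 At; have [_ [h1 h2]] := hf j.
  have -> : K%:R * (K%:R * (f j * (2 * H)) * f j) * t =
     K%:R * (K%:R * (f j * (2 * H * t)) * f j) by ring.
  apply: mxle_mul => //; first by rewrite !mulr_ge0 // (H0 j).
  exact: mxle_mul.
move=> r phi br bp rp p0; split=> [x x01|l x x' lx lx'].
  rewrite mulr_suml; apply: mxle_sum => j; apply: sand => // a b.
  by rewrite mxE -mulrA; apply: (kop_boundE HI (kH j)) => // y y01; exact: rp.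
rewrite -sumrB -mulrA mulr_suml; apply: mxle_sum => j; rewrite -mulmxBl -mulmxBr.
apply: sand => [|a b]; first by rewrite mulr_ge0 ?sqrtr_ge0.
rewrite !mxE mulrA -[2 * H * _]mulrA.
by apply: (kop_holderE HI (kH j) _ _ _ lx lx') => // y y01; exact: rp.
Qed.

Lemma mkopM m n p k (A : 'M[C]_(m, n)) (r : R -> 'M[C]_(n, n)) (B : 'M[C]_(n, p)) x :
  kern I k H -> mcbm r -> 0 <= x <= 1 ->
  mkop k (fun y => A *m r y *m B) x = A *m mkop k r x *m B.
Proof.
move=> kh br x01; apply/matrixP => a b; rewrite !mxE /kop.
have bk c e : cbm (fun y => (k x y)%:C * r y c e) by exact: (kern_cbm HI kh).
rewrite (cI_eq (g := fun y => \sum_e \sum_c (A a c * B e b) * ((k x y)%:C * r y c e))).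
  rewrite cI_sum => [|e]; last by apply: cbm_sum => c; exact: cbmZ.
  apply: eq_bigr => e _; rewrite cI_sum => [|c]; last exact: cbmZ.
  rewrite mxE mulr_suml; apply: eq_bigr => c _.
  by rewrite cIZ // mxE mulrAC.
move=> y _; rewrite mxE mulr_sumr; apply: eq_bigr => e _.
rewrite mxE mulr_suml mulr_sumr; apply: eq_bigr => c _; ring.
Qed.

Lemma tr_sum2 m n (A : 'M[C]_(m, n)) (B : 'M[C]_(n, m)) :
  \tr (A *m B) = \sum_b \sum_a A a b * B b a.
Proof.
rewrite /mxtrace exchange_big /=; apply: eq_bigr => a _; by rewrite mxE.
Qed.

(** Transposing the kernel in one summand and cycling the trace produces the summand of the
paired index. *)
Lemma SE_sym (r s : R -> 'M[C]_K) : mpwh r -> mpwh s ->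
  cI (fun x => \tr (r x *m SE s x)) = cI (fun x => \tr (s x *m SE r x)).
Proof.
move=> pr ps.
have br := mpwh_mcbm pr; have bs := mpwh_mcbm ps.
have E (p q : R -> 'M[C]_K) : mpwh p -> mpwh q -> cI (fun x => \tr (p x *m SE q x)) =
    \sum_j cI (fun x => \tr (((cc j)^t* *m p x *m cc j) *m mkop (kk j) q x)).
  move=> pp pq; rewrite -cI_sum => [|j].
    apply: cI_eq => x _; rewrite /SE mulmx_sumr raddf_sum /=; apply: eq_bigr => j _.
    by rewrite mulmxA mxtrace_mulC !mulmxA.
  apply: (pwh_cbm HI); apply: mpwh_tr; apply: mpwhM.
    by apply: mpwhM; [apply: mpwhM => //; exact: mpwh_cst|exact: mpwh_cst].
  by apply: (mpwh_mkop (kH j)); exact: mpwh_mcbm.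
rewrite [LHS](E r s pr ps).
rewrite [RHS](E s r ps pr).
rewrite [LHS](reindex_inj (inv_inj sgK)).
apply: eq_bigr => j _.
have kh := kern_swap (kH j).
pose p x := (cc j) *m r x *m (cc j)^t*.
have pp : mpwh p by apply: mpwhM; [apply: mpwhM => //; exact: mpwh_cst|exact: mpwh_cst].
transitivity (\sum_b \sum_a cI (fun x => p x a b * kop (fun x y => kk j y x) (fun y => s y b a) x)).
  rewrite (cI_eq (g := fun x => \sum_b \sum_a p x a b * kop (fun x y => kk j y x) (fun y => s y b a) x)).
    have bb b a : cbm (fun x => p x a b * kop (fun x y => kk j y x) (fun y => s y b a) x).
      apply: cbmM; first exact: (mpwh_mcbm pp).
      by apply: (pwh_cbm HI); apply: (pwh_kop HI kh); exact: bs.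
    rewrite cI_sum => [|b]; last by apply: cbm_sum => a.
    by apply: eq_bigr => b _; rewrite cI_sum.
  move=> x x01; rewrite tr_sum2; apply: eq_bigr => b _; apply: eq_bigr => a _.
  rewrite cc_sg adjmxK [mkop _ _ _ _ _]mxE -/(p x) /kop; congr (_ * _); apply: cI_eq => y y01.
  by rewrite kk_sg.
transitivity (\sum_b \sum_a cI (fun x => s x b a * kop (kk j) (fun y => p y a b) x)).
  apply: eq_bigr => b _; apply: eq_bigr => a _.
  by rewrite (kop_sym HI kh (pp a b) (ps b a)).
rewrite (cI_eq (f := fun x => \tr _) (g := fun x => \sum_b \sum_a s x b a * kop (kk j) (fun y => p y a b) x)).
  have bb b a : cbm (fun x => s x b a * kop (kk j) (fun y => p y a b) x).
    apply: cbmM; first exact: bs.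
    by apply: (pwh_cbm HI); apply: (pwh_kop HI (kH j)); exact: (mpwh_mcbm pp).
  rewrite cI_sum => [|b]; last by apply: cbm_sum => a.
  by apply: eq_bigr => b _; rewrite cI_sum.
move=> x x01.
transitivity (\tr ((cc j *m mkop (kk j) r x *m (cc j)^t*) *m s x)).
  by rewrite -!mulmxA mxtrace_mulC -!mulmxA mxtrace_mulC !mulmxA.
rewrite -(mkopM _ _ (kH j)) // tr_sum2; apply: eq_bigr => b _; apply: eq_bigr => a _.
by rewrite mulrC; congr (_ * _); rewrite mxE.
Qed.

(** For a solution this is - M^-1. *)
Definition Gf (z : C) (M : R -> 'M[C]_K) x : 'M[C]_K := z%:M - a x + SE M x.

(** A solution of the Dyson equation at every point of [0,1] rather than almost everywhere. *)
Definition sol (z : C) (M : R -> 'M[C]_K) := [/\ mpwh M,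
  forall x, 0 <= x <= 1 -> imge (complex.Im z) (Gf z M x) &
  forall x, 0 <= x <= 1 -> M x *m Gf z M x = - 1%:M].

Lemma mpwh_Gf z M : mpwh M -> mpwh (Gf z M).
Proof.
move=> pM; apply: mpwhD; last by apply: mpwh_SE; exact: mpwh_mcbm.
by apply: mpwhD; [exact: mpwh_cst|apply: mpwhN; exact: pa].
Qed.

Lemma im_a x u : 0 <= x <= 1 -> complex.Im (dot u (a x *m u)) = 0.
Proof.
move=> x01; have : Num.conj (dot u (a x *m u)) = dot u (a x *m u).
  by rewrite dot_conj dot_adj ha.
by case: (dot _ _) => p q /= [] /eqP; rewrite eq_sym -subr_eq0 opprK -mulr2n mulrn_eq0 /= => /eqP.
Qed.

Lemma Im_Gf z M x u : 0 <= x <= 1 -> complex.Im (dot u (Gf z M x *m u)) =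
  complex.Im z * nsq u + complex.Im (dot u (SE M x *m u)).
Proof.
move=> x01; rewrite /Gf mulmxDl mulmxBl !dotDr dotNr !ImD ImN im_a // oppr0 addr0.
by rewrite mul_scalar_mx dotZr dot_self mulrC ImMc mulrC.
Qed.

Section TwoSol.
Variables (z1 z2 : C) (M1 M2 : R -> 'M[C]_K) (eta : R).
Hypotheses (eta0 : 0 < eta) (s1 : sol z1 M1) (s2 : sol z2 M2)
  (e1 : eta <= complex.Im z1) (e2 : eta <= complex.Im z2).
Let D x := M1 x - M2 x.
Let w := cabs (z1 - z2).

(** The polarized form of the statement that D is controlled by the geometric mean of the
imaginary parts of M1 and M2, with constant lam. *)
Definition dominated (lam : R) := forall x, 0 <= x <= 1 -> forall u v,
  2 * complex.Re (dot u (D x *m v)) <=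
  lam * (complex.Im (dot u (M1 x *m u)) + complex.Im (dot v (M2 x *m v))).

Lemma sol_diff x : 0 <= x <= 1 -> D x = M1 x *m ((z1 - z2)%:M + SE D x) *m M2 x.
Proof.
move=> x01; have [p1 i1 d1] := s1; have [p2 i2 d2] := s2.
have -> : (z1 - z2)%:M + SE D x = Gf z1 M1 x - Gf z2 M2 x.
  rewrite /D SEB //; [|exact: mpwh_mcbm|exact: mpwh_mcbm].
  by rewrite /Gf; apply/matrixP => i j; rewrite !mxE mulrnBl; ring.
rewrite mulmxBr mulmxBl d1 // mulNmx mul1mx.
rewrite -mulmxA (ninv_comm (lt_le_trans eta0 e2) (i2 x x01) (d2 x x01)) mulmxN mulmx1.
by rewrite opprK addrC.
Qed.

Lemma im_sol_ge0 z M x u : sol z M -> 0 < complex.Im z -> 0 <= x <= 1 ->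
  0 <= complex.Im (dot u (M x *m u)).
Proof.
move=> [p i d] z0 x01; rewrite (le_trans _ (im_ninv_ge z0 (i x x01) (d x x01) u)) //.
by rewrite mulr_ge0 ?nsq_ge0 // ltW.
Qed.

(** Put p = M1^* u and r = M2 v. By [sol_diff], <u, D v> = (z1 - z2) <p, r> + <p, S[D] r>, and
[SE_mono] bounds the last term by lam times the imaginary parts of S[M1] and S[M2]; these
are smaller than those of G1 and G2 by at least eta. One round therefore replaces lam by a
convex combination of lam and w / eta, with a weight that stays bounded away from 0. *)
Lemma dominated_step (b lam : R) : 0 < b ->
  (forall x, 0 <= x <= 1 -> forall u, complex.Im (dot u (Gf z1 M1 x *m u)) <= b * nsq u) ->
  (forall x, 0 <= x <= 1 -> forall u, complex.Im (dot u (Gf z2 M2 x *m u)) <= b * nsq u) ->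
  w / eta <= lam -> dominated lam ->
  dominated (w / eta + (1 - eta / b) * (lam - w / eta)).
Proof.
move=> b0 b1 b2 wl dl x x01 u v; have [p1 i1 d1] := s1; have [p2 i2 d2] := s2.
have z10 := lt_le_trans eta0 e1; have z20 := lt_le_trans eta0 e2.
set p := (M1 x)^t* *m u; set r := M2 x *m v.
set A1 := complex.Im (dot u _); set A2 := complex.Im (dot v _).
have A1E : A1 = complex.Im (dot p (Gf z1 M1 x *m p)) by rewrite /A1 (im_ninv_adj (d1 x x01)).
have A2E : A2 = complex.Im (dot r (Gf z2 M2 x *m r)) by rewrite /A2 (im_ninv z20 (i2 x x01) (d2 x x01)).
have B1 : A1 <= b * nsq p by rewrite A1E b1.
have B2 : A2 <= b * nsq r by rewrite A2E b2.
rewrite Im_Gf // in A1E; rewrite Im_Gf // in A2E.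
have -> : dot u (D x *m v) = (z1 - z2) * dot p r + dot p (SE D x *m r).
  rewrite (sol_diff x01) -!mulmxA dot_adj -/p -/r mulmxDl dotDr mul_scalar_mx dotZr.
  by [].
have bD : mcbm D by apply: mcbmB; exact: mpwh_mcbm.
have S := SE_mono bD (mpwh_mcbm p1) (mpwh_mcbm p2) dl x01 p r.
have T : 2 * complex.Re ((z1 - z2) * dot p r) <= w * (nsq p + nsq r).
  have h := dot_le p r ltr01; rewrite invr1 !mul1r in h.
  rewrite (le_trans _ (ler_wpM2l (cabs_ge0 (z1 - z2)) h)) // mulrCA ler_pM2l //.
  by rewrite -cabsM (le_trans (ler_norm _)) // le_Re_cabs.
have l0 : 0 <= lam by rewrite (le_trans _ wl) // divr_ge0 ?cabs_ge0 // ltW.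
have N0 := nsq_ge0 p; have N1 := nsq_ge0 r.
rewrite ReD mulrDr; apply: (le_trans (lerD T S)).
set S1 := complex.Im (dot p (SE M1 x *m p)) in A1E *.
set S2 := complex.Im (dot r (SE M2 x *m r)) in A2E *.
have h1 : S1 <= A1 - eta * nsq p.
  by rewrite A1E lerBrDr addrC lerD2r ler_wpM2r.
have h2 : S2 <= A2 - eta * nsq r.
  by rewrite A2E lerBrDr addrC lerD2r ler_wpM2r.
clearbody S1 S2 A1 A2; set nn := nsq p + nsq r.
have h3 : (A1 + A2) / b <= nn.
  by rewrite ler_pdivrMr // /nn mulrDl mulrC [X in _ <= _ + X]mulrC lerD // mulrC.
have h4 : lam * (S1 + S2) <= lam * ((A1 + A2) - eta * nn).
  apply: ler_wpM2l => //; apply: (le_trans (lerD h1 h2)).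
  by rewrite /nn mulrDr opprD addrACA.
apply: (le_trans (lerD (lexx _) h4)).
have g0 : 0 <= lam * eta - w by rewrite subr_ge0 -ler_pdivrMr.
have -> : w * nn + lam * (A1 + A2 - eta * nn) = lam * (A1 + A2) - (lam * eta - w) * nn by ring.
have -> : (w / eta + (1 - eta / b) * (lam - w / eta)) * (A1 + A2) =
   lam * (A1 + A2) - (lam * eta - w) * ((A1 + A2) / b).
  by field; rewrite !gt_eqF.
by rewrite lerD2l lerN2 ler_wpM2l.
Qed.

Lemma form_bound z M : mpwh M -> exists2 b, eta < b & forall x, 0 <= x <= 1 ->
  [/\ (forall u, complex.Im (dot u (Gf z M x *m u)) <= b * nsq u) &
      (forall u, nsq (Gf z M x *m u) <= b ^+ 2 * nsq u)].
Proof.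
move=> pM; have [N N0 hN] := mxle_bound (mpwh_Gf z pM).
exists (eta + 1 + K%:R * N).
  by rewrite -addrA ltrDl ltr_wpDr // mulr_ge0 // ltW.
move=> x x01; split=> u.
  have h := form_le u u (ltW N0) ltr01 (hN x x01); rewrite invr1 !mul1r in h.
  rewrite (le_trans (ler_norm _)) // (le_trans (le_Im_cabs _)) //.
  have n0 := nsq_ge0 u; have := mulr_ge0 (ltW eta0) n0.
  by move: h; rewrite -mulr2n -mulr_natl; lra.
rewrite (le_trans (nsq_mul_le u N0 (hN x x01))) // ler_wpM2r ?nsq_ge0 //.
rewrite ler_sqr ?nnegrE ?mulr_ge0 ?addr_ge0 ?(ltW eta0) ?(ltW N0) //; last first.
  by rewrite mulr_ge0 // ltW.
by rewrite lerDr addr_ge0 // ltW.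
Qed.

(** Bernoulli's inequality, in the form that feeds [le_inv_nat0]. *)
Lemma expr_small (q : R) n : 0 < q -> q <= 1 -> (1 - q) ^+ n <= q^-1 / n.+1%:R.
Proof.
move=> q0 q1; have h : (1 + n%:R * q) * (1 - q) ^+ n <= 1.
  elim: n => [|n IH]; first by rewrite mul0r addr0 expr0 mulr1.
  apply: le_trans IH; rewrite exprS mulrA ler_wpM2r ?exprn_ge0 ?subr_ge0 //.
  rewrite -natr1; have n0 : 0 <= n%:R :> R by [].
  by have := mulr_ge0 n0 (sqr_ge0 q); have := sqr_ge0 q; nra.
have p0 : 0 <= (1 - q) ^+ n by rewrite exprn_ge0 // subr_ge0.
rewrite -invfM -[leRHS]mul1r ler_pdivlMr ?mulr_gt0 ?ltr0Sn //.
apply: le_trans h; rewrite mulrC ler_wpM2r // -natr1; nra.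
Qed.

(** The matrices G are bounded, so the imaginary parts of M1 and M2 are bounded below, and every
bounded form is dominated with some constant. *)
Lemma dominated_init : exists2 lam, w / eta <= lam & dominated lam.
Proof.
have [p1 i1 d1] := s1; have [p2 i2 d2] := s2.
have z10 := lt_le_trans eta0 e1; have z20 := lt_le_trans eta0 e2.
have [b1 eb1 h1] := form_bound z1 p1; have [b2 eb2 h2] := form_bound z2 p2.
have b10 := lt_trans eta0 eb1; have b20 := lt_trans eta0 eb2.
have [N N0 hN] := mxle_bound (mpwhD p1 (mpwhN p2)).
have lower z M b x : sol z M -> eta <= complex.Im z -> 0 < b -> 0 <= x <= 1 ->
    (forall u, nsq (Gf z M x *m u) <= b ^+ 2 * nsq u) ->
    forall u, nsq u <= b ^+ 2 / eta * complex.Im (dot u (M x *m u)).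
  move=> [p i d] ez b0 x01 h u; have z0 := lt_le_trans eta0 ez.
  have -> : nsq u = nsq (Gf z M x *m (M x *m u)).
    by rewrite mulmxA (ninv_comm z0 (i x x01) (d x x01)) mulNmx mul1mx nsqN.
  apply: (le_trans (h _)); rewrite -mulrA ler_pM2l ?exprn_gt0 //.
  rewrite mulrC ler_pdivlMr // mulrC.
  apply: le_trans (im_ninv_ge z0 (i x x01) (d x x01) u).
  by rewrite ler_wpM2r ?nsq_ge0.
pose c := b1 ^+ 2 / eta + b2 ^+ 2 / eta.
exists (w / eta + K%:R * N * c).
  rewrite lerDl mulr_ge0 //; first by rewrite mulr_ge0 // ltW.
  by rewrite addr_ge0 // divr_ge0 ?sqr_ge0 // ltW.
move=> x x01 u v.
have L1 := lower z1 M1 b1 x s1 e1 b10 x01 (proj2 (h1 x x01)) u.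
have L2 := lower z2 M2 b2 x s2 e2 b20 x01 (proj2 (h2 x x01)) v.
have P1 := im_sol_ge0 u s1 z10 x01; have P2 := im_sol_ge0 v s2 z20 x01.
set A1 := complex.Im (dot u _) in L1 P1 *; set A2 := complex.Im (dot v _) in L2 P2 *.
have F := form_le u v (ltW N0) ltr01 (hN x x01); rewrite invr1 !mul1r in F.
have -> : D x = M1 x + - M2 x by [].
apply: (@le_trans _ _ (K%:R * N * (nsq u + nsq v))).
  apply: le_trans F; rewrite ler_pM2l //.
  by rewrite (le_trans (ler_norm _)) // le_Re_cabs.
have w0 : 0 <= w / eta by rewrite divr_ge0 ?cabs_ge0 // ltW.
have c1 : 0 <= b1 ^+ 2 / eta by rewrite divr_ge0 ?sqr_ge0 // ltW.
have c2 : 0 <= b2 ^+ 2 / eta by rewrite divr_ge0 ?sqr_ge0 // ltW.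
have S0 : nsq u + nsq v <= c * (A1 + A2).
  apply: (le_trans (lerD L1 L2)); rewrite /c [leRHS]mulrDl lerD // ler_wpM2l //.
    by rewrite lerDl.
  by rewrite lerDr.
have KN0 : 0 <= K%:R * N by rewrite mulr_ge0 // ltW.
by rewrite mulrDl (le_trans (ler_wpM2l KN0 S0)) // mulrA lerDr mulr_ge0 ?addr_ge0.
Qed.

(** Iterating [dominated_step] drives the constant to its fixed point w / eta. *)
Lemma sol_dominated : dominated (w / eta).
Proof.
have [p1 _ _] := s1; have [p2 _ _] := s2.
have [b1 eb1 h1] := form_bound z1 p1; have [b2 eb2 h2] := form_bound z2 p2.
pose b := b1 + b2.
have b10 := lt_trans eta0 eb1; have b20 := lt_trans eta0 eb2.
have b0 : 0 < b by rewrite addr_gt0.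
have hb1 x : 0 <= x <= 1 -> forall u, complex.Im (dot u (Gf z1 M1 x *m u)) <= b * nsq u.
  by move=> /h1[h _] u; rewrite (le_trans (h u)) // ler_wpM2r ?nsq_ge0 // lerDl ltW.
have hb2 x : 0 <= x <= 1 -> forall u, complex.Im (dot u (Gf z2 M2 x *m u)) <= b * nsq u.
  by move=> /h2[h _] u; rewrite (le_trans (h u)) // ler_wpM2r ?nsq_ge0 // lerDr ltW.
have [lam0 wl0 dl0] := dominated_init.
pose q := eta / b.
have q0 : 0 < q by rewrite divr_gt0.
have q1 : q <= 1 by rewrite ler_pdivrMr // mul1r (le_trans (ltW eb1)) // lerDl ltW.
have dn n : dominated (w / eta + (1 - q) ^+ n * (lam0 - w / eta)).
  elim: n => [|n IH]; first by rewrite expr0 mul1r addrC subrK.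
  have -> : w / eta + (1 - q) ^+ n.+1 * (lam0 - w / eta) = w / eta + (1 - q) *
     (w / eta + (1 - q) ^+ n * (lam0 - w / eta) - w / eta) by rewrite exprS; ring.
  apply: dominated_step => //.
  by rewrite lerDl mulr_ge0 ?exprn_ge0 ?subr_ge0.
move=> x x01 u v; set A := _ + _.
have A0 : 0 <= A.
  by rewrite addr_ge0 ?(im_sol_ge0 _ s1 (lt_le_trans eta0 e1)) ?(im_sol_ge0 _ s2 (lt_le_trans eta0 e2)).
pose Y := (lam0 - w / eta) * A.
have Y0 : 0 <= Y by rewrite mulr_ge0 // subr_ge0.
rewrite -subr_le0; apply: (@le_inv_nat0 _ _ (q^-1 * Y)) => n.
rewrite (mulrAC q^-1 Y) lerBlDr; apply: (le_trans (dn n x x01 u v)).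
have -> : (w / eta + (1 - q) ^+ n * (lam0 - w / eta)) * A = (1 - q) ^+ n * Y + w / eta * A.
  by rewrite /Y mulrDl mulrA addrC.
by rewrite lerD2r; apply: ler_wpM2r Y0 _ _ _; exact: expr_small.
Qed.

(** Schwarz-Pick: test [sol_dominated] on basis vectors, the phase of u being chosen so that the
entry becomes its modulus, and use |M| <= 1 / eta. *)
Lemma sol_lip x : 0 <= x <= 1 -> mxle (M1 x - M2 x) (eta^-1 ^+ 2 * cabs (z1 - z2)).
Proof.
move=> x01 i j.
have [p1 i1 d1] := s1; have [p2 i2 d2] := s2.
have z10 := lt_le_trans eta0 e1; have z20 := lt_le_trans eta0 e2.
have [->|d0] := eqVneq ((M1 x - M2 x) i j) 0.
  by rewrite cabs0 mulr_ge0 ?cabs_ge0 // exprn_ge0 // invr_ge0 ltW.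
set d := (M1 x - M2 x) i j in d0 *.
have cd := cabs_gt0 d0.
pose om : C := d * (cabs d)^-1%:C.
have om1 : cabs om = 1 by rewrite cabsM cabs_real ger0_norm ?invr_ge0 ?cabs_ge0 // divff // gt_eqF.
have := sol_dominated x01 (om *: delta_mx i 0) (delta_mx j 0).
rewrite -scalemxAr !dotZl dotZr !dot_delta -/d.
have -> : Num.conj om * d = (cabs d)%:C.
  rewrite /om rmorphM /= mulrAC mulJ_cabs.
  have -> : Num.conj ((cabs d)^-1%:C : C) = (cabs d)^-1%:C by rewrite [LHS]conjc_real.
  by rewrite -rmorphM expr2 mulfK // gt_eqF.
rewrite mulrA mulJ_cabs om1 expr1n /= mul1r => h.
have b1 := mxle_ninv z10 (i1 x x01) (d1 x x01) i i.
have b2 := mxle_ninv z20 (i2 x x01) (d2 x x01) j j.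
have le1 : complex.Im (M1 x i i) <= eta^-1.
  rewrite (le_trans (ler_norm _)) // (le_trans (le_Im_cabs _)) // (le_trans b1) //.
  by rewrite lef_pV2 ?posrE.
have le2 : complex.Im (M2 x j j) <= eta^-1.
  rewrite (le_trans (ler_norm _)) // (le_trans (le_Im_cabs _)) // (le_trans b2) //.
  by rewrite lef_pV2 ?posrE.
have w0 : 0 <= w / eta by rewrite divr_ge0 ?cabs_ge0 // ltW.
have h' : 2 * cabs d <= w / eta * (eta^-1 + eta^-1).
  by rewrite (le_trans h) // ler_wpM2l // lerD.
rewrite -(ler_pM2l (ltr0Sn R 1)); apply: (le_trans h').
by rewrite le_eqVlt; apply/orP; left; apply/eqP; rewrite -/w; ring.
Qed.
End TwoSol.

End Kraus.

(** * The potential of a solution *)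

Section Extra.
Context {R : realType}.
Notation C := R[i].

Lemma imge_le n (c c' : R) (A : 'M[C]_n) : c' <= c -> imge c A -> imge c' A.
Proof. by move=> cc' Ac u; rewrite (le_trans _ (Ac u)) // ler_wpM2r ?nsq_ge0. Qed.
Lemma mxle_le m n (c c' : R) (A : 'M[C]_(m, n)) : c <= c' -> mxle A c -> mxle A c'.
Proof. by move=> cc' Ac i j; rewrite (le_trans (Ac i j)). Qed.
Lemma mxleD m n (c c' : R) (A B : 'M[C]_(m, n)) : mxle A c -> mxle B c' -> mxle (A + B) (c + c').
Proof. by move=> Ac Bc i j; rewrite mxE (le_trans (le_cabsD _ _)) // lerD. Qed.
Lemma mxleN m n (c : R) (A : 'M[C]_(m, n)) : mxle A c -> mxle (- A) c.
Proof. by move=> Ac i j; rewrite mxE cabsN. Qed.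
Lemma mxle_scalar n (z : C) : mxle (z%:M : 'M[C]_n) (cabs z).
Proof. by move=> i j; rewrite mxE; case: (i == j); rewrite ?cabs0 ?cabs_ge0. Qed.
Lemma cabs_tr n (A : 'M[C]_n) c : mxle A c -> cabs (\tr A) <= n%:R * c.
Proof.
move=> Ac; rewrite (le_trans (cabs_le_sum _ _ _)) //.
by rewrite -[n in leRHS]card_ord -sum1_card natr_sum mulr_suml ler_sum // => i _; rewrite mul1r.
Qed.

(** Subdividing [a, b] into n steps bounds |f a - f b| by c (b - a)^2 / n. *)
Lemma sq_const (f : R -> R) a b c : 0 <= c -> a <= b ->
  (forall s t, a <= s <= b -> a <= t <= b -> `|f s - f t| <= c * (s - t) ^+ 2) -> f a = f b.
Proof.
move=> c0 ab h; apply/eqP; rewrite -subr_eq0 -normr_le0.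
apply: (@le_inv_nat0 _ _ (c * (b - a) ^+ 2)) => n.
pose d := (b - a) / n.+1%:R.
have d0 : 0 <= d by rewrite divr_ge0 // subr_ge0.
have nd : n.+1%:R * d = b - a by rewrite mulrC divfK.
have main k : (k <= n.+1)%N -> `|f a - f (a + k%:R * d)| <= k%:R * (c * d ^+ 2).
  elim: k => [|k IH] kn; first by rewrite !mul0r addr0 subrr normr0.
  have -> : f a - f (a + k.+1%:R * d) = (f a - f (a + k%:R * d)) +
      (f (a + k%:R * d) - f (a + k.+1%:R * d)) by rewrite addrA subrK.
  have -> : k.+1%:R * (c * d ^+ 2) = k%:R * (c * d ^+ 2) + c * d ^+ 2 by rewrite -natr1; ring.
  rewrite (le_trans (ler_normD _ _)) // lerD //; first exact: IH (ltnW kn).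
  have inab j : (j <= n.+1)%N -> a <= a + j%:R * d <= b.
    move=> jn; rewrite lerDl mulr_ge0 //= -lerBrDl -nd ler_wpM2r // ler_nat //.
  rewrite (le_trans (h _ _ (inab k (ltnW kn)) (inab k.+1 kn))) // ler_wpM2l //.
  by rewrite le_eqVlt; apply/orP; left; apply/eqP; rewrite -natr1; ring.
have := main _ (leqnn _); rewrite nd (addrC a) subrK => /le_trans; apply.
rewrite /d le_eqVlt; apply/orP; left; apply/eqP; field.
by rewrite (_ : 1 + n%:R = n.+1%:R) ?pnatr_eq0 // -natr1 addrC.
Qed.
End Extra.

Section Potential.
Context {R : realType} (L : nat) (I : 'I_L -> set R) (K : nat) (md : model I K).
Notation C := R[i].
Local Notation HI := (md_part md).

Lemma sol_invmx z M x : sol md z M -> 0 < complex.Im z -> 0 <= x <= 1 ->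
  invmx (Gf md z M x) = - M x.
Proof.
move=> [p i d] z0 x01; have u := imge_unit z0 (i x x01).
by rewrite -[M x](mulmxK u) d // mulNmx mul1mx opprK.
Qed.

(** [argdet_taylor] makes the argument of the determinant a Lipschitz function of the matrix. *)
Lemma pwr_argdet (r : R -> 'M[C]_K) c : 0 < c -> mpwh I r ->
  (forall x, 0 <= x <= 1 -> imge c (r x)) -> pwr I (fun x => argdet (r x)).
Proof.
move=> c0 pr ir; have [N N0 rN] := mxle_bound md pr.
have [k k0 hk] := argdet_taylor K c0 N0.
have [e e0 he] := mpwh_holder pr.
pose B := K%:R * (K%:R * (c^-1 * e)).
exists (B + k * e ^+ 2).
  by rewrite addr_ge0 ?mulr_ge0 ?sqr_ge0 ?invr_ge0 // ltW.
move=> l x y lx ly; have x01 := part_sub HI lx; have y01 := part_sub HI ly.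
set s := Num.sqrt _; have s0 : 0 <= s := sqrtr_ge0 _.
have s1 : s ^+ 2 <= s.
  rewrite -[leRHS]mulr1 expr2 ler_wpM2l // -[leRHS]sqrtr1 ler_wsqrtr //.
  by case/andP: x01 => ? ?; case/andP: y01 => ? ?; rewrite ler_norml; apply/andP; split; lra.
have := hk (r x) (r y) (e * s) (ir x x01) (ir y y01) (rN x x01) (rN y y01) (mulr_ge0 e0 s0)
  (he l x y lx ly).
set w := complex.Im _ => hh.
have hw : `|w| <= B * s.
  rewrite (le_trans (le_Im_cabs _)) //.
  have -> : B * s = K%:R * (K%:R * (c^-1 * (e * s))) by rewrite /B; ring.
  apply: cabs_tr; apply: mxle_mul; first by rewrite invr_ge0 ltW.
    exact: mxle_invmx (ir y y01).
  exact: he lx ly.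
rewrite -[argdet _ - _](subrK w) (le_trans (ler_normD _ _)) // mulrDl addrC lerD //.
apply: (le_trans hh); rewrite exprMn mulrA ler_wpM2l // mulr_ge0 ?sqr_ge0 //.
Qed.

Definition Theta z M : R := E01 (fun x => argdet (Gf md z M x)).

(** The correction which makes solutions critical points of the potential, so that only the
explicit dependence on z contributes to its first variation. *)
Definition Quad M : R := complex.Im (cI (fun x => \tr (M x *m SE md M x))) / 2.

Lemma mpwh_B (r s : R -> 'M[C]_K) : mpwh I r -> mpwh I s -> mpwh I (fun x => r x - s x).
Proof. by move=> pr ps; apply: mpwhD => //; exact: mpwhN. Qed.
Lemma mpwh_SE' r : mpwh I r -> mpwh I (SE md r).
Proof. by move=> pr; apply: mpwh_SE; apply: (mpwh_mcbm md). Qed.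

Lemma quad_alg (x11 x12 x21 x22 y1 y2 y : C) : y1 = x11 - x12 -> y2 = x21 - x22 ->
  y = y1 - y2 -> x12 = x21 ->
  complex.Im x11 / 2 - complex.Im x22 / 2 = complex.Im y2 + complex.Im y / 2.
Proof. by move=> -> -> -> ->; rewrite !ImB; field. Qed.

Lemma potential_alg (t1 t2 q1 q2 w X Y A B : R) : q1 - q2 = X + Y ->
  `|t1 - t2 + (w + X)| <= A -> `|Y| <= B -> `|t1 + q1 - (t2 + q2) + w| <= A + B.
Proof.
move=> qd hA hB.
have -> : t1 + q1 - (t2 + q2) + w = (t1 - t2 + (w + X)) + (q1 - q2 - X) by ring.
by rewrite qd [X + Y]addrC addrK (le_trans (ler_normD _ _)) // lerD.
Qed.

(** Expansion of a quadratic form; the two mixed terms agree by [SE_sym]. *)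
Lemma Quad_diff M1 M2 : mpwh I M1 -> mpwh I M2 ->
  Quad M1 - Quad M2 =
  complex.Im (cI (fun x => \tr (M2 x *m SE md (fun y => M1 y - M2 y) x))) +
  complex.Im (cI (fun x => \tr ((M1 x - M2 x) *m SE md (fun y => M1 y - M2 y) x))) / 2.
Proof.
move=> p1 p2; rewrite /Quad.
have tc (r s : R -> 'M[C]_K) : mpwh I r -> mpwh I s -> cbm (fun x => \tr (r x *m SE md s x)).
  move=> pr ps; apply: (pwh_cbm HI); apply: mpwh_tr; apply: (mpwhM md) => //.
  exact: mpwh_SE'.
pose D y := M1 y - M2 y.
have pD : mpwh I D by exact: mpwh_B.
have e (r : R -> 'M[C]_K) : mpwh I r -> cI (fun x => \tr (r x *m SE md D x)) =
    cI (fun x => \tr (r x *m SE md M1 x)) - cI (fun x => \tr (r x *m SE md M2 x)).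
  move=> pr; rewrite -cIB; [|exact: tc|exact: tc].
  apply: cI_eq => x x01; rewrite SEB //; [|exact: (mpwh_mcbm md)|exact: (mpwh_mcbm md)].
  by rewrite mulmxBr raddfB.
have e2 : cI (fun x => \tr (D x *m SE md D x)) =
    cI (fun x => \tr (M1 x *m SE md D x)) - cI (fun x => \tr (M2 x *m SE md D x)).
  rewrite -cIB; [|exact: tc|exact: tc].
  by apply: cI_eq => x _; rewrite /D mulmxBl raddfB.
exact: (quad_alg (e _ p1) (e _ p2) e2 (SE_sym md p1 p2)).
Qed.

(** The first order terms in the variation of M are Im E tr (M2 S[M1 - M2]) with opposite signs
in [Theta] and [Quad]. What is left is - (s - t) Re E tr M2, and [sol_lip] bounds the
quadratic remainders. *)
Lemma potential_step tau e0 N : 0 < e0 -> exists2 c, 0 <= c & forall s t M1 M2,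
  e0 <= s <= N -> e0 <= t <= N -> sol md (tau +i* s) M1 -> sol md (tau +i* t) M2 ->
  `|(Theta (tau +i* s) M1 + Quad M1) - (Theta (tau +i* t) M2 + Quad M2) +
     (s - t) * complex.Re (cI (fun x => \tr (M2 x)))| <= c * (s - t) ^+ 2.
Proof.
move=> e00.
have [cS cS0 hS] := SE_bound md.
have [A A0 hA] := mxle_bound md (md_pwh md).
pose N' := `|N|.
pose B := `|tau| + N' + A + cS * e0^-1.
have N'0 : 0 <= N' := normr_ge0 N.
have B0 : 0 < B.
  apply: ltr_wpDr; first by rewrite mulr_ge0 // invr_ge0 ltW.
  by apply: (lt_le_trans A0); rewrite lerDr addr_ge0.
have [k k0 hk] := argdet_taylor K e00 B0.
pose l := e0^-1 ^+ 2.
have l0 : 0 <= l by rewrite sqr_ge0.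
pose h1 := 1 + cS * l.
pose q := K%:R * (K%:R * (l * (cS * l))).
have q0 : 0 <= q by do 3 (apply: mulr_ge0 => //); exact: mulr_ge0.
exists (k * h1 ^+ 2 + q).
  by rewrite addr_ge0 // mulr_ge0 // sqr_ge0.
move=> s t M1 M2 /andP[s0 sN] /andP[t0 tN] S1 S2.
have [p1 i1 d1] := S1; have [p2 i2 d2] := S2.
have s00 := lt_le_trans e00 s0; have t00 := lt_le_trans e00 t0.
set z1 := tau +i* s in S1 i1 d1 *; set z2 := tau +i* t in S2 i2 d2 *.
have z12 : z1 - z2 = 0 +i* (s - t) by apply/eqP; rewrite eq_complex /= subrr !eqxx.
have cz : cabs (z1 - z2) = `|s - t|.
  by rewrite z12 /cabs /= expr0n add0r sqrtr_sqr.
pose D y := M1 y - M2 y.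
have pD : mpwh I D by exact: mpwh_B.
have DL x : 0 <= x <= 1 -> mxle (D x) (l * `|s - t|).
  by move=> x01; rewrite -cz; exact: (sol_lip e00 S1 S2 s0 t0 x01).
have SD x : 0 <= x <= 1 -> mxle (SE md D x) (cS * (l * `|s - t|)).
  move=> x01; have [h _] := hS D (fun=> l * `|s - t|) (mpwh_mcbm md pD) (bmf_cst _ _) DL
    (E01_ge0 (fun _ _ => mulr_ge0 l0 (normr_ge0 _))).
  by have := h x x01; rewrite E01_cst.
have dG x : 0 <= x <= 1 -> Gf md z1 M1 x - Gf md z2 M2 x = (z1 - z2)%:M + SE md D x.
  move=> x01; rewrite /D SEB //; [|exact: (mpwh_mcbm md)|exact: (mpwh_mcbm md)].
  by rewrite /Gf; apply/matrixP => i j; rewrite !mxE mulrnBl; ring.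
have dGh x : 0 <= x <= 1 -> mxle (Gf md z1 M1 x - Gf md z2 M2 x) (h1 * `|s - t|).
  move=> x01; rewrite dG // /h1 mulrDl mul1r -{1}cz -mulrA.
  by apply: mxleD; [exact: mxle_scalar|exact: SD].
have GB y M : e0 <= y <= N -> sol md (tau +i* y) M -> forall x, 0 <= x <= 1 ->
    mxle (Gf md (tau +i* y) M x) B.
  move=> /andP[y0 yN] [p i d] x x01; have y00 := lt_le_trans e00 y0.
  have Me u : 0 <= u <= 1 -> mxle (M u) e0^-1.
    move=> u01; apply: mxle_le (mxle_ninv (y00 : 0 < complex.Im (tau +i* y)) (i u u01) (d u u01)).
    by rewrite lef_pV2 ?posrE.
  apply: mxleD; last first.
    have e1 : 0 <= E01 (fun=> e0^-1) by rewrite E01_cst invr_ge0 ltW.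
    have [h _] := hS M (fun=> e0^-1) (mpwh_mcbm md p) (bmf_cst _ _) Me e1.
    by have := h x x01; rewrite E01_cst.
  apply: mxleD; last exact/mxleN/hA.
  apply: mxle_le (mxle_scalar _); rewrite (le_trans (cabs_le_ReIm _)) //= lerD //.
  by rewrite (ger0_norm (ltW y00)) (le_trans yN) // ler_norm.
have sh : e0 <= s <= N by rewrite s0.
have th : e0 <= t <= N by rewrite t0.
have hdet x : 0 <= x <= 1 -> `|argdet (Gf md z1 M1 x) - argdet (Gf md z2 M2 x) +
    complex.Im (\tr (M2 x *m (Gf md z1 M1 x - Gf md z2 M2 x)))| <= k * h1 ^+ 2 * (s - t) ^+ 2.
  move=> x01; have := hk _ _ (h1 * `|s - t|) (imge_le s0 (i1 x x01)) (imge_le t0 (i2 x x01))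
    (GB s M1 sh S1 x x01) (GB t M2 th S2 x x01) _ (dGh x x01).
  rewrite (sol_invmx S2 t00 x01) mulNmx raddfN /= ImN opprK exprMn real_normK ?num_real //.
  rewrite mulrA; apply.
  by rewrite mulr_ge0 // addr_ge0 // mulr_ge0.
have a1 := pwr_bmf HI (pwr_argdet s00 (mpwh_Gf md z1 p1) i1).
have a2 := pwr_bmf HI (pwr_argdet t00 (mpwh_Gf md z2 p2) i2).
have pt : pwh I (fun x => \tr (M2 x *m (Gf md z1 M1 x - Gf md z2 M2 x))).
  apply: mpwh_tr; apply: (mpwhM md) => //; apply: mpwh_B; exact: mpwh_Gf.
have [_ a3] := pwh_cbm HI pt.
have HT : `|Theta z1 M1 - Theta z2 M2 +
     complex.Im (cI (fun x => \tr (M2 x *m (Gf md z1 M1 x - Gf md z2 M2 x))))| <=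
     k * h1 ^+ 2 * (s - t) ^+ 2.
  rewrite /Theta -(E01B a1 a2) Im_cI -(E01D (bmfB a1 a2) a3).
  exact: (E01_norm (bmfD (bmfB a1 a2) a3) hdet).
have cT : cI (fun x => \tr (M2 x *m (Gf md z1 M1 x - Gf md z2 M2 x))) =
    (z1 - z2) * cI (fun x => \tr (M2 x)) + cI (fun x => \tr (M2 x *m SE md D x)).
  have c1 : cbm (fun x => \tr (M2 x)) by apply: (pwh_cbm HI); exact: mpwh_tr.
  have c2 : cbm (fun x => \tr (M2 x *m SE md D x)).
    by apply: (pwh_cbm HI); apply: mpwh_tr; apply: (mpwhM md) => //; exact: mpwh_SE'.
  rewrite -(cIZ _ c1) -(cID (cbmZ _ c1) c2); apply: cI_eq => x x01.
  by rewrite dG // mulmxDr mxtraceD mul_mx_scalar mxtraceZ.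
have HQ : `|complex.Im (cI (fun x => \tr (D x *m SE md D x))) / 2| <= q * (s - t) ^+ 2.
  rewrite normrM [X in _ * X]ger0_norm ?invr_ge0 // ler_pdivrMr //.
  rewrite (le_trans (le_Im_cabs _)) // mulrC; apply: cabs_cI => [|x x01].
    by apply: (pwh_cbm HI); apply: mpwh_tr; apply: (mpwhM md) => //; exact: mpwh_SE'.
  have -> : q * (s - t) ^+ 2 = K%:R * (K%:R * ((l * `|s - t|) * (cS * (l * `|s - t|)))).
    by rewrite /q -(real_normK (num_real (s - t))); ring.
  apply: cabs_tr; apply: mxle_mul; [by rewrite mulr_ge0|exact: DL|exact: SD].
have QD := Quad_diff p1 p2; rewrite -/D in QD.
rewrite cT ImD z12 ImM /= mul0r add0r in HT.
rewrite [leRHS]mulrDl; exact: (potential_alg QD HT HQ).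
Qed.

(** For large eta, G = i eta + O(1) and M = O(1/eta). *)
Lemma potential_large tau : exists2 c, 0 <= c & forall s M, 1 <= s -> c <= s ->
  sol md (tau +i* s) M ->
  `|Theta (tau +i* s) M + Quad M - K%:R * (pi / 2)| <= c / s.
Proof.
have [cS cS0 hS] := SE_bound md.
have [A A0 hA] := mxle_bound md (md_pwh md).
pose E := `|tau| + A + cS.
have E0 : 0 <= E by rewrite !addr_ge0 // ltW.
pose b := K%:R * E; have b0 : 0 <= b by rewrite mulr_ge0.
pose q := K%:R * (K%:R * cS).
have q0 : 0 <= q by do 3 (apply: mulr_ge0 => //); exact: mulr_ge0.
(* The middle term is there only to make 2 b <= s follow from c <= s. *)
exists (K%:R * (2 * b) + 2 * b + q).
  by rewrite !addr_ge0 // ?mulr_ge0.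
move=> s M s1 cs S; have [p i d] := S.
have s0 : 0 < s by rewrite (lt_le_trans ltr01).
have bs : 2 * b <= s.
  by rewrite (le_trans _ cs) // addrAC lerDr addr_ge0 // !mulr_ge0.
have Me u : 0 <= u <= 1 -> mxle (M u) s^-1.
  by move=> u01; exact: (mxle_ninv (s0 : 0 < complex.Im (tau +i* s)) (i u u01) (d u u01)).
have SM x : 0 <= x <= 1 -> mxle (SE md M x) (cS * s^-1).
  move=> x01; have e1 : 0 <= E01 (fun=> s^-1) by rewrite E01_cst invr_ge0 ltW.
  have [h _] := hS M (fun=> s^-1) (mpwh_mcbm md p) (bmf_cst _ _) Me e1.
  by have := h x x01; rewrite E01_cst.
have si : 0 <= s^-1 by rewrite invr_ge0 ltW.
have si1 : s^-1 <= 1 by rewrite invf_le1.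
have hE x : 0 <= x <= 1 -> mxle (Gf md (tau +i* s) M x - (0 +i* s)%:M) E.
  move=> x01; have -> : Gf md (tau +i* s) M x - (0 +i* s)%:M = (tau%:C)%:M + - md_a md x + SE md M x.
    have zE : (tau +i* s : C) = tau%:C + (0 +i* s) by apply/eqP; rewrite eq_complex /= addr0 add0r !eqxx.
    by rewrite /Gf zE; apply/matrixP => u v; rewrite !mxE mulrnDl; ring.
  apply: mxleD; first apply: mxleD.
  - by rewrite -cabs_real; exact: mxle_scalar.
  - exact/mxleN/hA.
  - by apply: mxle_le (SM x x01); rewrite ler_piMr.
have hT : `|Theta (tau +i* s) M - K%:R * (pi / 2)| <= K%:R * (2 * b / s).
  have a1 := pwr_bmf HI (pwr_argdet s0 (mpwh_Gf md (tau +i* s) p) i).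
  rewrite /Theta -[X in _ - X](E01_cst) -(E01B a1 (bmf_cst _ _)).
  apply: E01_norm => [|x x01]; first by apply: bmfB => //; exact: bmf_cst.
  exact: (argdet_large s0 E0 (lexx _) bs (i x x01) (hE x x01)).
have hQ : `|Quad M| <= q / s.
  rewrite /Quad normrM [X in _ * X]ger0_norm ?invr_ge0 // ler_pdivrMr //.
  rewrite (le_trans (le_Im_cabs _)) // mulrC; apply: cabs_cI => [|x x01].
    by apply: (pwh_cbm HI); apply: mpwh_tr; apply: (mpwhM md) => //; exact: mpwh_SE'.
  apply: (@le_trans _ _ (K%:R * (K%:R * (s^-1 * (cS * s^-1))))).
    by apply: cabs_tr; apply: mxle_mul; [|exact: Me|exact: SM].
  rewrite /q -!mulrA; do 2 (rewrite ler_wpM2l //).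
  by rewrite mulrCA ler_wpM2l // ler_piMr.
rewrite addrAC (le_trans (ler_normD _ _)) // [leRHS]mulrDl lerD //.
apply: (le_trans hT).
have -> : (K%:R * (2 * b) + 2 * b) / s = K%:R * (2 * b / s) + 2 * b / s by ring.
by rewrite lerDl divr_ge0 ?mulr_ge0 // ltW.
Qed.
End Potential.

(** * The potential of a probability measure *)

Section Rho.
Context {R : realType} (rho : probability (measurableTypeR R) R).
Notation C := R[i].
Notation bmR := (@bmf _ (measurableTypeR R) R setT).
Definition RI (f : R -> R) : R := \int[rho]_(t in setT) f t.

Lemma mT : measurable (setT : set (measurableTypeR R)). Proof. exact: measurableT. Qed.
Lemma fT : (rho setT < +oo)%E.
Proof. by rewrite probability_setT ltry. Qed.
Lemma RI_cst (a : R) : RI (fun=> a) = a.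
Proof. rewrite /RI Rintegral_cst // (_ : fine _ = 1) ?mulr1 //.
exact: (congr1 fine (probability_setT rho)). Qed.
Lemma RI_le f g : bmR f -> bmR g -> (forall t, f t <= g t) -> RI f <= RI g.
Proof. by move=> bf bg fg; apply: (le_bmf mT fT bf bg) => x _; exact: fg. Qed.
Lemma RID f g : bmR f -> bmR g -> RI (fun t => f t + g t) = RI f + RI g.
Proof. by move=> bf bg; exact: (int_bmfD mT fT bf bg). Qed.
Lemma RIB f g : bmR f -> bmR g -> RI (fun t => f t - g t) = RI f - RI g.
Proof. by move=> bf bg; exact: (int_bmfB mT fT bf bg). Qed.
Lemma RIZ a f : bmR f -> RI (fun t => a * f t) = a * RI f.
Proof. by move=> bf; exact: (int_bmfZ mT fT a bf). Qed.
Lemma RI_norm f (M : R) : bmR f -> (forall t, `|f t| <= M) -> `|RI f| <= M.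
Proof.
move=> bf fM; rewrite -[leRHS]mulr1 -[1]/(fine 1%E) -(probability_setT rho).
by apply: (le_int_bmf mT fT bf) => x _; exact: fM.
Qed.

Lemma bmR_cont (f : R -> R) (M : R) : continuous f -> (forall t, `|f t| <= M) -> bmR f.
Proof.
move=> cf fM; split; first exact: continuous_measurable_fun.
by exists M => x _; exact: fM.
Qed.

(** Bounded convergence. *)
Lemma RI_cvg (f_ : nat -> R -> R) (f : R -> R) (M : R) :
  (forall n, bmR (f_ n)) -> bmR f -> (forall n t, `|f_ n t| <= M) ->
  (forall t, f_ n t @[n --> \oo] --> f t) -> RI (f_ n) @[n --> \oo] --> RI f.
Proof.
move=> bf_ bf fM cf.
have [|||||_ _ h] := @dominated_convergence _ (measurableTypeR R) R rho setT mT
  (fun n t => (f_ n t)%:E) (fun t => (f t)%:E) (fun=> M%:E).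
- by move=> n; apply/measurable_EFinP; case: (bf_ n).
- by apply/measurable_EFinP; case: bf.
- by apply: aeW => t _; apply: cvg_EFin; [exact: nearW|exact: cf].
- exact: (bmf_int mT fT (bmf_cst _ M)).
- by apply: aeW => t n _; rewrite /= lee_fin.
apply: fine_cvg; rewrite /RI /Rintegral fineK //.
apply: integrable_fin_num; [exact: mT|exact: (bmf_int mT fT bf)].
Qed.

Lemma cont_atan_scale (tau a : R) : continuous (fun t : R => atan ((tau - t) * a)).
Proof.
move=> t; apply: (@continuous_comp _ _ _ (fun t => (tau - t) * a) atan); last exact: continuous_atan.
apply: cvgM; last exact: cvg_cst.
by apply: cvgB; [exact: cvg_cst|exact: cvg_id].
Qed.

Lemma atan_bound (x : R) : `|atan x| <= pi / 2.
Proof. by rewrite ler_norml !ltW ?atan_gtNpi2 ?atan_ltpi2. Qed.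

Lemma bm_atan (tau a : R) : bmR (fun t => atan ((tau - t) * a)).
Proof. by apply: (bmR_cont (M := pi / 2)); [exact: cont_atan_scale|move=> t; exact: atan_bound]. Qed.

(** The derivative of eta |-> - atan (y / eta) is y / (y^2 + eta^2), whose own derivative is
at most 1 / eta^2 in modulus. *)
Lemma atan_step (y e0 s t : R) : 0 < e0 -> e0 <= s -> e0 <= t ->
  `|- atan (y / s) + atan (y / t) - (s - t) * (y / (y ^+ 2 + t ^+ 2))| <= (s - t) ^+ 2 / e0 ^+ 2.
Proof.
move=> e00 s0 t0.
pose g (x : R) := atan (y / x).
pose dg (x : R) : R := - (y / (y ^+ 2 + x ^+ 2)).
have der (x : R) : 0 < x -> is_derive x (1 : R) g (dg x).
  move=> x0.
  have x1 : x != 0 by rewrite gt_eqF.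
  have dv : is_derive x (1 : R) (fun x : R => y / x) (y * - (x ^- 2)).
    have h : is_derive x (1 : R) (fun x : R => x^-1) (- x ^- 2).
      have := @is_deriveV R id x 1 1 x1 (is_derive_id _ _).
      by move=> h; apply: (is_derive_eq h); rewrite /GRing.scale /= mulr1.
    have := @is_deriveZ _ _ _ (fun x : R => x^-1) y x 1 _ h.
    by move=> h'; apply: (is_derive_eq h').
  have := @is_derive1_comp R atan (fun x : R => y / x) x _ _ (is_derive1_atan (y / x)) dv.
  move=> h; apply: (is_derive_eq h); rewrite /dg; field.
  by rewrite x1 andbT gt_eqF // ltr_wpDl ?sqr_ge0 // exprn_gt0.
have cont a b : 0 < a -> {within `[a, b], continuous g}.
  move=> a0; apply: derivable_within_continuous => x; rewrite in_itv /= => /andP[ax _].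
  have d := der x (lt_le_trans a0 ax); exact: ex_derive.
have dseg (a b : R) : 0 < a -> forall x, x \in `]a, b[ -> is_derive x (1 : R) g (dg x).
  by move=> a0 x; rewrite in_itv /= => /andP[ax _]; exact/der/(lt_trans a0).
have s00 := lt_le_trans e00 s0; have t00 := lt_le_trans e00 t0.
have [c [c0 [ct ->]]] : exists c, e0 <= c /\ (`|c - t| <= `|s - t|) /\
    - atan (y / s) + atan (y / t) = - (dg c * (s - t)).
  have [st|ts] := leP t s.
    have [c] := @MVT_segment R g dg t s st (dseg t s t00) (cont _ _ t00).
    rewrite in_itv /= => /andP[tc cs] e; exists c; split; first exact: le_trans tc.
    split; last by rewrite -e /g opprB addrC.
    by rewrite !ger0_norm ?subr_ge0 // lerB.
  have [c] := @MVT_segment R g dg s t (ltW ts) (dseg s t s00) (cont _ _ s00).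
  rewrite in_itv /= => /andP[sc ct] e; exists c; split; first exact: le_trans sc.
  split; last by rewrite -[s - t]opprB mulrN opprK -e /g addrC.
  by rewrite !ler0_norm ?subr_le0 // ?(ltW ts) // lerN2 lerB.
have c00 := lt_le_trans e00 c0.
have Yc : 0 < y ^+ 2 + c ^+ 2 by rewrite ltr_wpDl ?sqr_ge0 // exprn_gt0.
have Yt : 0 < y ^+ 2 + t ^+ 2 by rewrite ltr_wpDl ?sqr_ge0 // exprn_gt0.
pose P := y / (y ^+ 2 + c ^+ 2) * (t / (y ^+ 2 + t ^+ 2)) + y / (y ^+ 2 + t ^+ 2) * (c / (y ^+ 2 + c ^+ 2)).
have -> : - (dg c * (s - t)) - (s - t) * (y / (y ^+ 2 + t ^+ 2)) =
   (s - t) * ((t - c) * P) by rewrite /dg /P; field; rewrite !gt_eqF.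
rewrite normrM -[(s - t) ^+ 2]real_normK ?num_real // expr2 -mulrA ler_wpM2l //.
rewrite normrM ler_pM // 1?distrC //.
have half (x z : R) : 0 < z -> 0 < x ^+ 2 + z ^+ 2 -> `|x * (z / (x ^+ 2 + z ^+ 2))| <= 1 / 2.
  move=> z0 n0; rewrite mulrA normrM normfV (gtr0_norm n0) ler_pdivrMr // normrM (gtr0_norm z0).
  by have := sqr_ge0 (`|x| - z); rewrite -(real_normK (num_real x)); nra.
have inv (z : R) : e0 <= z -> 0 < y ^+ 2 + z ^+ 2 -> `|(y ^+ 2 + z ^+ 2)^-1| <= (e0 ^+ 2)^-1.
  move=> ez n0; rewrite normfV (gtr0_norm n0) lef_pV2 ?posrE ?exprn_gt0 //.
  have z0 := lt_le_trans e00 ez.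
  by rewrite ler_wpDl ?sqr_ge0 // ler_sqr ?nnegrE ?(ltW e00) ?(ltW z0).
have -> : P = (y * (t / (y ^+ 2 + t ^+ 2))) * (y ^+ 2 + c ^+ 2)^-1 +
   (y * (c / (y ^+ 2 + c ^+ 2))) * (y ^+ 2 + t ^+ 2)^-1 by rewrite /P; field; rewrite !gt_eqF.
rewrite (le_trans (ler_normD _ _)) // !normrM.
have e2 : 0 <= (e0 ^+ 2)^-1 by rewrite invr_ge0 sqr_ge0.
have -> : (e0 ^+ 2)^-1 = 1 / 2 * (e0 ^+ 2)^-1 + 1 / 2 * (e0 ^+ 2)^-1 by field; rewrite gt_eqF.
by apply: lerD; apply: ler_pM; rewrite ?normr_ge0 // -?normrM ?half ?inv.
Qed.

(** pi/2 - atan ((tau - t) / eta) is the argument of (tau - t) + i eta, so this is the imaginary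
part of the logarithmic potential of rho at tau + i eta. *)
Definition logpot (tau eta : R) : R := RI (fun t => pi / 2 - atan ((tau - t) / eta)).

Lemma bm_poisson (tau eta : R) : 0 < eta ->
  bmR (fun t => (tau - t) / ((tau - t) ^+ 2 + eta ^+ 2)) /\
  bmR (fun t => eta / ((tau - t) ^+ 2 + eta ^+ 2)).
Proof.
move=> e0.
have n0 t : 0 < (tau - t) ^+ 2 + eta ^+ 2 by rewrite ltr_wpDl ?sqr_ge0 // exprn_gt0.
have c1 : continuous (fun t : R => tau - t).
  by move=> t; apply: cvgB; [exact: cvg_cst|exact: cvg_id].
have c2 : continuous (fun t : R => ((tau - t) ^+ 2 + eta ^+ 2)^-1).
  move=> t; apply: cvgV; first by rewrite gt_eqF.
  by apply: cvgD; [apply: cvgM; exact: c1|exact: cvg_cst].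
split.
  apply: (bmR_cont (M := eta^-1)) => [t|t]; first by apply: cvgM; [exact: c1|exact: c2].
  rewrite normrM normfV (gtr0_norm (n0 t)) ler_pdivrMr // mulrC ler_pdivlMr //.
  have := sqr_ge0 (`|tau - t| - eta); rewrite -(real_normK (num_real (tau - t))).
  by have := normr_ge0 (tau - t); nra.
apply: (bmR_cont (M := eta^-1)) => [t|t]; first by apply: cvgM; [exact: cvg_cst|exact: c2].
rewrite normrM normfV (gtr0_norm (n0 t)) (gtr0_norm e0) ler_pdivrMr // mulrC ler_pdivlMr //.
by rewrite -expr2 lerDr sqr_ge0.
Qed.

Lemma Re_stieltjes (tau eta : R) : 0 < eta ->
  complex.Re (stieltjes rho (tau +i* eta)) = - RI (fun t => (tau - t) / ((tau - t) ^+ 2 + eta ^+ 2)).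
Proof.
move=> e0; have [b _] := bm_poisson tau e0.
rewrite /stieltjes /cintegral /= -[RHS]mulN1r; apply: (etrans _ (RIZ (-1) b)); apply: eq_Rintegral => t _ /=.
by rewrite sub0r sqrrN -[(t - tau) ^+ 2]sqrrN opprB mulN1r -mulNr opprB.
Qed.

Lemma Im_stieltjes (tau eta : R) :
  complex.Im (stieltjes rho (tau +i* eta)) = RI (fun t => eta / ((tau - t) ^+ 2 + eta ^+ 2)).
Proof.
rewrite /stieltjes /cintegral /=; apply: eq_Rintegral => t _ /=.
by rewrite sub0r sqrrN -[(t - tau) ^+ 2]sqrrN opprB mulNr opprK.
Qed.

Lemma bm_logpot (tau eta : R) : bmR (fun t => pi / 2 - atan ((tau - t) / eta)).
Proof. by apply: bmfB; [exact: bmf_cst|exact: bm_atan]. Qed.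

(** [atan_step] integrated against rho: the derivative in eta is minus the real part of the
Stieltjes transform. *)
Lemma logpot_step (tau e0 s t : R) : 0 < e0 -> e0 <= s -> e0 <= t ->
  `|logpot tau s - logpot tau t + (s - t) * complex.Re (stieltjes rho (tau +i* t))|
    <= (s - t) ^+ 2 / e0 ^+ 2.
Proof.
move=> e00 s0 t0; have t00 := lt_le_trans e00 t0.
have [b _] := bm_poisson tau t00.
rewrite Re_stieltjes // mulrN /logpot -RIB; [|exact: bm_logpot|exact: bm_logpot].
rewrite -(RIZ _ b) -RIB; [|by apply: bmfB; exact: bm_logpot|exact: bmfZ].
apply: RI_norm => [|x].
  by apply: bmfB; [by apply: bmfB; exact: bm_logpot|exact: bmfZ].
have -> : pi / 2 - atan ((tau - x) / s) - (pi / 2 - atan ((tau - x) / t)) =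
  - atan ((tau - x) / s) + atan ((tau - x) / t) by ring.
exact: atan_step.
Qed.

Lemma logpot_infty (tau : R) : logpot tau n.+1%:R @[n --> \oo] --> pi / 2.
Proof.
have -> : pi / 2 = RI (fun=> pi / 2) by rewrite RI_cst.
apply: (@RI_cvg (fun n t => pi / 2 - atan ((tau - t) / n.+1%:R)) _ (pi / 2 + pi / 2)).
- by move=> n; exact: bm_logpot.
- exact: bmf_cst.
- move=> n t; rewrite (le_trans (ler_normB _ _)) // lerD //; last exact: atan_bound.
  by rewrite ger0_norm // divr_ge0 // pi_ge0.
move=> t; rewrite -[X in _ --> X]subr0; apply: cvgB; first exact: cvg_cst.
rewrite -atan0; apply: continuous_cvg; first exact: continuous_atan.
rewrite -[X in _ --> X](mulr0 (tau - t)); apply: cvgM; first exact: cvg_cst.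
exact: cvg_harmonic.
Qed.

(** Pointwise in t the argument tends to pi for t > tau and to 0 for t < tau; the point tau
itself is excluded by the hypothesis. *)
Lemma logpot_zero (tau : R) : rho [set tau] = 0%E ->
  logpot tau n.+1%:R^-1 @[n --> \oo] --> pi * (1 - fine (rho `]-oo, tau[%classic)).
Proof.
move=> rt.
pose lo : set (measurableTypeR R) := `]-oo, tau[%classic.
pose hi : set (measurableTypeR R) := `]tau, +oo[%classic.
have mlo : measurable lo by exact: measurable_itv.
have mhi : measurable hi by exact: measurable_itv.
have bi (A : set (measurableTypeR R)) : measurable A -> bmR (\1_A : R -> R).
  move=> mA; split; first exact: measurable_indic.
  by exists 1 => x _; rewrite indicE; case: (_ \in _); rewrite ?normr1 ?normr0.
have RIi (A : set (measurableTypeR R)) : measurable A -> RI (\1_A : R -> R) = fine (rho A).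
  by move=> mA; rewrite /RI /Rintegral integral_indic // setIT.
pose g (t : R) : R := pi / 2 - (pi / 2) * (\1_lo t - \1_hi t).
have bg : bmR g by apply: bmfB; [exact: bmf_cst|apply: bmfZ; apply: bmfB; exact: bi].
have hlo : fine (rho hi) = 1 - fine (rho lo).
  have dis : lo `&` hi = set0.
    apply/seteqP; split=> x //= []; rewrite /lo /hi /= !in_itv /= andbT => a b.
    by have := lt_trans a b; rewrite ltxx.
  have u : rho (lo `|` hi `|` [set tau]) = 1%E.
    rewrite -(probability_setT rho); congr (rho _); apply/seteqP; split=> // x _.
    rewrite /lo /hi /= !in_itv /= andbT.
    by case: (ltgtP x tau) => [?|?|->]; [left; left|left; right|right].
  have m1 : measurable [set tau : measurableTypeR R] by exact: measurable_set1.
  rewrite measureU0 // in u; last exact: measurableU.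
  rewrite measureU // in u.
  have fl : rho lo \is a fin_num by apply: fin_num_measure.
  have fh : rho hi \is a fin_num by apply: fin_num_measure.
  by have := congr1 fine u; rewrite fineD //= => <-; rewrite addrAC subrr add0r.
have -> : pi * (1 - fine (rho lo)) = RI g.
  rewrite /g RIB; [|exact: bmf_cst|by apply: bmfZ; apply: bmfB; exact: bi].
  rewrite RI_cst RIZ; last by apply: bmfB; exact: bi.
  transitivity (pi / 2 - pi / 2 * (fine (rho lo) - fine (rho hi))); first by rewrite hlo; field.
  congr (_ - _ * _); rewrite -(RIi lo mlo) -(RIi hi mhi); apply: esym.
  exact: (RIB (bi lo mlo) (bi hi mhi)).
apply: (@RI_cvg (fun n t => pi / 2 - atan ((tau - t) / n.+1%:R^-1)) _ (pi / 2 + pi / 2)) => //.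
- by move=> n; exact: bm_logpot.
- move=> n t; rewrite (le_trans (ler_normB _ _)) // lerD //; last exact: atan_bound.
  by rewrite ger0_norm // divr_ge0 // pi_ge0.
move=> t; rewrite /g; apply: cvgB; first exact: cvg_cst.
have invn (x : R) (n : nat) : x / n.+1%:R^-1 = x * n.+1%:R by rewrite invrK.
have up (x : R) : 0 < x -> atan (x * n.+1%:R) @[n --> \oo] --> pi / 2.
  move=> x0; apply: (cvg_comp _ _ _ (@cvgy_atan R)).
  apply/cvgryPge => A; near=> n.
  rewrite -ler_pdivrMl //.
  apply: le_trans (ltW (truncnS_gt _)) _; rewrite ler_nat ltnS; near: n.
  exact: nbhs_infty_ge.
rewrite /lo /hi !indicE.
have [tt|tt|->] := ltgtP t tau.
- rewrite mem_set /= ?in_itv //= memNset /= ?in_itv /= ?andbT; last by rewrite ltNge (ltW tt).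
  rewrite subr0 mulr1; under eq_fun do rewrite invn.
  by apply: up; rewrite subr_gt0.
- rewrite memNset /= ?in_itv /= ?mem_set /= ?in_itv /= ?andbT //; last by rewrite ltNge (ltW tt).
  rewrite sub0r mulrN1.
  have -> : (fun n : nat => atan ((tau - t) / n.+1%:R^-1)) = (fun n => - atan ((t - tau) * n.+1%:R)).
    by apply/funext => n; rewrite invn -atanN -mulNr opprB.
  by apply: cvgN; apply: up; rewrite subr_gt0.
- have n1 : ~ (`]-oo, tau[%classic : set R) tau by rewrite /= in_itv /= ltxx.
  have n2 : ~ (`]tau, +oo[%classic : set R) tau by rewrite /= in_itv /= ltxx.
  rewrite (memNset n1) (memNset n2) [false%:R - _]subrr mulr0.
  under eq_fun do rewrite subrr mul0r atan0.
  exact: cvg_cst.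
Unshelve. all: by end_near.
Qed.

End Rho.

(** * Perturbation of determinants and the logarithmic divergence *)

Section MatrixAux.
Context {R : realType}.
Notation C := R[i].

(** Telescoping: change one factor at a time. *)
Lemma prod_diff (I : Type) (s : seq I) (f g : I -> C) (B h : R) : 1 <= B -> 0 <= h ->
  (forall i, cabs (f i) <= B) -> (forall i, cabs (g i) <= B) ->
  (forall i, cabs (f i - g i) <= h) ->
  cabs (\prod_(i <- s) f i) <= B ^+ size s /\
  cabs (\prod_(i <- s) f i - \prod_(i <- s) g i) <= (size s)%:R * B ^+ size s * h.
Proof.
move=> B1 h0 fB gB fg; have B0 : 0 <= B by rewrite (le_trans _ B1).
elim: s => [|i s [IH1 IH2]] /=.
  by rewrite !big_nil cabs1 expr0 subrr cabs0 !mul0r.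
rewrite !big_cons; split; first by rewrite cabsM exprS ler_pM ?cabs_ge0.
have -> : f i * \prod_(j <- s) f j - g i * \prod_(j <- s) g j =
  (f i - g i) * \prod_(j <- s) f j + g i * (\prod_(j <- s) f j - \prod_(j <- s) g j).
  by rewrite mulrBl mulrBr addrA subrK.
rewrite (le_trans (le_cabsD _ _)) // !cabsM.
have -> : (size s).+1%:R * B ^+ (size s).+1 * h =
    h * B ^+ (size s).+1 + B * ((size s)%:R * B ^+ size s * h).
  by rewrite -natr1 exprS; ring.
rewrite lerD //; last by rewrite ler_pM ?cabs_ge0.
rewrite ler_pM ?cabs_ge0 // (le_trans IH1) // exprS.
by rewrite ler_peMl // exprn_ge0.
Qed.

(** Leibniz' formula together with [prod_diff]. *)
Lemma det_bound n (B : R) : 1 <= B -> exists2 c, 0 < c & forall (A : 'M[C]_n),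
  mxle A B -> cabs (\det A) <= c /\
  forall (A' : 'M[C]_n) h, 0 <= h -> mxle A' B -> mxle (A - A') h ->
  cabs (\det A - \det A') <= c * h.
Proof.
move=> B1; have B0 : 0 < B by rewrite (lt_le_trans ltr01).
pose N : R := #|{perm 'I_n}|%:R.
exists (1 + N * (n.+1%:R * B ^+ n)).
  by rewrite ltr_pwDl // !mulr_ge0 // exprn_ge0 // ltW.
have sz : size (index_enum 'I_n) = n by rewrite -[RHS]card_ord cardT enumT.
have cs (b : bool) (x : C) : cabs ((-1) ^+ b * x) = cabs x.
  by case: b; rewrite ?expr0 ?expr1 ?mul1r // mulN1r cabsN.
have sumN (F : 'S_n -> C) c : (forall s, cabs (F s) <= c) -> cabs (\sum_s F s) <= N * c.
  move=> Fc; rewrite (le_trans (cabs_le_sum _ _ _)) // (le_trans (ler_sum _ (fun s _ => Fc s))) //.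
  by rewrite sumr_const mulr_natl.
move=> A AB; split=> [|A' h h0 AB' AA'].
  apply: (@le_trans _ _ (N * B ^+ n)).
    apply: sumN => s; rewrite cs.
    have z i : cabs (A i (s i) - A i (s i)) <= 0 by rewrite subrr cabs0.
    have [+ _] := @prod_diff _ (index_enum 'I_n) (fun i => A i (s i)) (fun i => A i (s i)) B 0
      B1 (lexx _) (fun i => AB i (s i)) (fun i => AB i (s i)) z.
    by rewrite sz.
  rewrite -[leLHS]add0r lerD // ler_wpM2l //.
  by rewrite ler_peMl ?exprn_ge0 ?(ltW B0) // ler1n.
rewrite /determinant -sumrB.
apply: (@le_trans _ _ (N * (n%:R * B ^+ n * h))).
  apply: sumN => s; rewrite -mulrBr cs.
  have AAs i : cabs (A i (s i) - A' i (s i)) <= h by have := AA' i (s i); rewrite !mxE.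
  have [_ +] := @prod_diff _ (index_enum 'I_n) (fun i => A i (s i)) (fun i => A' i (s i)) B h
      B1 h0 (fun i => AB i (s i)) (fun i => AB' i (s i)) AAs.
  by rewrite sz.
have le1 : N * (n%:R * B ^+ n) <= N * (n.+1%:R * B ^+ n).
  by rewrite ler_wpM2l // ler_wpM2r ?exprn_ge0 ?(ltW B0) // ler_nat.
have -> : N * (n%:R * B ^+ n * h) = N * (n%:R * B ^+ n) * h by rewrite !mulrA.
by rewrite ler_wpM2r // (le_trans le1) // lerDr.
Qed.

Lemma det_adj n (A : 'M[C]_n) : \det (A^t*) = Num.conj (\det A).
Proof. by rewrite det_map_mx det_tr. Qed.

Lemma adj_mxE m n (A : 'M[C]_(m, n)) i j : (A^t*) i j = Num.conj (A j i).
Proof. by rewrite !mxE. Qed.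

(** The form at e_i + om e_j is nonnegative for every unimodular om; the choice of the phase om
makes its off-diagonal part equal to minus the modulus of the (i, j) entry of A - A^*. *)
Lemma skew_entry n (A : 'M[C]_n) i j : (forall u, 0 <= complex.Im (dot u (A *m u))) ->
  cabs ((A - A^t*) i j) <= complex.Im (A i i) + complex.Im (A j j).
Proof.
move=> A0; set N := (A - A^t*) i j.
have NE : N = A i j - Num.conj (A j i) by rewrite /N !mxE.
have diag k : 0 <= complex.Im (A k k) by have := A0 (delta_mx k 0); rewrite dot_delta.
have [->|N0] := eqVneq N 0; first by rewrite cabs0 addr_ge0.
have cN := cabs_gt0 N0.
(* The phase for which om N = - i |N|. *)
pose om : C := (0 -i* (cabs N)^-1) * Num.conj N.
have omN : om * N = 0 -i* cabs N.
  rewrite /om -mulrA mulJ_cabs; apply/eqP; rewrite eq_complex /=.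
  by apply/andP; split; apply/eqP; [ring|field; rewrite gt_eqF].
have om1 : Num.conj om * om = 1.
  rewrite mulJ_cabs /om cabsM cabsJ.
  have -> : cabs (0 -i* (cabs N)^-1) = (cabs N)^-1.
    by rewrite /cabs /= expr0n add0r sqrrN sqrtr_sqr ger0_norm // invr_ge0 ltW.
  by rewrite mulVf ?gt_eqF // expr1n.
have := A0 (delta_mx i 0 + om *: delta_mx j 0).
rewrite mulmxDr dotDr !dotDl -scalemxAr !dotZl !dotZr !dot_delta !ImD.
rewrite mulrA om1 mul1r.
have -> : complex.Im (Num.conj om * A j i) = - complex.Im (om * Num.conj (A j i)).
  have swap (z w : C) : complex.Im (Num.conj z * w) = - complex.Im (z * Num.conj w).
    by case: z w => [p q] [r s] /=; ring.
  exact: swap.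
have e : complex.Im (om * A i j) - complex.Im (om * Num.conj (A j i)) = - cabs N.
  by rewrite -ImB -mulrBr -NE omN.
lra.
Qed.

(** Only the scales with 2^k < h / y contribute, and their powers of 2 add up geometrically. *)
Lemma sum_halves (h y : R) n : 0 < h -> 0 < y ->
  (\sum_(k < n) (2 ^+ k) * (y < h / 2 ^+ k)%R%:R) * (h / 2 ^+ n + y) <= 3 * h.
Proof.
move=> h0 y0.
have p2 k : 0 < (2 : R) ^+ k by rewrite exprn_gt0.
set S := \sum_(k < n) _.
have S1 : S <= 2 ^+ n.
  rewrite /S; elim: n @S => [|n IH]; first by rewrite big_ord0 expr0.
  rewrite big_ord_recr /= exprS mulr_natl mulr2n lerD // ler_piMr ?(ltW (p2 n)) //.
  by case: (_ < _).
have S2 : S * y <= 2 * h.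
  rewrite /S; elim: n @S S1 => [|n IH] /= S1; first by rewrite big_ord0 mul0r mulr_ge0 // ltW.
  have [yn|yn] := ltP y (h / 2 ^+ n).
    apply: (@le_trans _ _ (2 ^+ n.+1 * y)); first by rewrite ler_wpM2r // ltW.
    move: yn; rewrite ltr_pdivlMr // => yn.
    by rewrite exprS -mulrA ler_wpM2l // mulrC ltW.
  rewrite big_ord_recr /= ltNge yn /= mulr0 addr0; apply: IH.
  move: S1; rewrite big_ord_recr /= ltNge yn /= mulr0 addr0 => _.
  elim: n {yn} => [|n IH]; first by rewrite big_ord0 expr0.
  rewrite big_ord_recr /= exprS mulr_natl mulr2n lerD // ler_piMr ?(ltW (p2 n)) //.
  by case: (_ < _).
rewrite mulrDr.
have : S * (h / 2 ^+ n) <= h.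
  apply: (@le_trans _ _ (2 ^+ n * (h / 2 ^+ n))); last by rewrite mulrC divfK // gt_eqF.
  by rewrite ler_wpM2r // divr_ge0 ?(ltW h0) // ltW.
by move: S2; lra.
Qed.
End MatrixAux.

Section Gap.
Context {R : realType} (L : nat) (I : 'I_L -> set R) (K : nat) (md : model I K).
Notation C := R[i].
Local Notation HI := (md_part md).

Lemma part_two_points l : exists p q, [/\ I l p, I l q & p < q].
Proof.
have [_ _ h] := HI; have [p lp] := part_ne HI l.
apply: contrapT => hn.
have sub : I l `<=` [set p].
  move=> q lq /=; case: (ltgtP p q) => // pq; exfalso; apply: hn.
    by exists p, q.
  by exists q, p.
have := h l; have -> : leb R (I l) = 0%E; last by rewrite ltxx.
apply/eqP; rewrite eq_le measure_ge0 andbT.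
have <- : leb R [set p] = 0%E by rewrite /leb; exact: lebesgue_measure_set1.
exact: (@le_measure _ _ _ (leb R) (I l) [set p] (mem_set (part_meas HI l))
  (mem_set (measurable_set1 p)) sub).
Qed.

(** Around any point x0 of I_l, one of the two sides of x0 inside I_l has a length at least h,
half the distance between two fixed points of I_l. Hence punctured one-sided neighbourhoods
J d of every length d <= h are available, with h independent of x0. *)
Lemma part_side l : exists2 h : R, 0 < h & forall x0, I l x0 -> exists J : R -> set R,
  forall d, 0 < d -> d <= h -> [/\ measurable (J d : set (measurableTypeR R)),
    E01 (\1_(J d)) = d & forall x, J d x -> [/\ I l x, 0 < `|x - x0| & `|x - x0| < d]].
Proof.
have [p [q [lp lq pq]]] := part_two_points l.
have [_ hint _] := HI.
have p01 := part_sub HI lp; have q01 := part_sub HI lq.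
pose h := (q - p) / 2; have h0 : 0 < h by rewrite divr_gt0 // subr_gt0.
exists h => // x0 lx0; have x01 := part_sub HI lx0.
have E1 (a b : R) : 0 <= a -> a < b -> b <= 1 -> E01 (\1_(`]a, b[%classic : set R) : R -> R) = b - a.
  move=> a0 ab b1; rewrite E01_indic; last exact: measurable_itv.
  have -> : `]a, b[%classic `&` `[0, 1]%classic = `]a, b[%classic :> set R.
    apply/seteqP; split=> x /=; first by case.
    rewrite !in_itv /= => /andP[xa xb]; split; apply/andP; split=> //.
      by rewrite (le_trans a0) // ltW.
    by rewrite (le_trans _ b1) // ltW.
  by have := @lebesgue_measure_itv R `]a, b[; rewrite /leb /= lte_fin ab => ->.
have [xm|xm] := leP x0 ((p + q) / 2).
  exists (fun d => `]x0, x0 + d[%classic) => d d0 dh.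
  have xq : x0 + d <= q by rewrite /h in dh; lra.
  split; first exact: measurable_itv.
  - rewrite E1 ?ltrDl //; [by rewrite addrAC subrr add0r|by case/andP: x01|].
    by rewrite (le_trans xq) //; case/andP: q01.
  - move=> x /=; rewrite in_itv /= => /andP[xa xb]; split.
    + apply: (hint l x0 q) => //; rewrite ltW //= ltW // (lt_le_trans xb) //.
    + by rewrite normr_gt0 subr_eq0 gt_eqF.
    + by rewrite ger0_norm ?subr_ge0 ?(ltW xa) // ltrBlDl.
exists (fun d => `]x0 - d, x0[%classic) => d d0 dh.
have xq : p <= x0 - d by rewrite /h in dh; lra.
split; first exact: measurable_itv.
- rewrite E1 ?ltrBlDr ?ltrDl //; [by rewrite opprB addrCA subrr addr0| |by case/andP: x01].
  by rewrite (le_trans _ xq) //; case/andP: p01.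
- move=> x /=; rewrite in_itv /= => /andP[xa xb]; split.
  + apply: (hint l p x0) => //; rewrite [X in _ && X]ltW // andbT ltW // (le_lt_trans xq) //.
  + by rewrite normr_gt0 subr_eq0 lt_eqF.
  + by rewrite ltr0_norm ?subr_lt0 // opprB ltrBlDr addrC -ltrBlDr.
Qed.

(** If U were large, psi would be at least a multiple of 1 / |x - x0| at all distances between
h / 2^n and h from x0, and its integral would be at least a multiple of n. Dyadic indicator
functions stand for 1 / |x - x0|, so that no logarithm is needed. *)
Lemma log_divergence l (k c0 : R) : 0 < k -> 0 <= c0 -> exists2 C0, 0 < C0 &
  forall (psi : R -> R) x0 U, bmU psi -> (forall x, 0 <= x <= 1 -> 0 <= psi x) ->
  E01 psi <= c0 -> I l x0 -> 0 <= U ->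
  (forall x, I l x -> U <= psi x * (k * (1 + k * (`|x - x0| * U)))) -> U <= C0.
Proof.
move=> k0 c00; have [h h0 side] := part_side l.
(* n dyadic scales yield an integral at least n / (3 k^2), more than c0 for this n. *)
pose n := (Num.truncn (3 * (k * k) * c0)).+1.
have hn : 3 * (k * k) * c0 < n%:R by exact: truncnS_gt.
have p2 j : 0 < (2 : R) ^+ j by rewrite exprn_gt0.
exists (2 ^+ n / (k * h)); first by rewrite divr_gt0 // mulr_gt0.
move=> psi x0 U bpsi psi0 Ec lx0 U0 hU; rewrite leNgt; apply/negP => UC.
have UC' : 1 < k * (h / 2 ^+ n) * U.
  move: UC; rewrite ltr_pdivrMr ?mulr_gt0 // => UC.
  have -> : k * (h / 2 ^+ n) * U = U * (k * h) / 2 ^+ n by field; rewrite gt_eqF.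
  by rewrite ltr_pdivlMr // mul1r.
have Up : 0 < U by rewrite (lt_trans _ UC) // divr_gt0 // mulr_gt0.
have [J hJ] := side x0 lx0.
have hd j : 0 < h / 2 ^+ j by rewrite divr_gt0.
have hd' j : h / 2 ^+ j <= h.
  by rewrite ler_pdivrMr // ler_peMr ?(ltW h0) // exprn_ege1 // ler1n.
pose g x := \sum_(j < n) (2 ^+ j) * (\1_(J (h / 2 ^+ j)) x : R).
have bJ j : bmU (fun x => (2 ^+ j) * (\1_(J (h / 2 ^+ j)) x : R)).
  apply: bmfZ; have [mJ _ _] := hJ _ (hd j) (hd' j).
  split; first exact: measurable_indic.
  by exists 1 => x _; rewrite indicE; case: (_ \in _); rewrite ?normr1 ?normr0.
have bg : bmU g by apply: bmf_sum => j; exact: bJ.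
have Eg : E01 g = n%:R * h.
  rewrite /g E01_sum => [|j]; last exact: bJ.
  rewrite (eq_bigr (fun _ => h)) => [|j _]; first by rewrite sumr_const card_ord mulr_natl.
  have [mJ EJ _] := hJ _ (hd j) (hd' j).
  rewrite E01Z ?EJ; first by rewrite mulrC divfK // gt_eqF.
  split; first exact: measurable_indic.
  by exists 1 => x _; rewrite indicE; case: (_ \in _); rewrite ?normr1 ?normr0.
have k2 : 0 < k * k by rewrite mulr_gt0.
have g0 x : 0 <= g x.
  apply: sumr_ge0 => j _; rewrite mulr_ge0 ?(ltW (p2 j)) // indicE; exact: ler0n.
have main x : 0 <= x <= 1 -> g x <= (3 * h * (k * k)) * psi x.
  move=> x01; have [[j jx]|nj] := pselect (exists j : 'I_n, J (h / 2 ^+ j) x); last first.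
    rewrite /g big1 => [|j _].
      by rewrite mulr_ge0 ?psi0 // !mulr_ge0 // ltW.
    rewrite indicE memNset ?mulr0 // => jx; by apply: nj; exists j.
  have [_ _ hx] := hJ _ (hd j) (hd' j); have [lx y0 _] := hx x jx.
  set y := `|x - x0| in y0.
  have gS : g x <= \sum_(i < n) 2 ^+ i * (y < h / 2 ^+ i)%R%:R.
    apply: ler_sum => i _; rewrite ler_wpM2l ?(ltW (p2 i)) // indicE ler_nat.
    have [_ _ hi] := hJ _ (hd i) (hd' i).
    case: (boolP (x \in _)) => // /set_mem ix.
    by have [_ _ yi] := hi x ix; rewrite /y yi.
  have := sum_halves n h0 y0; set S := \sum_(i < n) _ in gS * => SS.
  have yy : 0 < h / 2 ^+ n + y by rewrite addr_gt0.
  have := hU x lx; rewrite -/y => hU'.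
  have one : 1 <= psi x * (k * k * (h / 2 ^+ n + y)).
    rewrite -(ler_pM2r Up) mul1r (le_trans hU') // -[leRHS]mulrA.
    rewrite ler_wpM2l ?psi0 //.
    have -> : k * k * (h / 2 ^+ n + y) * U = k * (k * (h / 2 ^+ n) * U + k * (y * U)) by ring.
    by rewrite ler_pM2l // lerD2r ltW.
  apply: (@le_trans _ _ (g x * (psi x * (k * k * (h / 2 ^+ n + y))))).
    by rewrite ler_peMr.
  have -> : g x * (psi x * (k * k * (h / 2 ^+ n + y))) =
    (g x * (h / 2 ^+ n + y)) * (k * k * psi x) by ring.
  rewrite -[leRHS]mulrA ler_wpM2r ?mulr_ge0 ?psi0 ?(ltW k0) //.
  by apply: le_trans SS; rewrite ler_wpM2r // ltW.
have := E01_le bg (bmfZ _ bpsi) main; rewrite Eg E01Z //.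
have -> : 3 * h * (k * k) * E01 psi = 3 * (k * k) * E01 psi * h by ring.
rewrite ler_pM2r // => nE.
have := lt_le_trans hn nE; rewrite ltNge => /negP; apply.
by rewrite ler_wpM2l // mulr_ge0 // ltW.
Qed.
End Gap.

(** * Uniform bounds outside the support *)

Section HilbertSchmidt.
Context {R : realType}.
Notation C := R[i].

(** Squared Hilbert-Schmidt norm. *)
Definition hs m n (A : 'M[C]_(m, n)) : R := \sum_i \sum_j cabs (A i j) ^+ 2.

Lemma hs_ge0 m n (A : 'M[C]_(m, n)) : 0 <= hs A.
Proof. by apply: sumr_ge0 => i _; apply: sumr_ge0 => j _; exact: sqr_ge0. Qed.

Lemma sqr_sum_le n (f : 'I_n -> R) : (\sum_i f i) ^+ 2 <= n%:R * \sum_i f i ^+ 2.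
Proof.
rewrite expr2 mulr_suml.
have e : n%:R * \sum_i f i ^+ 2 = \sum_i \sum_j (f i ^+ 2 + f j ^+ 2) / 2.
  have cst (g : 'I_n -> R) : \sum_(i < n) \sum_(j < n) g j / 2 = n%:R * (\sum_j g j) / 2.
    by rewrite sumr_const card_ord -mulr_suml -[LHS]mulr_natl -mulrA.
  have -> : \sum_(i < n) \sum_(j < n) (f i ^+ 2 + f j ^+ 2) / 2 =
      \sum_(i < n) \sum_(j < n) f i ^+ 2 / 2 + \sum_(i < n) \sum_(j < n) f j ^+ 2 / 2.
    rewrite -big_split /=; apply: eq_bigr => i _; rewrite -big_split /=.
    by apply: eq_bigr => j _; rewrite mulrDl.
  by rewrite exchange_big /= !(cst (fun j => f j ^+ 2)); field.
rewrite e; apply: ler_sum => i _; rewrite mulr_sumr; apply: ler_sum => j _.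
by have := sqr_ge0 (f i - f j); nra.
Qed.

(** Cauchy-Schwarz, up to the factor n. *)
Lemma nsq_hs m n (A : 'M[C]_(m, n)) (w : 'cV[C]_n) : nsq (A *m w) <= n%:R * hs A * nsq w.
Proof.
rewrite -mulrA /hs mulr_suml mulr_sumr; apply: ler_sum => i _.
apply: (@le_trans _ _ ((\sum_j cabs (A i j) * cabs (w j 0)) ^+ 2)).
  rewrite ler_sqr ?nnegrE ?cabs_ge0 //; last by apply: sumr_ge0 => j _; rewrite mulr_ge0 ?cabs_ge0.
  rewrite mxE (le_trans (cabs_le_sum _ _ _)) //.
  by apply: ler_sum => j _; rewrite cabsM.
apply: (le_trans (sqr_sum_le _)); rewrite ler_wpM2l // mulr_suml.
apply: ler_sum => j _; rewrite exprMn ler_wpM2l ?sqr_ge0 // /nsq (bigD1 j) //= lerDl.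
by apply: sumr_ge0 => k _; exact: sqr_ge0.
Qed.

Lemma hs_mxle n (A : 'M[C]_n) h : 0 <= h -> mxle A h -> hs A <= n%:R * (n%:R * h ^+ 2).
Proof.
move=> h0 Ah; rewrite /hs -[X in _ <= X%:R * _]card_ord mulr_natl -sumr_const.
apply: ler_sum => i _; rewrite -[X in _ <= X%:R * _]card_ord mulr_natl -sumr_const.
by apply: ler_sum => j _; rewrite ler_sqr ?nnegrE ?cabs_ge0.
Qed.

Lemma nsqD_le n (u v : 'cV[C]_n) : nsq (u + v) <= 2 * nsq u + 2 * nsq v.
Proof.
rewrite /nsq !mulr_sumr -big_split /=; apply: ler_sum => i _; rewrite mxE.
have h := le_cabsD (u i 0) (v i 0); have h0 := cabs_ge0 (u i 0 + v i 0).
apply: (@le_trans _ _ ((cabs (u i 0) + cabs (v i 0)) ^+ 2)).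
  by rewrite ler_sqr ?nnegrE ?addr_ge0 ?cabs_ge0.
by have := sqr_ge0 (cabs (u i 0) - cabs (v i 0)); nra.
Qed.

Lemma conj_cI (f : R -> C) : cbm f -> Num.conj (cI f) = cI (fun x => Num.conj (f x)).
Proof.
move=> [fr fi]; apply: eqC; first by rewrite Re_conj !Re_cI; apply: E01_eq => x _; rewrite Re_conj.
rewrite Im_conj !Im_cI -mulN1r -E01Z //; apply: E01_eq => x _; by rewrite Im_conj mulN1r.
Qed.

End HilbertSchmidt.

Section GapEstimate.
Context {R : realType} (L : nat) (I : 'I_L -> set R) (K : nat) (md : model I K).
Notation C := R[i].
Local Notation HI := (md_part md).
Local Notation a := (md_a md).

Lemma SE_adj (r : R -> 'M[C]_K) x : mcbm r -> 0 <= x <= 1 ->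
  (SE md r x)^t* = SE md (fun y => (r y)^t*) x.
Proof.
move=> br x01; have adj_sum (T : finType) (F : T -> 'M[C]_K) :
    (\sum_j F j)^t* = \sum_j (F j)^t*.
  by apply/matrixP => i j; rewrite adj_mxE !summxE rmorph_sum; apply: eq_bigr => k _; rewrite adj_mxE.
have mk (j : md_J md) : (mkop (md_k j) r x)^t* = mkop (md_k j) (fun y => (r y)^t*) x.
  apply/matrixP => p q; rewrite adj_mxE [LHS](congr1 Num.conj (mxE _ _ _ _)) [RHS]mxE /kop conj_cI.
    apply: cI_eq => y _; rewrite rmorphM /= adj_mxE; congr (_ * _).
    by apply: eqC; rewrite ?Re_conj ?Im_conj //= oppr0.
  exact: (kern_cbm HI (md_kern j)).
by rewrite /SE adj_sum; apply: eq_bigr => j _; rewrite !adjmxM adjmxK mulmxA mk.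
Qed.

(** For a solution, the density of the mass seen by Im of the Stieltjes transform; it dominates
the diagonal entries of Im M. *)
Definition ImTr (M : R -> 'M[C]_K) x := complex.Im (\tr (M x)).

Lemma Im_diag_ge0 z M x j : sol md z M -> 0 < complex.Im z -> 0 <= x <= 1 ->
  0 <= complex.Im (M x j j).
Proof. by move=> s z0 x01; have := im_sol_ge0 (delta_mx j 0) s z0 x01; rewrite dot_delta. Qed.

Lemma sol_skew z M x : sol md z M -> 0 < complex.Im z -> 0 <= x <= 1 ->
  mxle (M x - (M x)^t*) (2 * ImTr M x).
Proof.
move=> s z0 x01 i j.
have h k : complex.Im (M x k k) <= ImTr M x.
  rewrite /ImTr /mxtrace Im_sum (bigD1 k) //= lerDl.
  by apply: sumr_ge0 => k' _; exact: (Im_diag_ge0 k' s).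
rewrite (le_trans (skew_entry i j (fun u => im_sol_ge0 u s z0 x01))) //.
by rewrite mulr_natl mulr2n lerD.
Qed.

(** [im_ninv_ge] on the vectors of the canonical basis. *)
Lemma hs_sol z M x : sol md z M -> 0 < complex.Im z -> 0 <= x <= 1 ->
  complex.Im z * hs (M x) <= ImTr M x.
Proof.
move=> s z0 x01; have [p i d] := s; rewrite /hs exchange_big mulr_sumr /ImTr /mxtrace Im_sum.
apply: ler_sum => j _; have := im_ninv_ge z0 (i x x01) (d x x01) (delta_mx j 0).
rewrite dot_delta; apply: le_trans; rewrite ler_wpM2l ?(ltW z0) // /nsq.
by apply: ler_sum => k _; rewrite -colE mxE.
Qed.

Lemma bm_ImTr M : mpwh I M -> bmU (ImTr M).
Proof. by move=> p; have [] := pwh_cbm HI (mpwh_tr p). Qed.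

Lemma bm_hs M : mpwh I M -> bmU (fun x : R => hs (M x : 'M[C]_K)).
Proof.
move=> p; apply: bmf_sum => i; apply: bmf_sum => j.
have [br bi] := pwh_cbm HI (p i j).
by apply: bmf_eq (bmfD (bmfM br br) (bmfM bi bi)) => x _; rewrite cabs_sqr !expr2.
Qed.

Lemma cabs_le_hs (A : 'M[C]_K) : mxle A (1 + hs A).
Proof.
move=> i j; have : cabs (A i j) ^+ 2 <= hs A.
  rewrite /hs (bigD1 i) //= (bigD1 j) //= -addrA lerDl addr_ge0 //.
    by apply: sumr_ge0 => k _; exact: sqr_ge0.
  by apply: sumr_ge0 => k _; apply: sumr_ge0 => k' _; exact: sqr_ge0.
by have := sqr_ge0 (cabs (A i j) - 1); nra.
Qed.

Lemma E01_hs z M c0 : sol md z M -> 0 < complex.Im z -> E01 (ImTr M) <= c0 * complex.Im z ->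
  E01 (fun x : R => hs (M x : 'M[C]_K)) <= c0.
Proof.
move=> s z0 Ec; have [p _ _] := s; rewrite -(ler_pM2l z0) -E01Z; last exact: bm_hs.
rewrite [leRHS]mulrC (le_trans _ Ec) //; apply: E01_le.
- by apply: bmfZ; exact: bm_hs.
- exact: bm_ImTr.
- by move=> x x01; exact: hs_sol s z0 x01.
Qed.

(** The bound on Im tr M controls the L^2 norm of M by [hs_sol], hence its L^1 norm, and S
turns an L^1 bound into sup and Hoelder bounds. *)
Lemma Gf_uniform (tau c0 : R) : 0 <= c0 -> exists2 B, 1 <= B & forall eta M, 0 < eta <= 1 ->
  sol md (tau +i* eta) M -> E01 (ImTr M) <= c0 * eta ->
  (forall x, 0 <= x <= 1 -> mxle (Gf md (tau +i* eta) M x) B) /\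
  (forall l x y, I l x -> I l y ->
     mxle (Gf md (tau +i* eta) M x - Gf md (tau +i* eta) M y) (B * Num.sqrt `|x - y|)).
Proof.
move=> c00; have [cS cS0 hS] := SE_bound md.
have [Na Na0 aN] := mxle_bound md (md_pwh md).
have [Ha Ha0 aH] := mpwh_holder (md_pwh md).
pose s := cS * (1 + c0); have s0 : 0 <= s by rewrite mulr_ge0 // addr_ge0.
exists (`|tau| + 1 + Na + Ha + s).
  by rewrite -!addrA addrCA lerDl !addr_ge0 // ltW.
move=> eta M /andP[e0 e1] sM Ec; have [p _ _] := sM.
have bM := mpwh_mcbm md p; have bh := bm_hs p.
have b1 : @bmf _ (measurableTypeR R) R `[0, 1]%classic (fun=> 1).
  by split; [exact: measurable_cst|exists 1 => x _; rewrite normr1].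
have Eh := E01_hs sM e0 Ec.
have Eh0 : 0 <= E01 (fun x : R => hs (M x : 'M[C]_K)) by apply: E01_ge0 => x _; exact: hs_ge0.
have Ephi : E01 (fun x => 1 + hs (M x)) = 1 + E01 (fun x : R => hs (M x : 'M[C]_K)).
  by rewrite (E01D b1 bh) E01_cst.
have [SB SH] := hS M (fun x => 1 + hs (M x)) bM (bmfD b1 bh)
  (fun y _ => @cabs_le_hs (M y)) ltac:(by rewrite Ephi addr_ge0).
have les : cS * E01 (fun x => 1 + hs (M x)) <= s by rewrite Ephi ler_wpM2l // lerD2l.
split=> [x x01|l x y lx ly].
  apply: (@mxle_le _ _ _ ((`|tau| + 1) + Na + s)).
    by rewrite lerD2r lerDl.
  rewrite /Gf; apply: mxleD; last exact: mxle_le les (SB x x01).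
  apply: mxleD; last by apply: mxleN; exact: aN.
  apply: mxle_le (@mxle_scalar _ K _).
  by rewrite (le_trans (cabs_le_ReIm _)) //= lerD2l ger0_norm // ltW.
apply: (@mxle_le _ _ _ (Ha * Num.sqrt `|x - y| + s * Num.sqrt `|x - y|)).
  rewrite -mulrDl ler_wpM2r ?sqrtr_ge0 // lerD2r lerDr !addr_ge0 ?(ltW Na0) //.
have -> : Gf md (tau +i* eta) M x - Gf md (tau +i* eta) M y =
    - (a x - a y) + (SE md M x - SE md M y).
  by rewrite /Gf; apply/matrixP => i j; rewrite !mxE; ring.
apply: mxleD; first by apply: mxleN; exact: (aH l).
by apply: mxle_le (SH l x y lx ly); rewrite ler_wpM2r ?sqrtr_ge0.
Qed.

Lemma gap_alg (k k1 c w W h U : R) : 0 <= k1 -> 0 <= c -> 0 <= h -> 0 <= w ->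
  2 * k1 <= k -> c <= k -> U <= k1 * h * W -> W <= 2 + 2 * (c * w) -> U <= h * (k * (1 + k * w)).
Proof.
move=> k0 c0 h0 w0 kk ck UW Wc; apply: (le_trans UW).
have -> : k1 * h * W = h * (k1 * W) by ring.
rewrite ler_wpM2l //; apply: (le_trans (ler_wpM2l k0 Wc)).
have -> : k1 * (2 + 2 * (c * w)) = 2 * k1 * (1 + c * w) by ring.
apply: ler_pM => //; [by rewrite mulr_ge0|by rewrite addr_ge0 // mulr_ge0|].
by rewrite lerD2l ler_wpM2r.
Qed.

(** Let u = M(x0) e_j. Then G(x0) u = - e_j, so G(x) u has squared norm O(1 + |x - x0| |u|^2) by
the Hoelder bound with exponent 1/2, and u = - M(x) G(x) u bounds |u|^2 by the product of
this quantity with |M(x)|^2, a function with bounded integral. [log_divergence] concludes. *)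
Lemma gap_bound (tau c0 : R) : 0 <= c0 -> exists2 B, 1 <= B & forall eta M, 0 < eta <= 1 ->
  sol md (tau +i* eta) M -> E01 (ImTr M) <= c0 * eta ->
  forall x, 0 <= x <= 1 -> mxle (M x) B.
Proof.
move=> c00; have [B B1 hB] := Gf_uniform tau c00.
have B0 : 0 < B by rewrite (lt_le_trans ltr01).
pose K1 : R := K%:R; have K0 : 0 <= K1 by [].
pose k := 1 + 2 * K1 + K1 * (K1 * (K1 * B ^+ 2)).
have k3 : 0 <= K1 * (K1 * (K1 * B ^+ 2)) by rewrite !mulr_ge0 // ltW.
have k0 : 0 < k by rewrite /k; lra.
have h l : exists C0, 0 < C0 /\ forall (psi : R -> R) x0 U, bmU psi ->
   (forall x, 0 <= x <= 1 -> 0 <= psi x) ->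
  E01 psi <= c0 -> I l x0 -> 0 <= U ->
  (forall x, I l x -> U <= psi x * (k * (1 + k * (`|x - x0| * U)))) -> U <= C0.
  by have [C0 C00 hC] := log_divergence md l k0 c00; exists C0.
have /choice[f hf] := h.
exists (1 + \sum_l f l); first by rewrite lerDl sumr_ge0 // => l _; rewrite ltW //; case: (hf l).
move=> eta M e01 sM Ec x0 x001 i j; have /andP[e0 _] := e01.
have [p iM dM] := sM; have [gB gH] := hB eta M e01 sM Ec.
have [l lx0] := part_cover HI x001.
pose u : 'cV[C]_K := M x0 *m delta_mx j 0.
have uE : cabs (M x0 i j) ^+ 2 <= nsq u by exact: entry_le_nsq.
have fl : nsq u <= f l.
  have [_ hl] := hf l; apply: (hl (fun x : R => hs (M x : 'M[C]_K)) x0) => //; first exact: bm_hs.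
  - by move=> x _; exact: hs_ge0.
  - exact: E01_hs sM e0 Ec.
  - exact: nsq_ge0.
  move=> x lx; have x01 := part_sub HI lx.
  have uMG : - u = M x *m (Gf md (tau +i* eta) M x *m u) by rewrite mulmxA dM // mulNmx mul1mx.
  have Gu : Gf md (tau +i* eta) M x *m u = - delta_mx j 0 +
      (Gf md (tau +i* eta) M x - Gf md (tau +i* eta) M x0) *m u.
    rewrite mulmxBl /u [X in _ + (_ - X)]mulmxA (ninv_comm e0 (iM x0 x001) (dM x0 x001)).
    by rewrite mulNmx mul1mx opprK addrC addrK.
  set D := _ - _ in Gu.
  have Dn : nsq (D *m u) <= K1 * (K1 * (K1 * B ^+ 2)) * (`|x - x0| * nsq u).
    apply: (le_trans (nsq_hs _ _)); rewrite [leRHS]mulrA ler_wpM2r ?nsq_ge0 //.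
    have hD := hs_mxle (mulr_ge0 (ltW B0) (sqrtr_ge0 _)) (gH l x x0 lx lx0).
    rewrite exprMn sqr_sqrtr // in hD.
    apply: (le_trans (ler_wpM2l K0 hD)); by rewrite !mulrA lexx.
  have Gn : nsq (Gf md (tau +i* eta) M x *m u) <= 2 + 2 * (K1 * (K1 * (K1 * B ^+ 2)) * (`|x - x0| * nsq u)).
    by rewrite Gu (le_trans (nsqD_le _ _)) // nsqN nsq_delta mulr1 lerD2l ler_wpM2l.
  have Un : nsq u <= K1 * hs (M x) * nsq (Gf md (tau +i* eta) M x *m u).
    by rewrite -nsqN uMG; exact: nsq_hs.
  apply: (gap_alg K0 k3 (hs_ge0 _) _ _ _ Un Gn).
  - by rewrite mulr_ge0 ?nsq_ge0.
  - by rewrite /k; lra.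
  - by rewrite /k; lra.
have : cabs (M x0 i j) <= 1 + f l.
  by have := sqr_ge0 (cabs (M x0 i j) - 1); nra.
move=> /le_trans; apply; rewrite lerD2l (bigD1 l) //= lerDl sumr_ge0 // => l' _.
by rewrite ltW //; case: (hf l').
Qed.

(** G - G^* is 2 i eta plus S[M - M^*], and the entries of M - M^* are dominated by Im tr M. *)
Lemma Gf_skew (tau c0 : R) : 0 <= c0 -> exists2 B, 0 <= B & forall eta M, 0 < eta ->
  sol md (tau +i* eta) M -> E01 (ImTr M) <= c0 * eta ->
  forall x, 0 <= x <= 1 -> mxle (Gf md (tau +i* eta) M x - (Gf md (tau +i* eta) M x)^t*) (B * eta).
Proof.
move=> c00; have [cS cS0 hS] := SE_bound md.
exists (2 + cS * (2 * c0)); first by rewrite addr_ge0 // !mulr_ge0.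
move=> eta M e0 sM Ec x x01; have [p _ _] := sM.
have bM := mpwh_mcbm md p.
have bMa : mcbm (fun y => (M y)^t*).
  move=> i j; have [br bi] := bM j i; split.
    by apply: bmf_eq br => y _; rewrite adj_mxE Re_conj.
  by apply: bmf_eq (bmfN bi) => y _; rewrite adj_mxE Im_conj.
have bT := bm_ImTr p.
have T0 : 0 <= E01 (fun y => 2 * ImTr M y).
  apply: E01_ge0 => y y01; rewrite mulr_ge0 // /ImTr /mxtrace Im_sum sumr_ge0 // => k _.
  exact: Im_diag_ge0 sM e0 y01.
have [SB _] := hS _ _ (mcbmB bM bMa) (bmfZ 2 bT) (fun y y01 => sol_skew sM e0 y01) T0.
have -> : Gf md (tau +i* eta) M x - (Gf md (tau +i* eta) M x)^t* =
   (0 +i* (2 * eta))%:M + SE md (fun y => M y - (M y)^t*) x.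
  rewrite SEB // -SE_adj // /Gf; apply/matrixP => i j; rewrite !mxE.
  have := congr1 (fun A : 'M[C]_K => A i j) (md_herm md x01); rewrite adj_mxE => aij.
  rewrite rmorphD rmorphB /= aij [j == i]eq_sym; case: (i == j); rewrite ?mulr1n ?mulr0n ?conjC0.
    have -> : 0 +i* (2 * eta) = (tau +i* eta) - Num.conj (tau +i* eta) :> C.
      by apply/eqP; rewrite eq_complex /=; apply/andP; split; apply/eqP; ring.
    by ring.
  by ring.
apply: (@mxle_le _ _ _ (2 * eta + cS * E01 (fun y => 2 * ImTr M y))).
  by rewrite [leRHS]mulrDl lerD2l -mulrA ler_wpM2l // E01Z // -mulrA ler_wpM2l.
apply: mxleD; last exact: SB.
apply: mxle_le (@mxle_scalar _ K _).
by rewrite (le_trans (cabs_le_ReIm _)) //= normr0 add0r ger0_norm // mulr_ge0 // ltW.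
Qed.

Lemma mxle_adj n (A : 'M[C]_n) c : mxle A c -> mxle (A^t*) c.
Proof. by move=> Ac i j; rewrite adj_mxE cabsJ. Qed.

(** det G - conj (det G) = det G - det G^* is O(eta) by [Gf_skew] and [det_bound], whereas
|det G| = 1 / |det M| is bounded below. *)
Lemma gap_sin (tau c0 : R) : 0 <= c0 -> exists2 B, 0 <= B & forall eta M, 0 < eta <= 1 ->
  sol md (tau +i* eta) M -> E01 (ImTr M) <= c0 * eta ->
  forall x, 0 <= x <= 1 -> `|sin (argdet (Gf md (tau +i* eta) M x))| <= B * eta.
Proof.
move=> c00; have [b b1 hb] := Gf_uniform tau c00; have [m m1 hm] := gap_bound tau c00.
have [s s0 hs] := Gf_skew tau c00.
have [cm cm0 dm] := @det_bound R K m m1; have [cb cb0 db] := @det_bound R K b b1.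
exists (cm * (cb * s)); first by rewrite !mulr_ge0 // ltW.
move=> eta M e01 sM Ec x x01; have /andP[e0 _] := e01.
have [p iM dM] := sM; have [gB _] := hb eta M e01 sM Ec.
have MB := hm eta M e01 sM Ec x x01; have GB := gB x x01.
have GS := hs eta M e0 sM Ec x x01.
set G := Gf md _ M x in GB GS *.
have [r r0 rE] := argdet_polar e0 (iM x x01); rewrite -/G in rE.
have rabs : cabs (\det G) = r.
  apply/eqP; rewrite -(eqrXn2 (ltn0Sn 1) (cabs_ge0 _) (ltW r0)).
  by rewrite cabs_sqr rE /= !exprMn -mulrDr cos2Dsin2 mulr1.
have dd : cabs (\det (M x)) * r = 1.
  rewrite -rabs -cabsM -det_mulmx dM // -scaleN1r detZ det1 mulr1.
  by elim: (K) => [|n IH]; rewrite ?expr0 ?cabs1 // exprS cabsM cabsN cabs1 mul1r.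
have [_ /(_ _ _ (mulr_ge0 s0 (ltW e0)) (mxle_adj GB) GS)] := db G GB.
rewrite det_adj => hd.
have [dM1 _] := dm (M x) MB.
have im : 2 * (r * `|sin (argdet G)|) <= cb * (s * eta).
  apply: le_trans hd; apply: le_trans (le_Im_cabs _); rewrite ImB Im_conj opprK rE /=.
  have -> : r * sin (argdet G) + r * sin (argdet G) = 2 * (r * sin (argdet G)) by ring.
  by rewrite !normrM (ger0_norm (ltW r0)) (@ger0_norm _ 2).
have r1 : 1 <= cm * r by rewrite -dd ler_wpM2r // ltW.
have S0 := normr_ge0 (sin (argdet G)).
have : `|sin (argdet G)| <= cm * (r * `|sin (argdet G)|) by rewrite mulrA ler_peMl.
move=> /le_trans; apply; rewrite -!mulrA ler_wpM2l ?(ltW cm0) // (le_trans _ im) //.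
by rewrite ler_peMl ?ler1n // mulr_ge0 // ltW.
Qed.

(** M S[M] = M (G - z + a) = - 1 - z M + M a, so only Im tr M, eta M and Im tr (M a) contribute
to the imaginary part of the trace; the last one is, up to a factor,
the trace of a times the skew part of M. *)
Lemma gap_quad (tau c0 : R) : 0 <= c0 -> exists2 B, 0 <= B & forall eta M, 0 < eta <= 1 ->
  sol md (tau +i* eta) M -> E01 (ImTr M) <= c0 * eta -> `|Quad md M| <= B * eta.
Proof.
move=> c00; have [m m1 hm] := gap_bound tau c00; have m0 : 0 <= m by rewrite (le_trans _ m1).
have [Na Na0 aN] := mxle_bound md (md_pwh md).
pose K1 : R := K%:R; have K0 : 0 <= K1 by [].
pose q := `|tau| + K1 * (K1 * (2 * Na)).
have q0 : 0 <= q by rewrite addr_ge0 // !mulr_ge0 // ltW.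
exists (q * c0 + K1 * m); first by rewrite addr_ge0 // mulr_ge0.
move=> eta M e01 sM Ec; have /andP[e0 _] := e01; have [p iM dM] := sM.
have bT := bm_ImTr p.
have bMS : cbm (fun x => \tr (M x *m SE md M x)).
  by apply: (pwh_cbm HI); apply: mpwh_tr; apply: (mpwhM md) => //; exact: (mpwh_SE' md).
have main x : 0 <= x <= 1 -> `|complex.Im (\tr (M x *m SE md M x))| <= q * ImTr M x + K1 * m * eta.
  move=> x01; have MB := hm eta M e01 sM Ec x x01.
  have T0 : 0 <= ImTr M x.
    by rewrite /ImTr /mxtrace Im_sum sumr_ge0 // => k _; exact: Im_diag_ge0 sM e0 x01.
  have -> : M x *m SE md M x = - 1%:M - (tau +i* eta) *: M x + M x *m a x.
    rewrite -(dM x x01) /Gf mulmxDr mulmxBr mul_mx_scalar.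
    by apply/matrixP => i j; rewrite !mxE; ring.
  have tMa : `|complex.Im (\tr (M x *m a x))| <= K1 * (K1 * (2 * Na)) * ImTr M x.
    have tN : \tr (M x *m a x) - Num.conj (\tr (M x *m a x)) = \tr ((M x - (M x)^t*) *m a x).
      have -> : Num.conj (\tr (M x *m a x)) = \tr ((M x *m a x)^t*).
        by rewrite /mxtrace rmorph_sum; apply: eq_bigr => i _; rewrite adj_mxE.
      by rewrite adjmxM (md_herm md x01) mulmxBl raddfB /= [X in _ - X]mxtrace_mulC.
    have tN' : cabs (\tr ((M x - (M x)^t*) *m a x)) <= K1 * (K1 * (2 * ImTr M x * Na)).
      apply: cabs_tr; apply: mxle_mul; [by rewrite mulr_ge0|exact: sol_skew sM e0 x01|exact: aN].
    have -> : K1 * (K1 * (2 * Na)) * ImTr M x = K1 * (K1 * (2 * ImTr M x * Na)) by ring.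
    apply: le_trans tN'; rewrite -tN; apply: le_trans (le_Im_cabs _).
    rewrite ImB Im_conj opprK -mulr2n -mulr_natl normrM ger0_norm //.
    by rewrite ler_peMl // ler1n.
  have tR : `|complex.Re (\tr (M x))| <= K1 * m.
    by rewrite (le_trans (le_Re_cabs _)) //; exact: cabs_tr.
  have -> : complex.Im (\tr (- 1%:M - (tau +i* eta) *: M x + M x *m a x)) =
     complex.Im (\tr (M x *m a x)) - tau * ImTr M x - eta * complex.Re (\tr (M x)).
    rewrite raddfD raddfB /= raddfN /= mxtrace1 mxtraceZ ImD ImB ImN ImM /= /ImTr.
    have -> : complex.Im (K%:R : C) = 0 by elim: (K) => [|n IH] //; rewrite -natr1 ImD IH addr0.
    by ring.
  rewrite (le_trans (ler_normB _ _)) // lerD //.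
    rewrite (le_trans (ler_normB _ _)) // /q mulrDl addrC lerD // normrM.
    by rewrite (ger0_norm T0).
  by rewrite normrM (ger0_norm (ltW e0)) mulrC ler_wpM2r // ltW.
have bq : bmU (fun x => q * ImTr M x + K1 * m * eta).
  by apply: bmfD; [exact: bmfZ|exact: bmf_cst].
have [_ bi] := bMS.
have := E01_norm_le bi bq main; rewrite -Im_cI.
rewrite (E01D (bmfZ q bT) (bmf_cst _ _)) E01_cst E01Z // => h.
rewrite /Quad normrM (@ger0_norm _ 2^-1) ?invr_ge0 //.
have h2 : q * E01 (ImTr M) + K1 * m * eta <= (q * c0 + K1 * m) * eta.
  by rewrite [leRHS]mulrDl lerD2r -mulrA ler_wpM2l.
have := le_trans h h2; have := normr_ge0 (complex.Im (cI (fun x => \tr (M x *m SE md M x)))).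
by lra.
Qed.
End GapEstimate.

(** * The mass to the left of a point outside the support *)

Section NearMultiples.
Context {R : realType}.

Lemma abs_sin_shift (y : R) k : `|sin (y + k%:R * pi)| = `|sin y|.
Proof.
elim: k => [|k IH]; first by rewrite mul0r addr0.
by rewrite -natr1 mulrDl mul1r addrA sinDpi normrN.
Qed.

(** The sine is increasing on [- pi/2, pi/2]. *)
Lemma abs_sin_le (y e : R) : 0 <= e <= pi / 2 -> `|y| <= pi / 2 -> `|sin y| <= sin e -> `|y| <= e.
Proof.
move=> /andP[e0 e1] yp sy.
have p0 : 0 < pi / 2 :> R by rewrite divr_gt0 // pi_gt0.
have mem (t : R) : 0 <= t -> t <= pi / 2 -> t \in `[(- (pi / 2)), pi / 2].
  by move=> t0 t1; rewrite in_itv /= t1 andbT (le_trans _ t0) // oppr_le0 ltW.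
have sabs : sin `|y| <= sin e.
  apply: le_trans sy; have [y0|y0] := leP 0 y.
    by rewrite (ger0_norm y0); exact: ler_norm.
  by rewrite (ltr0_norm y0) sinN -[leRHS]normrN; exact: ler_norm.
by rewrite leNgt -(ltr_sin (mem _ e0 e1) (mem _ (normr_ge0 y) yp)) -leNgt.
Qed.

Lemma near_multiple (K : nat) (t e : R) : 0 <= e < pi / 2 -> 0 <= t <= K%:R * pi ->
  `|sin t| <= sin e -> exists2 k : nat, (k <= K)%N & `|t - k%:R * pi| <= e.
Proof.
move=> /andP[e0 e1] /andP[t0 t1] st.
have p0 : 0 < pi :> R by exact: pi_gt0.
have tp : 0 <= t / pi + 1 / 2 by rewrite addr_ge0 ?divr_ge0 // ltW.
have /andP[k1 k2] := truncn_itv tp.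
pose k := Num.truncn (t / pi + 1 / 2).
have tk : t = t / pi * pi by rewrite divfK ?gt_eqF.
move: (t / pi) tk tp k1 k2 @k => q tk tp k1 k2 k.
have k3 : k%:R <= q + 1 / 2 by [].
have k4 : q + 1 / 2 < k%:R + 1 by rewrite natr1.
exists k.
  have qK : q <= K%:R by rewrite -(ler_pM2r p0) -tk.
  have : k%:R < (K.+1)%:R :> R by rewrite -natr1; lra.
  by rewrite ltr_nat ltnS.
have near : `|t - k%:R * pi| <= pi / 2.
  by rewrite ler_norml tk; apply/andP; split; nra.
apply: abs_sin_le => //; first by rewrite e0 ltW.
by rewrite -(abs_sin_shift _ k) subrK.
Qed.

(** The nearest multiple is constant along an interval: to pass from one to another the function
would have to take the value of a half-integer multiple of pi, where |sin| = 1. *)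
Lemma near_multiple_itv (K : nat) (f : R -> R) (A : set R) (e : R) : is_interval A ->
  {within A, continuous f} -> A !=set0 -> 0 <= e < pi / 2 ->
  (forall x, A x -> 0 <= f x <= K%:R * pi) -> (forall x, A x -> `|sin (f x)| <= sin e) ->
  exists2 k : nat, (k <= K)%N & forall x, A x -> `|f x - k%:R * pi| <= e.
Proof.
move=> iA cf [x0 Ax0] /[dup] e01 /andP[e0 e1] fb fs.
have [k kK kx0] := near_multiple e01 (fb _ Ax0) (fs _ Ax0).
exists k => // x Ax; have [k' k'K k'x] := near_multiple e01 (fb _ Ax) (fs _ Ax).
suff : k = k' by move=> ->.
have p0 : 0 < pi :> R by exact: pi_gt0.
have s1 : sin e < 1.
  by rewrite -sin_pihalf ltr_sin // in_itv /= ?lexx ?andbT ?(ltW e1); lra.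
(* v is the first odd multiple of pi/2 above the multiple p pi. *)
have cross a b p q : A a -> A b -> `|f a - p%:R * pi| <= e -> `|f b - q%:R * pi| <= e ->
    (p < q)%N -> False.
  move=> Aa Ab fa fb' pq.
  have pq' : p%:R + 1 <= q%:R :> R by rewrite natr1 ler_nat.
  pose v : R := pi / 2 + p%:R * pi.
  have pqpi : p%:R * pi + pi <= q%:R * pi :> R by rewrite -[X in _ + X]mul1r -mulrDl ler_pM2r.
  move: fa fb'; rewrite !ler_norml => /andP[fa1 fa2] /andP[fb1 fb2].
  have av : f a <= v by rewrite /v; lra.
  have vb : v <= f b by rewrite /v; lra.
  have [c Ac fc] : exists2 c, A c & f c = v.
    have [ab|ba] := leP a b.
      have sub : `[a, b]%classic `<=` A.
        by move=> c; rewrite /= in_itv /= => cab; exact: (iA a b).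
      have [|c cab fc] := @IVT R f a b v ab (continuous_subspaceW sub cf).
        by rewrite ge_min av /= le_max vb orbT.
      by exists c => //; apply: sub.
    have sub : `[b, a]%classic `<=` A.
      by move=> c; rewrite /= in_itv /= => cab; exact: (iA b a).
    have [|c cab fc] := @IVT R f b a v (ltW ba) (continuous_subspaceW sub cf).
      by rewrite ge_min av orbT /= le_max vb.
    by exists c => //; apply: sub.
  have := fs c Ac; rewrite fc abs_sin_shift sin_pihalf normr1; lra.
case: (ltngtP k k') => // kk'; exfalso.
- exact: cross kx0 k'x kk'.
- exact: cross k'x kx0 kk'.
Qed.

(** A finite family of positive numbers has a positive minimum. *)
Lemma finite_approx (T : finType) (f : T -> R) (c : R) : 0 <= c ->
  (forall e, 0 < e -> exists t, f t <= c * e) -> exists t, f t <= 0.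
Proof.
move=> c0 h; apply: contrapT => hn.
have f0 t : 0 < f t by rewrite ltNge; apply/negP => ft; apply: hn; exists t.
pose D := 1 + \sum_t (f t)^-1.
have D0 : 0 < D by rewrite ltr_pwDl // sumr_ge0 // => t _; rewrite invr_ge0 ltW.
have e0 : 0 < ((c + 1) * D)^-1 by rewrite invr_gt0 mulr_gt0 // ltr_wpDl.
have [t ft] := h _ e0.
have : (f t)^-1 < D.
  rewrite /D (bigD1 t) //= addrCA ltrDl ltr_pwDl // sumr_ge0 // => s _.
  by rewrite invr_ge0 ltW.
rewrite -ltf_pV2 ?posrE ?invr_gt0 // invrK ltNge => /negP; apply.
apply: (le_trans ft); rewrite invfM mulrA ler_piMl ?invr_ge0 ?(ltW D0) //.
by rewrite ler_pdivrMr ?ltr_wpDl // mul1r lerDl.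
Qed.
End NearMultiples.

Section GapMass.
Context {R : realType} (L : nat) (I : 'I_L -> set R) (K : nat) (md : model I K).
Context (rho : probability (measurableTypeR R) R) (tau : R).
Notation C := R[i].
Local Notation HI := (md_part md).
Hypothesis K0 : (0 < K)%N.
Hypothesis hsol : forall eta, 0 < eta -> exists2 M, sol md (tau +i* eta) M &
  cI (fun x => \tr (M x)) = K%:R * stieltjes rho (tau +i* eta).

Lemma Re_natr n : complex.Re (n%:R : C) = n%:R.
Proof. by elim: n => [|n IH] //; rewrite -natr1 ReD IH natr1. Qed.
Lemma Im_natr n : complex.Im (n%:R : C) = 0.
Proof. by elim: n => [|n IH] //; rewrite -natr1 ImD IH addr0. Qed.

Lemma diff_le0 (p q w c s : R) : `|p - q + (s - s) * w| <= c * (s - s) ^+ 2 -> p = q.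
Proof. by rewrite subrr mul0r addr0 expr0n mulr0 normr_le0 subr_eq0 => /eqP. Qed.

Lemma potential_dist (p q la lb w k d A B : R) : 0 <= k -> `|p - q + d * (k * w)| <= A ->
  `|la - lb + d * w| <= B -> `|(p - k * la) - (q - k * lb)| <= A + k * B.
Proof.
move=> k0 hA hB.
have -> : (p - k * la) - (q - k * lb) = (p - q + d * (k * w)) - k * (la - lb + d * w) by ring.
by rewrite (le_trans (ler_normB _ _)) // lerD // normrM ger0_norm // ler_wpM2l.
Qed.

(** The difference of the two sides varies by O((s - t)^2) according to [potential_step] and
[logpot_step], so it is constant by [sq_const]; it tends to 0 at infinity. *)
Lemma potential_identity eta M : 0 < eta -> sol md (tau +i* eta) M ->
  Theta md (tau +i* eta) M + Quad md M = K%:R * logpot rho tau eta.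
Proof.
move=> e0 sM.
have /choice[Mf hM] : forall s, exists M, 0 < s -> sol md (tau +i* s) M /\
  cI (fun x => \tr (M x)) = K%:R * stieltjes rho (tau +i* s).
  move=> s; have [s0|s0] := ltP 0 s; last by exists (fun=> 0).
  by have [N sN tN] := hsol s0; exists N.
pose P s := Theta md (tau +i* s) (Mf s) + Quad md (Mf s).
have -> : Theta md (tau +i* eta) M + Quad md M = P eta.
  have [c c0 /(_ eta eta M (Mf eta))] := potential_step md tau eta e0.
  rewrite lexx; have [sf _] := hM eta e0 => /(_ isT isT sM sf); exact: diff_le0.
pose F s := P s - K%:R * logpot rho tau s.
have Fc s t : 0 < s -> s <= t -> F s = F t.
  move=> s0 st; have [c c0 hc] := potential_step md tau t s0.
  apply: (@sq_const _ F s t (c + K%:R / s ^+ 2)) => //.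
    by rewrite addr_ge0 // divr_ge0 // exprn_ge0 // ltW.
  move=> u v us vs; have u0 : s <= u by case/andP: us.
  have v0 : s <= v by case/andP: vs.
  have [su _] := hM u (lt_le_trans s0 u0); have [sv tv] := hM v (lt_le_trans s0 v0).
  have h1 := hc u v _ _ us vs su sv.
  have h2 := logpot_step rho tau s0 u0 v0.
  rewrite tv ReM Re_natr Im_natr mul0r subr0 in h1.
  have h3 := potential_dist (ler0n R K) h1 h2.
  apply: (le_trans h3); rewrite le_eqVlt; apply/orP; left; apply/eqP.
  by rewrite [RHS]mulrDl [_ * _ ^+ 2 in X in _ = _ + X]mulrAC -mulrA.
suff F0 : F eta = 0 by apply/eqP; rewrite -subr_eq0 -/(F eta) F0.
apply/eqP; rewrite -normr_le0; apply/ler_addgt0Pr => e ep; rewrite add0r.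
have [c c0 hc] := potential_large md tau.
have K1 : 0 < K%:R + 1 :> R by rewrite ltr_wpDl.
have /cvgrPdist_lt/(_ (e / (K%:R + 1) / 2))[|n _ hn] := logpot_infty rho tau.
  by rewrite !divr_gt0.
pose m := (n + Num.truncn (eta + c + c * 2 / e)).+1.
have mb : eta + c + c * 2 / e < m%:R.
  apply: (lt_le_trans (truncnS_gt _)); by rewrite ler_nat /m ltnS leq_addl.
have ce : 0 <= c * 2 / e by rewrite divr_ge0 ?mulr_ge0 // ltW.
have m0 : 0 < m%:R :> R by rewrite ltr0n.
have [sm _] := hM m%:R m0.
have h1 := hc m%:R (Mf m%:R).
rewrite ler1n (_ : c <= m%:R) in h1; last by lra.
have {}h1 := h1 isT isT sm; rewrite -/(P _) in h1.
have h2 := hn m.-1 (leq_addr _ _); rewrite prednK // in h2.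
rewrite (Fc eta m%:R) //; last by lra.
have -> : F m%:R = (P m%:R - K%:R * (pi / 2)) + K%:R * (pi / 2 - logpot rho tau m%:R).
  by rewrite /F; ring.
rewrite (le_trans (ler_normD _ _)) // [e]splitr lerD //.
  apply: (le_trans h1); rewrite ler_pdivrMr // mulrC -ler_pdivrMr ?divr_gt0 //.
  by rewrite invf_div mulrA; lra.
rewrite normrM ger0_norm // (le_trans (ler_wpM2l _ (ltW h2))) //.
have -> : K%:R * (e / (K%:R + 1) / 2) = (K%:R / (K%:R + 1)) * (e / 2) by field; rewrite gt_eqF.
by rewrite ler_piMl ?divr_ge0 ?(ltW ep) // ler_pdivrMr // mul1r lerDl.
Qed.

Lemma gap_ball : ~ msupport rho tau -> exists2 delta : R, 0 < delta &
  rho `]tau - delta, tau + delta[%classic = 0%E.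
Proof.
move=> ns; have [U [oU Ut rU]] : exists U : set R, [/\ open U, U tau & rho U = 0%E].
  apply: contrapT => h; apply: ns => U oU Ut; rewrite lt_def measure_ge0 andbT.
  by apply/eqP => rU; apply: h; exists U.
have /nbhs_ballP[delta d0 hd] := open_nbhs_nbhs (conj oU Ut).
exists delta => //; apply/eqP; rewrite eq_le measure_ge0 andbT -rU.
apply: le_measure; rewrite ?inE.
- exact: measurable_itv.
- exact: open_measurable.
- by rewrite -ball_itv.
Qed.

(** The Poisson kernel is at most eta / delta^2 outside the gap, and the gap carries no mass. *)
Lemma Im_stieltjes_gap delta eta : 0 < delta -> 0 < eta ->
  rho `]tau - delta, tau + delta[%classic = 0%E ->
  complex.Im (stieltjes rho (tau +i* eta)) <= eta / delta ^+ 2.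
Proof.
move=> d0 e0 rb; rewrite Im_stieltjes.
pose N : set (measurableTypeR R) := `]tau - delta, tau + delta[%classic.
have mN : measurable N by exact: measurable_itv.
have [_ bp] := bm_poisson tau e0.
have bN : @bmf _ (measurableTypeR R) R setT (\1_N : R -> R).
  split; first exact: measurable_indic.
  by exists 1 => x _; rewrite indicE; case: (_ \in _); rewrite ?normr1 ?normr0.
have IN : RI rho (\1_N : R -> R) = 0.
  have -> : RI rho (\1_N : R -> R) = fine (rho N).
    by rewrite /RI /Rintegral integral_indic // setIT.
  exact: (congr1 fine rb).
have b1 : @bmf _ (measurableTypeR R) R setT (fun=> eta / delta ^+ 2).
  by split; [exact: measurable_cst|exists `|eta / delta ^+ 2|].
have -> : eta / delta ^+ 2 = RI rho (fun t => eta / delta ^+ 2 + eta^-1 * (\1_N t : R)).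
  rewrite (RID rho b1 (bmfZ _ bN)) RI_cst RIZ // IN mulr0 addr0 //.
apply: (RI_le rho bp (bmfD b1 (bmfZ _ bN))) => t.
have [tN|tN] := boolP (t \in N).
  rewrite indicE tN mulr1 (le_trans (y := eta^-1)) //; last first.
    by rewrite lerDr divr_ge0 ?exprn_ge0 ?(ltW e0) ?(ltW d0).
  rewrite ler_pdivrMr ?ltr_wpDl ?sqr_ge0 ?exprn_gt0 // mulrDr expr2 [eta ^+ 2]expr2.
  by rewrite mulKf ?gt_eqF // lerDr -expr2; apply: mulr_ge0; [rewrite invr_ge0 ltW|exact: sqr_ge0].
rewrite indicE (negbTE tN) mulr0 addr0 ler_pM2l // lef_pV2 ?posrE ?exprn_gt0 ?ltr_wpDl ?sqr_ge0 ?exprn_gt0 //.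
have : delta <= `|tau - t|.
  rewrite leNgt; apply/negP => h; move/negP: tN; apply; rewrite inE /N /= in_itv /=.
  by move: h; rewrite ltr_norml => /andP[h1 h2]; apply/andP; split; lra.
move=> h; have : delta ^+ 2 <= (tau - t) ^+ 2.
  by rewrite -[(tau - t) ^+ 2]real_normK ?num_real // ler_sqr ?nnegrE ?(ltW d0).
by move=> /le_trans; apply; rewrite lerDl sqr_ge0.
Qed.

Lemma E01_indic_part l : E01 (\1_(I l) : R -> R) = fine (leb R (I l)).
Proof.
rewrite E01_indic; last exact: (part_meas HI).
congr (fine (leb R _)); apply/seteqP; split=> x /=; first by case.
by move=> lx; split=> //; rewrite in_itv /=; exact: (part_sub HI lx).
Qed.

Lemma bm_indic_part l : bmU (\1_(I l) : R -> R).
Proof.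
split; first by apply: measurable_indic; exact: (part_meas HI).
by exists 1 => x _; rewrite indicE; case: (_ \in _); rewrite ?normr1 ?normr0.
Qed.

Lemma sum_part (c : 'I_L -> R) l x : I l x -> \sum_k c k * (\1_(I k) x : R) = c l.
Proof.
move=> lx; rewrite (bigD1 l) //= indicE mem_set // mulr1 big1 ?addr0 // => k kl.
rewrite indicE memNset ?mulr0 // => kx.
by rewrite (part_inj HI kx lx) eqxx in kl.
Qed.

Lemma E01_step (c : 'I_L -> R) :
  E01 (fun x => \sum_l c l * (\1_(I l) x : R)) = \sum_l c l * fine (leb R (I l)).
Proof.
rewrite E01_sum => [|l]; last by apply: bmfZ; exact: bm_indic_part.
by apply: eq_bigr => l _; rewrite E01Z ?E01_indic_part //; exact: bm_indic_part.
Qed.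

Lemma sum_leb : \sum_l fine (leb R (I l)) = 1.
Proof.
have := E01_step (fun=> 1); under [X in _ = X]eq_bigr do rewrite mul1r.
move=> <-; rewrite -[RHS](E01_cst 1); apply: E01_eq => x x01.
by have [l lx] := part_cover HI x01; rewrite (sum_part _ lx).
Qed.

(** [potential_identity] at a small eta: [Quad] is small, and [argdet] is close to k_l pi on I_l. *)
Lemma gap_mass_approx : ~ msupport rho tau -> forall e, 0 < e ->
  exists k : {ffun 'I_L -> 'I_K.+1},
   `|K%:R * (pi * (1 - fine (rho `]-oo, tau[%classic))) -
      \sum_l (k l)%:R * pi * fine (leb R (I l))| <= (K%:R + 2) * e.
Proof.
move=> ns e ep; have [delta d0 rb] := gap_ball ns.
have rt : rho [set tau] = 0%E.
  apply/eqP; rewrite eq_le measure_ge0 andbT -rb; apply: le_measure; rewrite ?inE.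
  - exact: measurable_set1.
  - exact: measurable_itv.
  - by move=> x /= ->; rewrite in_itv /=; apply/andP; split; lra.
have p0 : 0 < pi :> R by exact: pi_gt0.
(* pi/4 is an arbitrary bound below pi/2, where the sine is still increasing. *)
pose e' := Num.min e (pi / 4).
have e'0 : 0 < e' by rewrite lt_min ep divr_gt0.
have e'e : e' <= e by rewrite ge_min lexx.
have e'p : 0 <= e' < pi / 2 by rewrite (ltW e'0) /= (le_lt_trans (y := pi / 4)) ?ge_min ?lexx ?orbT //; lra.
have se : 0 < sin e' by apply: sin_gt0_pi; rewrite e'0 /=; case/andP: e'p => _; lra.
pose c0 := K%:R / delta ^+ 2.
have c00 : 0 <= c0 by rewrite divr_ge0 // exprn_ge0 // ltW.
have [B1 B10 hB1] := gap_sin md tau c00; have [B2 B20 hB2] := gap_quad md tau c00.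
have /cvgrPdist_lt/(_ e ep)[n _ hn] := logpot_zero rt.
(* eta = 1/m has to be small enough for the sine, for Quad and for the limit eta -> 0. *)
pose m := (n + Num.truncn (B1 / sin e' + B2 / e)).+1.
have m0 : 0 < m%:R :> R by rewrite ltr0n.
have mb : B1 / sin e' + B2 / e < m%:R.
  apply: (lt_le_trans (truncnS_gt _)); by rewrite ler_nat /m ltnS leq_addl.
have hm := hn m.-1 (leq_addr _ _); rewrite prednK // in hm.
pose eta : R := m%:R^-1.
have eta0 : 0 < eta by rewrite invr_gt0.
have eta1 : eta <= 1 by rewrite invf_le1 // ler1n.
have eta01 : 0 < eta <= 1 by rewrite eta0.
have [M sM tM] := hsol eta0; have [pM iM dM] := sM.
have Ec : E01 (ImTr M) <= c0 * eta.
  rewrite /ImTr -Im_cI tM ImM Re_natr Im_natr mul0r addr0 /c0 mulrAC -mulrA ler_wpM2l //.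
  exact: Im_stieltjes_gap.
have r1 : 0 <= B1 / sin e' by rewrite divr_ge0 // ltW.
have r2 : 0 <= B2 / e by rewrite divr_ge0 // ltW.
have hs x : 0 <= x <= 1 -> `|sin (argdet (Gf md (tau +i* eta) M x))| <= sin e'.
  move=> x01; rewrite (le_trans (hB1 _ _ eta01 sM Ec _ x01)) //.
  by rewrite /eta ler_pdivrMr // mulrC -ler_pdivrMr // ltW // (le_lt_trans _ mb) // lerDl.
have hq : `|Quad md M| <= e.
  rewrite (le_trans (hB2 _ _ eta01 sM Ec)) //.
  by rewrite /eta ler_pdivrMr // mulrC -ler_pdivrMr // ltW // (le_lt_trans _ mb) // lerDr.
have pth : pwr I (fun x => argdet (Gf md (tau +i* eta) M x)).
  by apply: (pwr_argdet md eta0) => //; exact: mpwh_Gf.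
have hk l : exists k : 'I_K.+1, forall x, I l x ->
    `|argdet (Gf md (tau +i* eta) M x) - k%:R * pi| <= e'.
  have [_ iI _] := HI; have [c cc0 hc] := pth.
  have [||k kK hk] := @near_multiple_itv R K _ _ e' (iI l) (holder_within cc0 (hc l)) (part_ne HI l) e'p.
  - by move=> x _; exact: argdet_bounds.
  - by move=> x lx; apply: hs; exact: (part_sub HI lx).
  by have kK' : (k < K.+1)%N by []; exists (Ordinal kK').
have /choice[k hk'] := hk; exists [ffun l => k l].
have -> : \sum_l ([ffun l => k l] l)%:R * pi * fine (leb R (I l)) =
    E01 (fun x => \sum_l (k l)%:R * pi * (\1_(I l) x : R)).
  by rewrite E01_step; apply: eq_bigr => l _; rewrite ffunE.
set S := E01 _; pose T := Theta md (tau +i* eta) M.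
have TS : `|T - S| <= e.
  have bth := pwr_bmf HI pth.
  have bS : bmU (fun x => \sum_l (k l)%:R * pi * (\1_(I l) x : R)).
    by apply: bmf_sum => l; apply: bmfZ; exact: bm_indic_part.
  rewrite /T /S /Theta -E01B //; apply: E01_norm; first exact: bmfB.
  move=> x x01; have [l lx] := part_cover HI x01.
  by rewrite (sum_part (fun l => (k l)%:R * pi) lx) (le_trans (hk' l x lx)).
have pid := potential_identity eta0 sM; rewrite -/T in pid.
set X := pi * _ in hm *.
have -> : K%:R * X - S = K%:R * (X - logpot rho tau eta) + (T - S) + Quad md M.
  by rewrite mulrBr -pid; ring.
rewrite (le_trans (ler_normD _ _)) //.
have -> : (K%:R + 2) * e = K%:R * e + e + e by ring.
rewrite lerD // (le_trans (ler_normD _ _)) // lerD // normrM ger0_norm // ler_wpM2l // ltW //.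
Qed.

(** The integers k_l of [gap_mass_approx] depend on the precision, but there are finitely many
choices, so one of them is exact. It describes the mass to the right of tau; replacing k_l by
K - k_l and using that the lengths add up to 1 gives the mass to the left. *)
Lemma gap_mass : ~ msupport rho tau ->
  exists2 k : 'I_L -> nat, (forall l, (k l <= K)%N) &
    fine (rho `]-oo, tau[%classic) = K%:R^-1 * \sum_l (k l)%:R * fine (leb R (I l)).
Proof.
move=> ns; have K2 : 0 <= K%:R + 2 :> R by rewrite addr_ge0.
have [k hk] := finite_approx K2 (gap_mass_approx ns).
move: hk; rewrite normr_le0 subr_eq0 => /eqP hk.
exists (fun l => (K - k l)%N) => [l|]; first exact: leq_subr.
have KR : 0 < K%:R :> R by rewrite ltr0n.
have p0 : 0 < pi :> R by exact: pi_gt0.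
set r := fine _ in hk *.
have e : K%:R * (1 - r) = \sum_l (k l)%:R * fine (leb R (I l)).
  apply: (mulfI (lt0r_neq0 p0)); rewrite mulr_sumr.
  by rewrite mulrCA hk; apply: eq_bigr => l _; rewrite mulrCA mulrA.
have -> : \sum_l (K - k l)%:R * fine (leb R (I l)) = K%:R * r.
  rewrite (eq_bigr (fun l => K%:R * fine (leb R (I l)) - (k l)%:R * fine (leb R (I l)))).
    by rewrite sumrB -mulr_sumr sum_leb -e; ring.
  by move=> l _; rewrite natrB ?mulrBl // -ltnS.
by rewrite mulKf // gt_eqF.
Qed.
End GapMass.

(** * From the data to pointwise solutions *)

(* The integrals have to be compared with those of the data. *)
Transparent E01 cI.

Section CleanUp.
Context {R : realType}.
Notation C := R[i].
Local Notation U := (`[0 : R, 1]%classic).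

Definition cmeas (f : R -> C) :=
  measurable_fun U (fun x => complex.Re (f x)) /\ measurable_fun U (fun x => complex.Im (f x)).

(** Explicit exceptional sets, so that finitely many almost-everywhere statements can be
combined into one set off which functions are redefined. *)
Definition null (N : set (measurableTypeR R)) := measurable N /\ leb R N = 0%E.

Lemma ae_null (P : R -> Prop) : (\forall x \ae leb R, P x) <-> exists2 N, null N & forall x, ~ N x -> P x.
Proof.
split=> [[N [mN N0 sub]]|[N [mN N0] h]].
  by exists N => // x nx; apply: contrapT => px; apply: nx; exact: sub.
by exists N; split=> // x /= px; apply: contrapT => nx; apply: px; exact: h.
Qed.

Lemma cI_null f g N : cmeas f -> cmeas g -> null N ->
  (forall x, 0 <= x <= 1 -> ~ N x -> f x = g x) -> cI f = cI g.
Proof.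
move=> [fr fi] [gr gi] nN fg; apply: eqC; rewrite ?Re_cI ?Im_cI; apply: E01_ae => //;
  by apply/ae_null; exists N => // x nx x01; rewrite fg.
Qed.

Lemma cmeas_kern (k : R -> R) f : measurable_fun U k -> cmeas f -> cmeas (fun y => (k y)%:C * f y).
Proof.
move=> mk [fr fi]; split.
  by apply: (eq_measurable_fun (fun y => k y * complex.Re (f y))); [move=> y _; rewrite ReMc|exact: measurable_funM].
by apply: (eq_measurable_fun (fun y => k y * complex.Im (f y))); [move=> y _; rewrite ImMc|exact: measurable_funM].
Qed.

(** The form of the skew part of A, divided by i, is the imaginary part of the form of A. *)
Lemma psd_im n (A : 'M[C]_n) (e : R) v : 0 < e -> mx_psd (mx_im A - (e%:C)%:M) ->
  0 <= complex.Im (dot v (A *m v)).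
Proof.
move=> e0 /(_ v); set w := dot v (A *m v).
have ww : Num.conj w = dot v (A^t* *m v) by rewrite dot_conj dot_adjl.
have -> : (v ^t* *m (mx_im A - (e%:C)%:M) *m v) 0 0 = (complex.Im w)%:C - e%:C * (nsq v)%:C.
  rewrite -mulmxA mulmxBl -[LHS]/(dot v _) dotDr dotNr mul_scalar_mx dotZr dot_self.
  congr (_ - _); rewrite /mx_im -scalemxAl dotZr mulmxBl dotDr dotNr -ww -/w.
  have -> : w - Num.conj w = (2%:R * 'i) * (complex.Im w)%:C.
    apply/eqP; rewrite eq_complex; apply/andP; split; apply/eqP;
    by case: (w) => p q /=; ring.
  rewrite mulKf // mulf_neq0 ?pnatr_eq0 //.
  by apply/eqP => /(congr1 (@complex.Im R)) /= /eqP; rewrite oner_eq0.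
rewrite lecE /= => /andP[_].
rewrite !(mul0r, mulr0, subr0, addr0) subr_ge0; apply: le_trans.
by rewrite mulr_ge0 ?nsq_ge0 // ltW.
Qed.
End CleanUp.

Section Model.
Context {R : realType} (K L l1 l2 : nat) (I : 'I_L -> set R) (d : kronecker_data R K l1 l2).
Notation C := R[i].
Hypotheses (HI : interval_partition I) (HP : piecewise_hoelder I d).

Lemma hoelder_kern (s : R * R -> R) : (forall l k, hoelder_on 2^-1 (I l `*` I k) s) ->
  exists H, kern I (fun x y => s (x, y)) H.
Proof.
move=> hs; have /choice[c hc] : forall q : 'I_L * 'I_L, exists c, forall x y x' y',
    I q.1 x -> I q.2 y -> I q.1 x' -> I q.2 y' ->
    `|s (x, y) - s (x', y')| <= c * Num.sqrt (Num.max `|x - x'| `|y - y'|).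
  move=> q; have [c hc] := hs q.1 q.2; exists c => x y x' y' lx ly lx' ly'.
  have := hc (x, y) (x', y') (conj lx ly) (conj lx' ly').
  by rewrite powR12_sqrt ?normr_ge0.
have /choice[p Ip] := part_ne HI.
pose F q := `|s (p q.1, p q.2)| + `|c q|; pose H := \sum_q F q.
have F0 q : 0 <= F q by rewrite addr_ge0.
have FH q : F q <= H by rewrite /H (bigD1 q) //= lerDl sumr_ge0.
have cH q : c q <= H by rewrite (le_trans (ler_norm _)) // (le_trans _ (FH q)) // lerDr.
exists H; split.
- exact: sumr_ge0.
- move=> x y x01 y01; have [l lx] := part_cover HI x01; have [k ky] := part_cover HI y01.
  apply: (le_trans _ (FH (l, k))).
  rewrite -[s (x, y)](subrK (s (p l, p k))) addrC (le_trans (ler_normD _ _)) // lerD2l.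
  apply: (le_trans (hc (l, k) x y (p l) (p k) lx ky (Ip l) (Ip k))).
  have d1 a b : 0 <= a <= 1 -> 0 <= b <= 1 -> `|a - b| <= 1 :> R.
    by move=> /andP[a0 a1] /andP[b0 b1]; rewrite ler_norml; apply/andP; split; lra.
  apply: (@le_trans _ _ (`|c (l, k)| * Num.sqrt (Num.max `|x - p l| `|y - p k|))).
    by rewrite ler_wpM2r ?sqrtr_ge0 // ler_norm.
  rewrite ler_piMr // -[leRHS]sqrtr1 ler_wsqrtr // ge_max !d1 //; exact: (part_sub HI (Ip _)).
- move=> l x x' y y01 lx lx'; have [k ky] := part_cover HI y01.
  apply: (le_trans (hc (l, k) x y x' y lx ky lx' ky)); rewrite subrr normr0 max_l //.
  by rewrite ler_wpM2r ?sqrtr_ge0.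
- move=> k x y y' x01 ky ky'; have [l lx] := part_cover HI x01.
  apply: (le_trans (hc (l, k) x y x y' lx ky lx ky')); rewrite subrr normr0 max_r //.
  by rewrite ler_wpM2r ?sqrtr_ge0.
Qed.

Lemma kern_mono k H H' : H <= H' -> kern I k H -> kern I k H'.
Proof.
move=> HH [a b c e]; split.
- exact: le_trans a HH.
- by move=> x y x01 y01; rewrite (le_trans (b x y x01 y01)).
- by move=> l x x' y y01 lx lx'; rewrite (le_trans (c l x x' y y01 lx lx')) // ler_wpM2r ?sqrtr_ge0.
- by move=> l x y y' x01 ly ly'; rewrite (le_trans (e l x y y' x01 ly ly')) // ler_wpM2r ?sqrtr_ge0.
Qed.

Lemma hoelder_pwh (f : R -> C) : (forall l, hoelder_on 2^-1 (I l) (f : R -> Rcomplex R)) -> pwh I f.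
Proof.
move=> hf; have /choice[c hc] : forall l, exists c, forall x y, I l x -> I l y ->
    cabs (f x - f y) <= c * Num.sqrt `|x - y|.
  move=> l; have [c hc] := hf l; exists c => x y lx ly.
  by have := hc x y lx ly; rewrite powR12_sqrt ?normr_ge0.
exists (\sum_l `|c l|); first exact: sumr_ge0.
move=> l x y lx ly; rewrite (le_trans (hc l x y lx ly)) // ler_wpM2r ?sqrtr_ge0 //.
by rewrite (bigD1 l) //= (le_trans (ler_norm _)) // lerDl sumr_ge0.
Qed.

Lemma pwh_conj (f : R -> C) : pwh I f -> pwh I (fun x => Num.conj (f x)).
Proof. by move=> [c c0 hc]; exists c => // l x y lx ly; rewrite -rmorphB /= cabsJ; exact: hc lx ly. Qed.

Lemma hermsymmx_adj n (A : 'M[C]_n) : A \is hermsymmx -> A^t* = A.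
Proof. by move=> /is_hermitianmxP; rewrite expr0 scale1r => {2}->. Qed.

(** One index for each alpha, two for each beta: the flag tells the summand
with the adjoint of beta on the left from the other one, and the involution exchanges them. *)
Definition kJ : finType := ('I_l1 + 'I_l2 * bool)%type.
Definition kc (j : kJ) : 'M[C]_K := match j with
  | inl mu => kd_alpha d mu
  | inr p => if p.2 then (kd_beta d p.1)^t* else kd_beta d p.1 end.
Definition kk (j : kJ) (x y : R) : R := match j with
  | inl mu => kd_s d mu (x, y)
  | inr p => if p.2 then kd_t d p.1 (y, x) else kd_t d p.1 (x, y) end.
Definition ks (j : kJ) : kJ := match j with
  | inl mu => inl mu
  | inr p => inr (p.1, ~~ p.2) end.

(** The hermitian part of a: it agrees with a almost everywhere, and is hermitian everywhere. *)
Definition ka (x : R) : 'M[C]_K := 2%:R^-1 *: (kd_a d x + (kd_a d x)^t*).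

Lemma ka_herm x : (ka x)^t* = ka x.
Proof.
apply/matrixP => i j; rewrite adj_mxE !mxE rmorphM rmorphD /= conjCK fmorphV rmorph_nat.
by rewrite addrC.
Qed.

Lemma kd_aE x : kd_a d x \is hermsymmx -> ka x = kd_a d x.
Proof.
move=> /hermsymmx_adj e; rewrite /ka e -mulr2n -[kd_a d x *+ 2]scaler_nat scalerA mulVf ?scale1r //.
Qed.

Lemma ka_pwh i j : pwh I (fun x => ka x i j).
Proof.
have [_ _ _ _ ha] := HP.
under eq_fun do rewrite mxE [X in _ * X]mxE adj_mxE.
apply: (pwhZ HI); apply: pwhD; first by apply: hoelder_pwh => l; exact: ha.
by apply: pwh_conj; apply: hoelder_pwh => l; exact: ha.
Qed.

Lemma kd_model : exists md : model I K, md_a md = ka /\ forall r x, SE md r x = self_energy d r x.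
Proof.
have [hal hs ht _ _] := HP.
have /choice[H0 hH0] : forall j, exists H, kern I (kk j) H.
  case=> [mu|[nu b]].
    by have [_ _ h] := hs mu; have [H hH] := hoelder_kern h; exists H.
  have [_ h] := ht nu; have [H hH] := hoelder_kern h; exists H.
  by case: b => //; exact: (kern_swap hH).
pose H := \sum_j `|H0 j|.
have hH j : kern I (kk j) H.
  apply: kern_mono (hH0 j); rewrite /H (bigD1 j) //= (le_trans (ler_norm _)) // lerDl.
  exact: sumr_ge0.
have k0 j x y : 0 <= x <= 1 -> 0 <= y <= 1 -> 0 <= kk j x y.
  case: j => [mu|[nu []]] x01 y01 /=; [have [h _ _] := hs mu|have [h _] := ht nu|have [h _] := ht nu]; exact: h.
have ksK : involutive ks by case=> [mu|[nu b]] //=; rewrite negbK.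
have kks j x y : 0 <= x <= 1 -> 0 <= y <= 1 -> kk (ks j) x y = kk j y x.
  case: j => [mu|[nu []]] x01 y01 //=; have [_ h _] := hs mu; exact: h.
have kcs j : kc (ks j) = (kc j)^t*.
  case: j => [mu|[nu []]] /=; [by rewrite hermsymmx_adj|by rewrite adjmxK|by []].
exists (Model HI hH k0 ksK kks kcs ka_pwh (fun x _ => ka_herm x)); split=> // r x.
rewrite /SE /= /self_energy /tensor_lift.
have E (j : kJ) : kc j *m mkop (kk j) r x *m (kc j)^t* = \sum_p \sum_q
    kop (kk j) (fun y => r y p q) x *: (kc j *m delta_mx p q *m (kc j)^t*).
  rewrite [mkop _ _ _]matrix_sum_delta mulmx_sumr mulmx_suml; apply: eq_bigr => p _.
  rewrite mulmx_sumr mulmx_suml; apply: eq_bigr => q _.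
  by rewrite -scalemxAr -scalemxAl mxE.
rewrite (eq_bigr _ (fun j _ => E j)) exchange_big; apply: eq_bigr => p _.
rewrite exchange_big; apply: eq_bigr => q _ /=.
rewrite big_sumType /=; congr (_ + _).
  by apply: eq_bigr => mu _; rewrite (hermsymmx_adj (hal mu)).
rewrite -(pair_bigA _ (fun (nu : 'I_l2) (b : bool) => kop (kk (inr (nu, b))) (fun y => r y p q) x *:
   (kc (inr (nu, b)) *m delta_mx p q *m (kc (inr (nu, b)))^t*))) /=.
by apply: eq_bigr => nu _; rewrite big_bool /= addrC adjmxK.
Qed.
End Model.

Section Solution.
Context {R : realType} (K L : nat) (I : 'I_L -> set R) (md : model I K).
Notation C := R[i].
Local Notation HI := (md_part md).
Local Notation U := (`[0 : R, 1]%classic).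

Lemma kop_null k H f g N x : kern I k H -> cmeas f -> cmeas g -> null N ->
  (forall y, 0 <= y <= 1 -> ~ N y -> f y = g y) -> 0 <= x <= 1 -> kop k f x = kop k g x.
Proof.
move=> kH mf mg nN fg x01; have mk := pwr_meas HI (kern_pwr kH x01).
apply: (cI_null (cmeas_kern mk mf) (cmeas_kern mk mg) nN) => y y01 ny; by rewrite fg.
Qed.

Lemma SE_null (r s : R -> 'M[C]_K) N x : (forall i j, cmeas (fun x => r x i j)) ->
  (forall i j, cmeas (fun x => s x i j)) -> null N ->
  (forall y, 0 <= y <= 1 -> ~ N y -> r y = s y) -> 0 <= x <= 1 -> SE md r x = SE md s x.
Proof.
move=> mr ms nN rs x01; apply: eq_bigr => j _; congr (_ *m _ *m _); apply/matrixP => p q; rewrite !mxE.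
by apply: (kop_null (md_kern j) (mr p q) (ms p q) nN) => // y y01 ny; rewrite rs.
Qed.

Lemma pwh_ninv (G : R -> 'M[C]_K) c : 0 < c -> mpwh I G -> (forall x, 0 <= x <= 1 -> imge c (G x)) ->
  mpwh I (fun x => - invmx (G x)).
Proof.
move=> c0 pG iG; have [h h0 hG] := mpwh_holder pG.
have ci : 0 <= c^-1 by rewrite invr_ge0 ltW.
move=> i j; exists (K%:R * (K%:R * (c^-1 * h) * c^-1)); first by rewrite !mulr_ge0.
move=> l x y lx ly; have ix := iG x (part_sub HI lx); have iy := iG y (part_sub HI ly).
have ed (A B : 'M[C]_K) : (- A) i j - (- B) i j = (- (A - B)) i j by rewrite !mxE opprD.
rewrite ed (invmxB (imge_unit c0 ix) (imge_unit c0 iy)) opprK.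
have b1 := mxle_mul ci (mxle_invmx c0 ix) (hG l x y lx ly).
have b2 := mxle_mul (mulr_ge0 (ler0n R K) (mulr_ge0 ci (mulr_ge0 h0 (sqrtr_ge0 _)))) b1
  (mxle_invmx c0 iy).
apply: (le_trans (b2 i j)); rewrite le_eqVlt; apply/orP; left; apply/eqP; ring.
Qed.

(** Set m to 0 on a null set off which all the hypotheses hold, and let G be formed from the
result. S does not see null sets, so G is defined and accretive at every point, and
M = - G^-1 is piecewise Hoelder because S is smoothing. Off the null set M = m, hence S[M]
is S[m] everywhere and M solves the equation at every point. *)
Lemma sol_of_ae z (m : R -> 'M[C]_K) : 0 < complex.Im z -> linfty_mx m ->
  (\forall x \ae leb R, 0 <= x <= 1 ->
     (forall v, 0 <= complex.Im (dot v (m x *m v))) /\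
     (m x \in unitmx /\ - invmx (m x) = z%:M - md_a md x + SE md m x)) ->
  exists2 M, sol md z M & cI (fun x => \tr (M x)) = K%:R * tracial_state m.
Proof.
move=> z0 lm hae.
have /choice[B hB] : forall p : 'I_K * 'I_K, exists B, \forall x \ae leb R,
    0 <= x <= 1 -> cabs (m x p.1 p.2) <= B.
  by move=> p; have [_ _ [B hB]] := lm p.1 p.2; exists B.
have hB' := @filter_forall _ _ _ _ (ae_filter_ringOfSetsType (leb R)) hB.
have /ae_null[N nN hN] := @filterI _ _ (ae_filter_ringOfSetsType (leb R)) _ _ hae hB'.
have mm i j : cmeas (fun x => m x i j) by have [a b _] := lm i j.
pose mb x : 'M[C]_K := if x \in N then 0 else m x.
have mbE x : ~ N x -> mb x = m x by move=> nx; rewrite /mb memNset.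
have cb i j : cbm (fun x => mb x i j).
  have [mr mi] := mm i j; have mI : measurable_fun U (\1_(~` N) : R -> R).
    by apply: measurable_indic; apply: measurableC; case: nN.
  have e x : mb x i j = ((\1_(~` N) x : R)%:C) * m x i j.
    rewrite /mb indicE in_setC; case: (x \in N); first by rewrite mxE mul0r.
    by rewrite mul1r.
  have bd x : 0 <= x <= 1 -> cabs (mb x i j) <= `|B (i, j)|.
    move=> x01; have [xN|xN] := boolP (x \in N); first by rewrite /mb xN mxE cabs0.
    have nx : ~ N x by move=> /mem_set h; rewrite h in xN.
    by rewrite mbE //; have [_ /(_ (i, j) x01) h] := hN x nx; rewrite (le_trans h) // ler_norm.
  split; split.
  - apply: (eq_measurable_fun (fun x => (\1_(~` N) x : R) * complex.Re (m x i j))).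
      by move=> x _; rewrite e ReMc.
    exact: measurable_funM.
  - exists `|B (i, j)| => x; rewrite /= in_itv /= => /bd; apply: le_trans; exact: le_Re_cabs.
  - apply: (eq_measurable_fun (fun x => (\1_(~` N) x : R) * complex.Im (m x i j))).
      by move=> x _; rewrite e ImMc.
    exact: measurable_funM.
  - exists `|B (i, j)| => x; rewrite /= in_itv /= => /bd; apply: le_trans; exact: le_Im_cabs.
have mcb i j : cmeas (fun x => mb x i j) by have [[a _] [b _]] := cb i j.
have mb0 y : 0 <= y <= 1 -> forall u, 0 <= complex.Im (dot u (mb y *m u)).
  move=> y01 u; have [yN|yN] := boolP (y \in N).
    by rewrite /mb yN mul0mx /dot mulmx0 mxE.
  have ny : ~ N y by move=> /mem_set h; rewrite h in yN.
  by rewrite mbE //; have [/(_ y01)[h _] _] := hN y ny; exact: h.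
have SEb x : 0 <= x <= 1 -> SE md m x = SE md mb x.
  by move=> x01; apply: (SE_null mm mcb nN) => // y _ ny; rewrite mbE.
have pG : mpwh I (Gf md z mb).
  apply: mpwhD; last exact: (mpwh_SE md).
  by apply: mpwhD; [exact: mpwh_cst|apply: mpwhN; exact: md_pwh].
have iG x : 0 <= x <= 1 -> imge (complex.Im z) (Gf md z mb x).
  by move=> x01 u; rewrite Im_Gf // lerDl; apply: SE_im_ge0.
pose M x := - invmx (Gf md z mb x).
have pM : mpwh I M by exact: (pwh_ninv z0 pG iG).
have mM i j : cmeas (fun x => M x i j) by have [[a _] [b _]] := pwh_cbm HI (pM i j).
have Mm x : 0 <= x <= 1 -> ~ N x -> M x = m x.
  move=> x01 nx; have [/(_ x01)[_ [um em]] _] := hN x nx.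
  have e : Gf md z mb x = - invmx (m x) by rewrite em (SEb x x01).
  have := ninv_Amul z0 (iG x x01); rewrite -/(M x) e mulmxN => /oppr_inj d.
  by rewrite -[LHS]mulmx1 -(mulVmx um) mulmxA d mul1mx.
have GM x : 0 <= x <= 1 -> Gf md z M x = Gf md z mb x.
  move=> x01; rewrite /Gf; congr (_ + _); apply: (SE_null mM mcb nN) => // y y01 ny.
  by rewrite Mm // mbE.
exists M.
  split; [exact: pM|move=> x x01; rewrite (GM x x01); exact: iG|move=> x x01; rewrite (GM x x01)].
  exact: (ninv_Amul z0 (iG x x01)).
rewrite /tracial_state /tensor_lift mulr_sumr cI_sum => [|i]; last exact: (pwh_cbm HI).
have trd (i j : 'I_K) : \tr (delta_mx i j : 'M[C]_K) = (i == j)%:R.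
  rewrite /mxtrace (bigD1 i) //= big1 ?addr0 => [|k ki]; first by rewrite mxE eqxx.
  by rewrite mxE (negbTE ki).
apply: eq_bigr => i _; rewrite (bigD1 i) //= big1 => [|j ji]; last first.
  by rewrite trd eq_sym (negbTE ji) !mul0r.
have K0 : K%:R != 0 :> C by rewrite pnatr_eq0 -lt0n (leq_trans _ (ltn_ord i)).
rewrite addr0 trd eqxx div1r mulVKf //.
by apply: (cI_null (mM i i) (mm i i) nN) => x x01 nx; rewrite Mm.
Qed.
End Solution.

Section Connection.
Context {R : realType} (K L l1 l2 : nat) (I : 'I_L -> set R) (d : kronecker_data R K l1 l2).
Notation C := R[i].

Lemma dos_model (rho : probability (measurableTypeR R) R) : interval_partition I ->
  piecewise_hoelder I d -> self_consistent_dos d rho ->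
  exists md : model I K, forall tau eta, 0 < eta -> exists2 M, sol md (tau +i* eta) M &
    cI (fun x => \tr (M x)) = K%:R * stieltjes rho (tau +i* eta).
Proof.
move=> HI HP [m dm rm]; have [md [mda mdS]] := kd_model HI HP; exists md => tau eta e0.
have z0 : 0 < complex.Im (tau +i* eta) by [].
have [lm [eps e1 pm] eqm] := dm _ z0; have [_ _ _ ha _] := HP.
have aef := ae_filter_ringOfSetsType (leb R).
have := @filterI _ _ aef _ _ pm (@filterI _ _ aef _ _ eqm ha).
move=> hae; rewrite -rm //; apply: sol_of_ae => //.
apply: (@filterS _ _ aef _ _ _ hae) => x /= [p [e h]] x01.
have [u ->] := e x01; split; first by move=> v; exact: psd_im e1 (p x01).
by rewrite mda kd_aE ?mdS // h.
Qed.

Theorem dos_gap_mass (rho : probability (measurableTypeR R) R) (tau : R) : (0 < K)%N ->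
  interval_partition I -> piecewise_hoelder I d -> self_consistent_dos d rho ->
  ~ msupport rho tau ->
  exists2 k : 'I_L -> nat, (forall l, (k l <= K)%N) &
    rho `]-oo, tau[%classic = (K%:R^-1 * \sum_l (k l)%:R * fine (leb R (I l)))%:E.
Proof.
move=> K0 HI HP hr ns; have [md hmd] := dos_model HI HP hr.
have [k kK hk] := gap_mass K0 (hmd tau) ns; exists k => //.
by rewrite -hk fineK //; apply: fin_num_measure; exact: measurable_itv.
Qed.
End Connection.

(** * Connected components of the support *)

Section Support.
Context {R : realType} (rho : probability (measurableTypeR R) R).
Local Notation S := (msupport rho).
Definition pm (A : set R) : R := fine (rho A).

(** Every point outside the support lies in a null interval with rational end points, and there
are countably many of them. *)
Lemma support_null (A : set R) : measurable (A : set (measurableTypeR R)) -> A `<=` ~` S -> rho A = 0%E.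
Proof.
move=> mA AS; apply/(negligibleP _ mA).
pose F (n : nat) : set (measurableTypeR R) := match @unpickle (rat * rat)%type n with
  | Some (p, q) => if rho `]ratr p, ratr q[%classic == 0%E then `]ratr p, ratr q[%classic else set0
  | None => set0 end.
have nF n : rho.-negligible (F n).
  rewrite /F; case: unpickle => [[p q]|]; last exact: negligible_set0.
  case: eqP => [e|_]; last exact: negligible_set0.
  by apply/negligibleP => //; exact: measurable_itv.
apply: negligibleS (negligible_bigcup nF) => x Ax.
have [e e0 re] := gap_ball (AS x Ax).
have [p] := @rat_in_itvoo R (x - e) x ltac:(lra); rewrite in_itv /= => /andP[p1 p2].
have [q] := @rat_in_itvoo R x (x + e) ltac:(lra); rewrite in_itv /= => /andP[q1 q2].
have FE : F (pickle (p, q)) = if rho `]ratr p, ratr q[%classic == 0%E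
    then `]ratr p, ratr q[%classic else set0 by rewrite /F pickleK.
exists (pickle (p, q)); first exact: I.
rewrite FE; have -> : rho `]ratr p, ratr q[%classic == 0%E.
  rewrite eq_le measure_ge0 andbT -re; apply: le_measure; rewrite ?inE; try exact: measurable_itv.
  move=> y /=; rewrite !in_itv /= => /andP[y1 y2].
  by rewrite (lt_trans p1 y1) (lt_trans y2 q2).
by rewrite /= in_itv /= p2 q1.
Qed.

Lemma pm_le (A B : set (measurableTypeR R)) : measurable A -> measurable B -> A `<=` B -> pm A <= pm B.
Proof.
move=> mA mB AB; apply: fine_le; [exact: fin_num_measure|exact: fin_num_measure|].
by apply: le_measure; rewrite ?inE.
Qed.

Lemma pmU (A B : set (measurableTypeR R)) : measurable A -> measurable B -> A `&` B = set0 ->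
  pm (A `|` B) = pm A + pm B.
Proof.
move=> mA mB AB; by rewrite /pm measureU // fineD //; exact: fin_num_measure.
Qed.

Lemma pm_split (A B : set (measurableTypeR R)) : measurable A -> measurable B -> A `<=` B ->
  pm B = pm A + pm (B `\` A).
Proof.
move=> mA mB AB; rewrite -pmU //; last 2 first.
- exact: measurableD.
- by apply/seteqP; split=> x // [xA [_]].
by congr pm; apply/seteqP; split=> x; [move=> xB; have [xA|xA] := pselect (A x); [left|right]|case=> [/AB|[]]].
Qed.

Lemma pm_null_ext (A B : set (measurableTypeR R)) : measurable A -> measurable B -> A `<=` B ->
  (forall x, B x -> ~ A x -> ~ S x) -> pm A = pm B.
Proof.
move=> mA mB AB h; rewrite (pm_split mA mB AB) [X in _ + X](_ : _ = 0) ?addr0 //.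
rewrite /pm support_null //; first exact: measurableD.
by move=> x [Bx nAx]; exact: h.
Qed.

Lemma pm_open (U : set R) x : open U -> U x -> S x -> 0 < pm U.
Proof.
move=> oU Ux Sx; apply: fine_gt0; rewrite Sx //= ltey_eq fin_num_measure //.
exact: open_measurable.
Qed.

Lemma pmT : pm setT = 1. Proof. exact: (congr1 fine (probability_setT rho)). Qed.

Lemma mlow (t : R) : measurable (`]-oo, t[%classic : set (measurableTypeR R)).
Proof. exact: measurable_itv. Qed.

(** An open neighbourhood of a point of the support has positive mass. *)
Lemma pm_low_eq (s t y : R) : s < y -> y < t -> pm `]-oo, t[%classic <= pm `]-oo, s[%classic -> ~ S y.
Proof.
move=> sy yt h Sy; have : 0 < pm `]s, t[%classic.
  by apply: (@pm_open _ y) => //=; rewrite in_itv /= sy yt.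
rewrite ltNge => /negP; apply.
have mst : measurable (`]s, t[%classic : set (measurableTypeR R)) by exact: measurable_itv.
have dis : `]-oo, s[%classic `&` `]s, t[%classic = set0 :> set (measurableTypeR R).
  apply/seteqP; split=> x //=; rewrite !in_itv /= => -[a /andP[b _]].
  by have := lt_trans a b; rewrite ltxx.
have := pm_le (measurableU _ _ (mlow s) mst) (mlow t).
rewrite (pmU (mlow s) mst dis) => /(_ _)H.
have /H : (`]-oo, s[%classic `|` `]s, t[%classic : set R) `<=` `]-oo, t[%classic.
  move=> x [|] /=; rewrite !in_itv /=; last by case/andP.
  by move=> xs; rewrite (lt_trans xs) // (lt_trans sy).
by move: h; lra.
Qed.

Section Component.
Variables (K : nat).
Hypothesis K0 : (0 < K)%N.
Hypothesis hgap : forall tau, ~ S tau -> exists2 k, (k <= K)%N & pm `]-oo, tau[%classic = k%:R / K%:R.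
Variable (x : R).
Hypothesis Sx : S x.
Local Notation J := (connected_component S x).

Definition leftof (A : set R) : set R := [set y | forall z, A z -> y < z].

Let iJ : is_interval J.
Proof. by apply/connected_intervalP; exact: component_connected. Qed.
Let Jx : J x. Proof. exact: connected_component_refl. Qed.

(** The segment is connected. *)
Lemma comp_absorb a b : a <= b -> (J a \/ J b) -> (forall c, a <= c <= b -> S c) -> J a /\ J b.
Proof.
move=> ab Jab sub; have ci : connected `[a, b]%classic by apply/connected_intervalP; exact: interval_is_interval.
have subS : `[a, b]%classic `<=` S by move=> c; rewrite /= in_itv /=; exact: sub.
have ea : `[a, b]%classic a by rewrite /= in_itv /= lexx.
have eb : `[a, b]%classic b by rewrite /= in_itv /= lexx andbT.
case: Jab => h; split => //.
  exact: connected_component_trans h (connected_component_max ea subS ci eb).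
exact: connected_component_trans h (connected_component_max eb subS ci ea).
Qed.

Lemma mleft (A : set R) : measurable (leftof A : set (measurableTypeR R)).
Proof.
apply: is_interval_measurable => a b La Lb c /andP[_ cb] z Az; exact: le_lt_trans cb (Lb z Az).
Qed.

(** Otherwise the segment from y to x would lie in the support and y would belong to the
component. *)
Lemma gap_left y : leftof J y -> exists2 tau, ~ S tau & leftof J tau /\ y <= tau.
Proof.
move=> Ly; apply: contrapT => hn; have yx := Ly x Jx.
have sub c : y <= c <= x -> S c.
  move=> /andP[yc cx]; have [Jc|nJc] := pselect (J c); first exact: (connected_component_sub Jc).
  apply: contrapT => nSc; apply: hn; exists c => //; split=> // z Jz.
  rewrite ltNge; apply/negP => zc; apply: nJc; apply: (iJ Jz Jx); by rewrite zc.
have [Jy _] := comp_absorb (ltW yx) (or_intror Jx) sub.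
by have := Ly y Jy; rewrite ltxx.
Qed.

Lemma gap_right y : ~ J y -> x < y -> exists2 tau, ~ S tau & x < tau <= y.
Proof.
move=> nJy xy; apply: contrapT => hn.
have sub c : x <= c <= y -> S c.
  move=> /andP[xc cy]; apply: contrapT => nSc; apply: hn; exists c => //.
  rewrite cy andbT lt_neqAle xc andbT; apply/eqP => xc'; apply: nSc; by rewrite -xc'.
by have [_] := comp_absorb (ltW xy) (or_introl Jx) sub.
Qed.

(** Among the points of the complement to the left of the component, take one, s, for which the
mass to its left is maximal; this is possible because the masses are multiples of 1/K. By
[gap_left] nothing of the support lies between s and the component. The strict inequality
is the separation property that makes components comparable. *)
Lemma left_mass : exists2 k, (k <= K)%N & pm (leftof J) = k%:R / K%:R /\
  forall t, x < t -> pm (leftof J) < pm `]-oo, t[%classic.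
Proof.
have KR : 0 < K%:R :> R by rewrite ltr0n.
have [[t0 [Lt0 nSt0]]|hn] := pselect (exists t, leftof J t /\ ~ S t); last first.
  have e0 : leftof J = set0.
    apply/seteqP; split=> y // /gap_left[tau nS [Lt _]]; by apply: hn; exists tau.
  exists 0%N => //; rewrite /pm e0 measure0 /= mul0r; split=> // t xt.
  by rewrite -/(pm _); apply: (@pm_open _ x) => //=; rewrite ?in_itv.
pose P k := `[< exists t, [/\ leftof J t, ~ S t & pm `]-oo, t[%classic = k%:R / K%:R] >].
have exP : exists k, P k.
  have [k _ e] := hgap nSt0; exists k; apply/asboolP; by exists t0.
have ubP k : P k -> (k <= K)%N.
  move=> /asboolP[t [_ nS e]]; have [k' k'K e'] := hgap nS.
  suff : k%:R = k'%:R :> R by move=> /eqP; rewrite eqr_nat => /eqP ->.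
  by apply: (mulIf (invr_neq0 (lt0r_neq0 KR))); rewrite -e -e'.
have [k /asboolP[s [Ls nSs es]] kmax] := ex_maxnP exP ubP.
have eL : pm (leftof J) = pm `]-oo, s[%classic.
  apply/esym/pm_null_ext; [exact: mlow|exact: mleft| |].
    by move=> y /=; rewrite in_itv /= => ys z Jz; rewrite (lt_trans ys) ?Ls.
  move=> y Ly; rewrite /= in_itv /= => /negP; rewrite -leNgt => sy Sy.
  have [t nSt [Lt yt]] := gap_left Ly.
  have yt' : y < t by rewrite lt_neqAle yt andbT; apply/eqP => yt'; apply: nSt; rewrite -yt'.
  have sy' : s < y by rewrite lt_neqAle sy andbT; apply/eqP => sy'; apply: nSs; rewrite sy'.
  apply: (pm_low_eq sy' yt') Sy.
  have [k' _ e'] := hgap nSt; rewrite es e' ler_pM2r ?invr_gt0 // ler_nat kmax //.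
  by apply/asboolP; exists t.
exists k; first by apply: ubP; apply/asboolP; exists s.
split=> [|t xt]; first by rewrite eL.
rewrite eL ltNge; apply/negP => h; exact: (pm_low_eq (Ls x Jx) xt h).
Qed.

(** Same argument as for [left_mass], from the right and with a minimal mass. *)
Lemma upto_mass : exists2 k, (k <= K)%N & pm (leftof J `|` J) = k%:R / K%:R.
Proof.
have KR : 0 < K%:R :> R by rewrite ltr0n.
have mJ : measurable (J : set (measurableTypeR R)) by exact: is_interval_measurable.
have mU : measurable (leftof J `|` J : set (measurableTypeR R)) by apply: measurableU; [exact: mleft|].
have upE y : ~ (leftof J `|` J) y -> x < y /\ ~ J y.
  move=> nU; have nJ : ~ J y by move=> h; apply: nU; right.
  split=> //; rewrite ltNge; apply/negP => yx; apply: nU; left=> z Jz.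
  rewrite ltNge; apply/negP => zy; apply: nJ; apply: (iJ Jz Jx); by rewrite zy.
have [[t0 [Lt0 nSt0]]|hn] := pselect (exists t, ~ (leftof J `|` J) t /\ ~ S t); last first.
  have e0 : leftof J `|` J = setT.
    apply/seteqP; split=> y // _; apply: contrapT => nU.
    have [xy nJ] := upE y nU; have [tau nS /andP[xt ty]] := gap_right nJ xy.
    apply: hn; exists tau; split=> //; case=> [/(_ x Jx)|/connected_component_sub //].
    by rewrite ltNge (ltW xt).
  by exists K => //; rewrite e0 pmT divff // gt_eqF.
pose P k := `[< exists t, [/\ ~ (leftof J `|` J) t, ~ S t & pm `]-oo, t[%classic = k%:R / K%:R] >].
have exP : exists k, P k.
  have [k _ e] := hgap nSt0; exists k; apply/asboolP; by exists t0.
have [k /asboolP[s [Ls nSs es]] kmin] := ex_minnP exP.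
have [xs nJs] := upE s Ls.
have sJ z : J z -> z < s.
  move=> Jz; rewrite ltNge; apply/negP => sz; apply: nJs; apply: (iJ Jx Jz); by rewrite (ltW xs).
exists k.
  have [k' k'K e'] := hgap nSs; suff -> : k = k' by [].
  suff : k%:R = k'%:R :> R by move=> /eqP; rewrite eqr_nat => /eqP ->.
  by apply: (mulIf (invr_neq0 (lt0r_neq0 KR))); rewrite -es -e'.
rewrite -es; apply: pm_null_ext; [exact: mU|exact: mlow| |].
  move=> y [Ly|Jy] /=; rewrite in_itv /=; last exact: sJ.
  exact: lt_trans (Ly x Jx) xs.
move=> y; rewrite /= in_itv /= => ys nU Sy; have [xy nJ] := upE y nU.
have [t nSt /andP[xt ty]] := gap_right nJ xy.
have ty' : t < y by rewrite lt_neqAle ty andbT; apply/eqP => e; apply: nSt; rewrite e.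
apply: (pm_low_eq ty' ys) Sy.
have [k' _ e'] := hgap nSt; rewrite es e' ler_pM2r ?invr_gt0 // ler_nat kmin //.
apply/asboolP; exists t; split=> //; case=> [/(_ x Jx)|/connected_component_sub //].
by rewrite ltNge (ltW xt).
Qed.

Lemma component_mass : exists n : int, rho J = (n%:~R / K%:R)%:E.
Proof.
have mJ : measurable (J : set (measurableTypeR R)) by exact: is_interval_measurable.
have [k _ [ek _]] := left_mass; have [k' _ ek'] := upto_mass.
exists (k'%:Z - k%:Z); rewrite -[LHS]fineK; last exact: fin_num_measure.
have := pmU (mleft J) mJ; rewrite ek' ek => e; congr EFin.
rewrite intrB mulrBl -[k'%:~R]/(k'%:R) -[k%:~R]/(k%:R) e; last first.
  by apply/seteqP; split=> y // -[/[apply]]; rewrite ltxx.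
by rewrite addrAC subrr add0r.
Qed.
End Component.

(** The number K rho (left of J) separates components: a gap lies between two of them, and
[left_mass] makes the mass jump strictly across the first one. The same strict
inequality keeps it below K. *)
Lemma components_card (K : nat) : (0 < K)%N ->
  (forall tau, ~ S tau -> exists2 k, (k <= K)%N & pm `]-oo, tau[%classic = k%:R / K%:R) ->
  components S #<= `I_K.
Proof.
move=> K0 hgap; have KR : 0 < K%:R :> R by rewrite ltr0n.
(* An integer for components; truncation only gives the function a type. *)
pose f (A : set R) : nat := Num.truncn (K%:R * pm (leftof A)).
have fE x k : pm (leftof (connected_component S x)) = k%:R / K%:R ->
    f (connected_component S x) = k.
  by move=> e; rewrite /f e mulrC divfK ?gt_eqF // natrK.
have lt x y : S x -> S y -> x < y -> connected_component S x <> connected_component S y ->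
    (f (connected_component S x) < f (connected_component S y))%N.
  move=> Sx Sy xy ne.
  have nJy : ~ connected_component S x y by move=> /same_connected_component.
  have [t nSt /andP[xt ty]] := gap_right Sx nJy xy.
  have [k _ [ek hk]] := left_mass K0 hgap Sx; have [k' _ [ek' _]] := left_mass K0 hgap Sy.
  rewrite (fE _ _ ek) (fE _ _ ek'); have := hk t xt.
  have tl : `]-oo, t[%classic `<=` leftof (connected_component S y).
    move=> s /=; rewrite in_itv /= => st z Jz; rewrite (lt_trans st) // ltNge; apply/negP => zt.
    apply: nSt; apply: (@connected_component_sub _ S y).
    have /connected_intervalP ci : connected (connected_component S y) by exact: component_connected.
    by apply: (ci z y Jz (connected_component_refl Sy)); rewrite zt ty.
  move=> /lt_le_trans/(_ (pm_le (mlow t) (mleft _) tl)).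
  by rewrite ek ek' ltr_pM2r ?invr_gt0 // ltr_nat.
have inj : {in components S &, injective f}.
  move=> A B /set_mem[x Sx <-] /set_mem[y Sy <-] e; apply: contrapT => ne.
  case: (ltgtP x y) => [xy|yx|xy]; last by rewrite xy in ne.
  - by have := lt x y Sx Sy xy ne; rewrite e ltnn.
  - by have := lt y x Sy Sx yx (fun e => ne (esym e)); rewrite e ltnn.
rewrite -(card_le_eql (inj_card_eq inj)); apply: subset_card_le => k [A [x Sx <-] <-] /=.
have [k' _ [ek' hk']] := left_mass K0 hgap Sx; rewrite (fE _ _ ek').
have := hk' (x + 1) ltac:(by rewrite ltrDl).
have := pm_le (mlow (x + 1)) (@measurableT _ (measurableTypeR R)) (@subsetT _ _).
rewrite pmT ek' => h1 h2; have := lt_le_trans h2 h1.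
by rewrite ltr_pdivrMr // mul1r ltr_nat.
Qed.
End Support.

Theorem corollary9p4 (R : realType) (K L l1 l2 : nat) (I : 'I_L -> set R)
    (d : kronecker_data R K l1 l2) (rho : probability (measurableTypeR R) R) :
  (0 < K)%N -> (0 < L)%N ->
  interval_partition I ->
  piecewise_hoelder I d ->
  self_consistent_dos d rho ->
  (forall tau : R, ~ msupport rho tau ->
     exists2 k : 'I_L -> nat, (forall l, (k l <= K)%N) &
       rho `]-oo, tau[%classic =
         (K%:R^-1 * \sum_(l < L) (k l)%:R * fine (leb R (I l)))%:E) /\
  (L = 1%N ->
     (forall J : set R, components (msupport rho) J ->
        exists n : int, rho J = (n%:~R / K%:R)%:E) /\
     components (msupport rho) #<= `I_K).
Proof.
move=> K0 _ HI HP hr; split=> [tau ns|L1]; first exact: dos_gap_mass HP hr ns.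
have [md _] := dos_model HI HP hr; have sl := sum_leb md.
have hgap tau : ~ msupport rho tau ->
    exists2 k, (k <= K)%N & pm rho `]-oo, tau[%classic = k%:R / K%:R.
  move=> ns; have [k kK e] := dos_gap_mass K0 HI HP hr ns.
  subst L; exists (k ord0); first exact: kK.
  move: sl; rewrite /pm e /= !big_ord1 => ->; by rewrite mulr1 mulrC.
split; last exact: components_card.
by move=> J [x Sx <-]; exact: (component_mass K0 hgap Sx).
Qed.
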